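(* There is an algorithm that, given a positive integer $q$, an $n$-vertex graph $G$, and a contraction sequence $G=G_n,\dots,G_1$ witnessing that the component twin-width of $G$ is at most $d$ (i.e., every connected component of the red graph of every $G_i$ has at most $d$ vertices), decides whether $G$ admits a proper coloring with $q$ colors (the $q$-Coloring problem), in time $O((2^q-1)^d d^2 n)$.
   Context: A trigraph is a graph whose edges are colored black or red. Contracting two vertices $u,v$ of a trigraph replaces them by a new vertex $w$; for every other vertex $x$, $wx$ is a black edge if both $ux$ and $vx$ were black edges, $wx$ is a red edge if at least one of $ux,vx$ was an edge and not both were black, and there is no edge $wx$ otherwise; the rest of the trigraph is unchanged. A contraction sequence of an $n$-vertex graph $G$ is a sequence of trigraphs $G=G_n,G_{n-1},\dots,G_1$ where $G_i$ has $i$ vertices and is obtained from $G_{i+1}$ by one contraction. The red graph of $G_i$ consists of its vertices and red edges. *)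

(* Defs.v *)
From mathcomp Require Import all_boot.
Set Implicit Arguments. Unset Strict Implicit. Unset Printing Implicit Defensive.

(* Trigraphs whose vertices are named by elements of a ground type V; the
   vertex set varies along a contraction sequence, the ground type does not. *)
Record trigraph (V : finType) := Trigraph {
  vertices : {set V};
  black : rel V;
  red : rel V
}.

Section Trigraphs.
Variable V : finType.
Implicit Types (H : trigraph V) (x y u v w : V).

Definition edge H x y := black H x y || red H x y.

(* The triple (u, v, w) contracts u and v into the new vertex w. *)
Definition contract H (p : V * V * V) : trigraph V :=
  let: (u, v, w) := p in
  let rest := vertices H :\: [set u; v] in
  let black_w x := black H u x && black H v x in
  let red_w x := (edge H u x || edge H v x) && ~~ black_w x in
  let glue (r : rel V) (r_w : pred V) x y :=
    [|| [&& x \in rest, y \in rest & r x y],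
        [&& x == w, y \in rest & r_w y] |
        [&& y == w, x \in rest & r_w x]] in
  {| vertices := w |: rest;
     black := glue (black H) black_w;
     red := glue (red H) red_w |}.

Fixpoint contraction_sequence H (s : seq (V * V * V)) : bool :=
  if s is (u, v, w) :: s' then
    [&& u \in vertices H, v \in vertices H, u != v, w \notin vertices H
      & contraction_sequence (contract H (u, v, w)) s']
  else #|vertices H| == 1.

(* G_n, G_(n-1), ..., G_1 when H = G_n and s is a contraction sequence of H. *)
Definition trigraphs H (s : seq (V * V * V)) : seq (trigraph V) :=
  H :: scanl contract H s.

Definition red_component H x : {set V} :=
  [set y in vertices H | connect (red H) x y].

Definition red_components_le (d : nat) H : bool :=
  [forall x in vertices H, #|red_component H x| <= d].

End Trigraphs.

(* The n vertices of the input graph are the names 0, ..., n-1; the remaining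
   names n, ..., 2n-1 are available for the n-1 vertices created later. *)
Definition name n : finType := 'I_(n + n).

Definition trigraph_of_graph n (e : rel 'I_n) : trigraph (name n) :=
  {| vertices := [set lshift n x | x : 'I_n];
     black := fun a b =>
       [exists x, exists y, [&& a == lshift n x, b == lshift n y & e x y]];
     red := fun _ _ => false |}.

Definition colorable q n (e : rel 'I_n) : bool :=
  [exists c : {ffun 'I_n -> 'I_q},
     [forall x, forall y, e x y ==> (c x != c y)]].

(* Unit-cost random access machine, with structured control flow.  Registers and
   memory cells hold natural numbers, and the only arithmetic is addition and
   truncated subtraction: with unit-cost multiplication on unbounded numbers
   the running times would not be meaningful. *)
Inductive expr :=
  | Lit of nat
  | Reg of nat
  | Mem of expr
  | Add of expr & expr
  | Sub of expr & expr.

Inductive com :=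
  | Skip
  | Assign of nat & expr
  | Store of expr & expr
  | Seq of com & com
  | If of expr & com & com
  | While of expr & com.

Record state := State { reg : nat -> nat; mem : nat -> nat }.

Definition update (f : nat -> nat) (a v : nat) : nat -> nat :=
  fun b => if b == a then v else f b.

Fixpoint eval (st : state) (a : expr) : nat :=
  match a with
  | Lit k => k
  | Reg r => reg st r
  | Mem b => mem st (eval st b)
  | Add b c => eval st b + eval st c
  | Sub b c => eval st b - eval st c
  end.

Fixpoint cost (a : expr) : nat :=
  match a with
  | Lit _ | Reg _ => 1
  | Mem b => (cost b).+1
  | Add b c | Sub b c => (cost b + cost c).+1
  end.

(* exec c st t st' : started in st, the program c halts in st' after t steps. *)
Inductive exec : com -> state -> nat -> state -> Prop :=
  | ExecSkip st : exec Skip st 1 st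
  | ExecAssign st r a :
      exec (Assign r a) st (cost a).+1
        (State (update (reg st) r (eval st a)) (mem st))
  | ExecStore st a b :
      exec (Store a b) st (cost a + cost b).+1
        (State (reg st) (update (mem st) (eval st a) (eval st b)))
  | ExecSeq c1 c2 st st1 st2 t1 t2 :
      exec c1 st t1 st1 -> exec c2 st1 t2 st2 ->
      exec (Seq c1 c2) st (t1 + t2) st2
  | ExecIfTrue a c1 c2 st st' t :
      eval st a != 0 -> exec c1 st t st' ->
      exec (If a c1 c2) st ((cost a).+1 + t) st'
  | ExecIfFalse a c1 c2 st st' t :
      eval st a = 0 -> exec c2 st t st' ->
      exec (If a c1 c2) st ((cost a).+1 + t) st'
  | ExecWhileFalse a c st :
      eval st a = 0 -> exec (While a c) st (cost a).+1 st
  | ExecWhileTrue a c st st1 st2 t1 t2 :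
      eval st a != 0 -> exec c st t1 st1 -> exec (While a c) st1 t2 st2 ->
      exec (While a c) st ((cost a).+1 + t1 + t2) st2.

Definition initial_state (input : seq nat) : state :=
  State (fun _ => 0) (nth 0 input).

(* Row-major adjacency matrix: 0 = no edge, 1 = black edge, 2 = red edge. *)
Definition adjacency_matrix n (H : trigraph (name n)) : seq nat :=
  [seq (if black H x y then 1 else if red H x y then 2 else 0)
     | x <- enum (name n), y <- enum (name n)].

(* q, n, the contracted triples, then the adjacency matrices of G_n, ..., G_1,
   the first of which describes the input graph itself. *)
Definition encode q n (e : rel 'I_n) (s : seq (name n * name n * name n)) :
    seq nat :=
  [:: q; n]
  ++ flatten [seq [:: val p.1.1; val p.1.2; val p.2] | p <- s]
  ++ flatten [seq adjacency_matrix H | H <- trigraphs (trigraph_of_graph e) s].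

(* Main.v *)
(* Store, for every red component, the functions [f] that give each vertex [x] the
   exact set of colours used on the input vertices contracted into [x], over all
   proper colourings of the part of the graph below the component: at most [N ^ d]
   functions, where [N = 2 ^ q - 1].  Contracting [u] and [v] to [w] puts [w] in a
   component that is glued from old components; a function on it is realizable iff
   the set at [w] splits as [U] union [W] such that [U] at [u], [W] at [v] and the
   other sets are realizable on the old components, with disjoint sets at the ends
   of each black edge between them.

   A component of [d] vertices comes from up to [d + 1] vertices, and trying all
   [N ^ (d + 1)] combinations would exceed the bound by the factor [2 ^ q].
   Realizability is invariant under permutations of the colours, so only the
   functions with an initial segment [[0, k)] at [w] and, if there is another vertex,
   a set of the form [[0, a)] union [[k, l)] at the last one are searched; there are
   [3 ^ k] pairs [(U, W)] of union [[0, k)], and [3 ^ q] is less than [N ^ 2] by more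
   than any polynomial in [q].  If [w] is alone, [(U, W)] is normalised as well, to
   [[0, i)] and [[0, j)] union [[i, k)].  Every other entry is copied from its image
   under a transposition of two consecutive colours that lowers the set at [w], or
   fixes it and lowers the last set.

   The machine has no multiplication, but its addresses are unbounded: the entry
   of [f] is stored at the sum of the [f x * 2 ^ (q * id x)], which is read off a
   table of multiples.  The red components are found beforehand, from the last
   trigraph to the first.  The cases [q = 1] and [n <= q] are treated apart;
   otherwise [d <= N ^ d] absorbs the [d ^ 3] steps spent on each component, and
   [q < n] the [q * 2 ^ q] steps spent on tables of colour sets. *)

From Stdlib Require Import FunctionalExtensionality PeanoNat.
Require Import Defs.
From mathcomp Require Import all_boot zify.
Set Implicit Arguments. Unset Strict Implicit. Unset Printing Implicit Defensive.

(** * A structured language and its compilation *)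

(** Fresh memory reads 0, so absent entries need no initialisation and 0 can mean not realizable.

    Copying is well founded by its order. Entries with an initial segment at the new vertex come
    first, by an odometer whose most significant digit is the set of the last vertex; the others
    follow by increasing set at the new vertex. The image under a lowering transposition is then
    treated earlier, whatever the transposition does to the sets in between.

    Programs are written with bounded loops only, so their semantics is a function to a final store
    and a time. Correctness and time are proved there, and one simulation theorem transfers both to
    the machine, at the price of a factor that depends on the program text alone. *)

Record store := HStore { var : nat -> nat; arr : nat -> nat -> nat }.

Inductive hexpr :=
  | HLit of nat
  | HVar of nat
  | HArr of nat & hexpr
  | HInp of hexpr
  | HAdd of hexpr & hexpr
  | HSub of hexpr & hexpr.

Inductive hcom :=
  | HSkip
  | HSet of nat & hexpr
  | HPut of nat & hexpr & hexpr
  | HSeq of hcom & hcom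
  | HIf of hexpr & hcom & hcom
  | HFor of nat & hexpr & hcom.

Definition setv (h : store) (v x : nat) : store :=
  HStore (fun r => if Nat.eqb r v then x else var h r) (arr h).

Definition upd (f : nat -> nat) (i x : nat) : nat -> nat :=
  fun j => if j == i then x else f j.

Definition seta (h : store) (k i x : nat) : store :=
  HStore (var h) (fun k' => if Nat.eqb k' k then upd (arr h k) i x else arr h k').

Fixpoint memn (x : nat) (s : seq nat) : bool :=
  if s is y :: s' then (if Nat.eqb x y then true else memn x s') else false.

(* The store that reads [g] on the variables [vs] and the arrays [ks], and [h]
   elsewhere; on literals its components compute. *)
Definition overlay (vs ks : seq nat) (h g : store) : store :=
  HStore (fun r => if memn r vs then var g r else var h r)
        (fun k => if memn k ks then arr g k else arr h k).

Lemma memnE x s : memn x s = (x \in s).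
Proof.
elim: s => //= y s ->; rewrite inE.
by case: (PeanoNat.Nat.eqb_spec x y) => [->|/eqP/negbTE ->]; rewrite ?eqxx.
Qed.

Fixpoint assigned (c : hcom) : seq nat :=
  match c with
  | HSet v _ => [:: v]
  | HSeq c1 c2 | HIf _ c1 c2 => assigned c1 ++ assigned c2
  | HFor v _ c => v :: assigned c
  | _ => [::]
  end.

Fixpoint stored (c : hcom) : seq nat :=
  match c with
  | HPut k _ _ => [:: k]
  | HSeq c1 c2 | HIf _ c1 c2 => stored c1 ++ stored c2
  | HFor _ _ c => stored c
  | _ => [::]
  end.

Section Semantics.
Variables (inp : nat -> nat) (E : nat).

(* The content of the machine's memory: the input below [E], and above it the
   32 interleaved arrays. *)
Definition raw (h : store) (a : nat) : nat :=
  if a < E then inp a else arr h ((a - E) %% 32) ((a - E) %/ 32).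

Fixpoint heval (h : store) (e : hexpr) : nat :=
  match e with
  | HLit k => k
  | HVar v => var h v
  | HArr k e => arr h k (heval h e)
  | HInp e => raw h (heval h e)
  | HAdd a b => heval h a + heval h b
  | HSub a b => heval h a - heval h b
  end.

(** The bound is read once, before the first iteration, so every program terminates and [run] can be
    a function. Each iteration is charged one unit beyond its body. *)
Definition loop (v n : nat) (f : store -> store * nat) (h : store) :
    store * nat :=
  let p := iteri n (fun i p => let r := f (setv p.1 v i) in
                               (r.1, p.2 + r.2.+1)) (h, 1) in
  (setv p.1 v n, p.2).

Fixpoint run (c : hcom) (h : store) : store * nat :=
  match c with
  | HSkip => (h, 1)
  | HSet v e => (setv h v (heval h e), 1)
  | HPut k a e => (seta h k (heval h a) (heval h e), 1)
  | HSeq c1 c2 => let r1 := run c1 h in let r2 := run c2 r1.1 in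
                  (r2.1, r1.2 + r2.2)
  | HIf e c1 c2 => let r := if heval h e == 0 then run c2 h else run c1 h in
                   (r.1, r.2.+1)
  | HFor v e c => loop v (heval h e) (run c) h
  end.

Lemma run_frame c h :
  (forall r, r \notin assigned c -> var (run c h).1 r = var h r) /\
  (forall k, k \notin stored c -> arr (run c h).1 k = arr h k).
Proof.
elim: c h => [|v e|k a e|c1 IH1 c2 IH2|e c1 IH1 c2 IH2|v e c IH] h /=.
- by [].
- by split=> [r|//]; rewrite inE; case: (PeanoNat.Nat.eqb_spec r v) => [->|//]; rewrite eqxx.
- by split=> [//|r]; rewrite inE; case: (PeanoNat.Nat.eqb_spec r k) => [->|//]; rewrite eqxx.
- have [A1 B1] := IH1 h; have [A2 B2] := IH2 (run c1 h).1.
  split=> r; rewrite mem_cat negb_or => /andP[r1 r2].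
    by rewrite A2 // A1.
  by rewrite B2 // B1.
- have [A1 B1] := IH1 h; have [A2 B2] := IH2 h.
  split=> r; rewrite mem_cat negb_or => /andP[r1 r2]; case: ifP => _ /=.
  + by rewrite A2.
  + by rewrite A1.
  + by rewrite B2.
  + by rewrite B1.
- rewrite /loop /=; set f := fun (i : nat) p => _.
  have [A B] : (forall r, r \notin v :: assigned c ->
       var (iteri (heval h e) f (h, 1)).1 r = var h r) /\
     (forall k, k \notin stored c -> arr (iteri (heval h e) f (h, 1)).1 k = arr h k).
    elim: (heval h e) => //= n [A B]; split=> r nr.
      have [-> //] := IH (setv (iteri n f (h, 1)).1 v n).
        rewrite /= -A //; case: (PeanoNat.Nat.eqb_spec r v) => // rv.
        by move: nr; rewrite rv inE eqxx.
      by move: nr; rewrite inE negb_or => /andP[].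
    by have [_ -> //=] := IH (setv (iteri n f (h, 1)).1 v n); rewrite B.
  split=> r nr /=; last exact: B.
  rewrite A //; case: (PeanoNat.Nat.eqb_spec r v) => // rv.
  by move: nr; rewrite rv inE eqxx.
Qed.

(** Frame conditions in equational form: once a final store is an overlay with concrete lists,
    whatever the program leaves alone is read back by computation. *)
Lemma run_overlay c h vs ks :
  {subset assigned c <= vs} -> {subset stored c <= ks} ->
  (run c h).1 = overlay vs ks h (run c h).1.
Proof.
move=> sv sk; have [A B] := run_frame c h.
rewrite /overlay; case: (run c h).1 A B => vr ar /= A B; congr HStore.
  apply: functional_extensionality => r; rewrite memnE.
  by case: ifP => // /negbT nr; apply: A; apply: contra nr; apply: sv.
apply: functional_extensionality => k; rewrite memnE.
by case: ifP => // /negbT nr; apply: B; apply: contra nr; apply: sk.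
Qed.

Definition wp (c : hcom) (h : store) (Q : store -> nat -> Prop) : Prop :=
  Q (run c h).1 (run c h).2.

Lemma wp_seq c1 c2 h Q :
  wp c1 h (fun h1 t1 => wp c2 h1 (fun h2 t2 => Q h2 (t1 + t2))) ->
  wp (HSeq c1 c2) h Q.
Proof. by []. Qed.

Lemma wp_if e c1 c2 h Q :
  (heval h e != 0 -> wp c1 h (fun h1 t => Q h1 t.+1)) ->
  (heval h e = 0 -> wp c2 h (fun h1 t => Q h1 t.+1)) ->
  wp (HIf e c1 c2) h Q.
Proof. by rewrite /wp /=; case: eqP => // e0 A B; [apply: B | apply: A]. Qed.

Lemma wp_call c h (Q Q' : store -> nat -> Prop) :
  wp c h Q' ->
  (forall g t, Q' (overlay (assigned c) (stored c) h g) t ->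
               Q (overlay (assigned c) (stored c) h g) t) ->
  wp c h Q.
Proof.
rewrite /wp (@run_overlay c h (assigned c) (stored c)) // => A B.
exact: B.
Qed.

Lemma wp_skip h (Q : store -> nat -> Prop) : Q h 1 -> wp HSkip h Q.
Proof. by []. Qed.

Lemma wp_set v e h (Q : store -> nat -> Prop) :
  Q (setv h v (heval h e)) 1 -> wp (HSet v e) h Q.
Proof. by []. Qed.

Lemma wp_put k a e h (Q : store -> nat -> Prop) :
  Q (seta h k (heval h a) (heval h e)) 1 -> wp (HPut k a e) h Q.
Proof. by []. Qed.

(** The invariant is only met on overlays of the initial store, so it has to mention just what the
    body changes; every other fact about [h] persists by computation. [B] bounds the time of one
    body. *)
Lemma wp_for (I : nat -> store -> Prop) B v e c h Q :
  let vs := v :: assigned c in let ks := stored c in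
  I 0 h ->
  (forall i g, i < heval h e -> I i (overlay vs ks h g) ->
     wp c (setv (overlay vs ks h g) v i) (fun h1 t => I i.+1 h1 /\ t <= B)) ->
  (forall g t, I (heval h e) (overlay vs ks h g) ->
     t <= (heval h e * B.+1).+1 ->
     Q (setv (overlay vs ks h g) v (heval h e)) t) ->
  wp (HFor v e c) h Q.
Proof.
move=> vs ks; have sv : {subset assigned c <= vs}.
  by move=> r rc; rewrite /vs inE rc orbT.
have vv : v \in vs by apply: mem_head.
have sk : {subset stored c <= ks} by [].
clearbody vs ks => I0 Ib; rewrite /wp /= /loop /=; set f := fun (i : nat) p => _.
set n := heval h e in Ib * => IQ.
have [A B1] : (exists g, (iteri n f (h, 1)).1 = overlay vs ks h g /\
    I n (overlay vs ks h g)) /\ (iteri n f (h, 1)).2 <= (n * B.+1).+1.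
  elim: {-2}n (leqnn n) => [|m IH] mn /=.
    have E0 : h = overlay vs ks h h.
      by case: (h) => x y; rewrite /overlay; congr HStore;
        apply: functional_extensionality => r /=; case: ifP.
    by split=> //; exists h; rewrite -E0.
  have [[g [Eg Ig]] Bt] := IH (ltnW mn).
  have := Ib m g mn Ig; rewrite -Eg /wp => -[I1 B1].
  have E2 : (run c (setv (iteri m f (h, 1)).1 v m)).1 =
     overlay vs ks h (run c (setv (iteri m f (h, 1)).1 v m)).1.
    rewrite {1}(@run_overlay c _ vs ks) //.
    rewrite Eg /overlay /=; congr HStore; apply: functional_extensionality => r.
      case: ifP => //; rewrite memnE => nr; case: (PeanoNat.Nat.eqb_spec r v) => [rv|_]; last by rewrite nr.
      by rewrite rv vv in nr.
    by case: (memn r ks).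
  split; last by lia.
  by exists (run c (setv (iteri m f (h, 1)).1 v m)).1; rewrite -E2.
have [g [Eg Ig]] := A.
by rewrite Eg; apply: IQ.
Qed.

End Semantics.

Definition double (a : expr) : expr := Add a a.

(** Register 0 is kept for the answer and 1 for the base address [E]; variables take the even
    registers from 2 on, hidden loop bounds the odd ones from 3 on. *)
Definition rvar v := (v.+1).*2.
Definition rbound v := (v.+1).*2.+1.

Fixpoint compile_expr (e : hexpr) : expr :=
  match e with
  | HLit k => Lit k
  | HVar v => Reg (rvar v)
  | HArr k e => Defs.Mem (Add (Reg 1) (Add (Lit k) (iter 5 double (compile_expr e))))
  | HInp e => Defs.Mem (compile_expr e)
  | HAdd a b => Add (compile_expr a) (compile_expr b)
  | HSub a b => Defs.Sub (compile_expr a) (compile_expr b)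
  end.

Fixpoint compile (c : hcom) : com :=
  match c with
  | HSkip => Skip
  | HSet v e => Assign (rvar v) (compile_expr e)
  | HPut k a e => Defs.Store (Add (Reg 1) (Add (Lit k) (iter 5 double (compile_expr a))))
                    (compile_expr e)
  | HSeq c1 c2 => Seq (compile c1) (compile c2)
  | HIf e c1 c2 => If (compile_expr e) (compile c1) (compile c2)
  | HFor v e c =>
      Seq (Assign (rbound v) (compile_expr e))
        (Seq (Assign (rvar v) (Lit 0))
           (While (Defs.Sub (Reg (rbound v)) (Reg (rvar v)))
              (Seq (compile c) (Assign (rvar v) (Add (Reg (rvar v)) (Lit 1))))))
  end.

(** The constant factor lost in compilation. The 20 of a loop covers initialisation, test and
    increment of its counter. *)
Fixpoint overhead (c : hcom) : nat :=
  match c with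
  | HSkip => 1
  | HSet v e => (cost (compile_expr e)).+1
  | HPut k a e => (cost (Add (Reg 1) (Add (Lit k) (iter 5 double (compile_expr a))))
                    + cost (compile_expr e)).+1
  | HSeq c1 c2 => overhead c1 + overhead c2
  | HIf e c1 c2 => (cost (compile_expr e)).+1 + overhead c1 + overhead c2
  | HFor v e c => cost (compile_expr e) + 20 + overhead c
  end.

Fixpoint wf_expr (e : hexpr) : bool :=
  match e with
  | HArr k e => (k < 32) && wf_expr e
  | HInp e => wf_expr e
  | HAdd a b | HSub a b => wf_expr a && wf_expr b
  | _ => true
  end.

(** A body that changed its own counter would break the agreement between the machine's [While] and
    [loop]; array numbers below 32 keep the interleaved arrays apart. *)
Fixpoint wf (c : hcom) : bool :=
  match c with
  | HSkip => true
  | HSet v e => wf_expr e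
  | HPut k a e => [&& k < 32, wf_expr a & wf_expr e]
  | HSeq c1 c2 => wf c1 && wf c2
  | HIf e c1 c2 => [&& wf_expr e, wf c1 & wf c2]
  | HFor v e c => [&& v \notin assigned c, wf_expr e & wf c]
  end.

Section Compile.
Variables (inp : nat -> nat) (E : nat).

Definition represents (h : store) (st : state) : Prop :=
  [/\ reg st 1 = E,
      forall v, reg st (rvar v) = var h v
    & forall a, Defs.mem st a = raw inp E h a].

Lemma compile_exprP h st e :
  represents h st -> wf_expr e -> eval st (compile_expr e) = heval inp E h e.
Proof.
move=> [R1 Rv Rm]; elim: e => [k|v|k e IH|e IH|a IHa b IHb|a IHa b IHb] //=.
- move=> /andP[k32 we]; rewrite Rm R1 IH // /raw; set x := heval _ _ _ _.
  rewrite (_ : E + _ < E = false); last by lia.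
  by congr (arr h _ _); lia.
- by move=> we; rewrite Rm IH.
- by move=> /andP[wa wb]; rewrite IHa // IHb.
- by move=> /andP[wa wb]; rewrite IHa // IHb.
Qed.

Lemma represents_setv h st v x :
  represents h st -> represents (setv h v x) (State (update (reg st) (rvar v) x) (Defs.mem st)).
Proof.
move=> [R1 Rv Rm]; split=> [|r|//]; rewrite /= /update.
  by rewrite /rvar; case: eqP => //; lia.
rewrite -Rv; case: (PeanoNat.Nat.eqb_spec r v) => [->|rv]; first by rewrite eqxx.
by case: eqP => //; rewrite /rvar; lia.
Qed.

Lemma represents_bound h st v x :
  represents h st -> represents h (State (update (reg st) (rbound v) x) (Defs.mem st)).
Proof.
move=> [R1 Rv Rm]; split=> [|r|//]; rewrite /= /update /rbound /rvar.
  by case: eqP => //; lia.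
by rewrite -Rv /rvar; case: eqP => //; lia.
Qed.

Lemma run_time c h : 0 < (run inp E c h).2.
Proof.
elim: c h => [|v e|k a e|c1 IH1 c2 IH2|e c1 IH1 c2 IH2|v e c IH] h //=.
  by rewrite addn_gt0 IH1.
by elim: (heval _ _ _ _) => //= n IHn; lia.
Qed.

(** The last conjunct serves the induction: a loop must find its bound register intact after its
    body, which by [wf] does not assign its counter. *)
Lemma compileP c h st : wf c -> represents h st ->
  exists t st', [/\ exec (compile c) st t st', represents (run inp E c h).1 st',
    t <= overhead c * (run inp E c h).2
    & forall v, v \notin assigned c -> reg st' (rbound v) = reg st (rbound v)].
Proof.
elim: c h st => [|v e|k a e|c1 IH1 c2 IH2|e c1 IH1 c2 IH2|v e c IH] h st /=.
- by move=> _ R; exists 1, st; split=> //; apply: ExecSkip.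
- move=> we R; eexists; eexists; split; first exact: ExecAssign.
  + by rewrite (compile_exprP R we); apply: represents_setv.
  + by rewrite muln1.
  + move=> r /=; rewrite inE /update /rvar /rbound => _.
    by case: eqP => //; lia.
- move=> /and3P[k32 wa we] R; eexists; eexists; split; first exact: ExecStore.
  + have [R1 Rv Rm] := R; split=> //= b.
    rewrite /update R1 (compile_exprP R wa) (compile_exprP R we).
    rewrite /raw /=; set x := heval _ _ _ a; case: (ltnP b E) => bE.
      by case: eqP => [|_]; [lia|rewrite Rm /raw bE].
    case: eqP => [->|nb].
      rewrite (_ : Nat.eqb _ _ = true) /upd; last by apply/PeanoNat.Nat.eqb_spec; lia.
      by rewrite (_ : _ == x) //; apply/eqP; lia.
    case: (PeanoNat.Nat.eqb_spec _ k) => [bk|//]; last by rewrite Rm /raw ltnNge bE.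
    by rewrite /upd; case: eqP => [|_]; [lia|rewrite Rm /raw ltnNge bE /= bk].
  + by rewrite muln1 /=.
  + by [].
- move=> /andP[w1 w2] R.
  have [t1 [st1 [X1 R1 T1 F1]]] := IH1 h st w1 R.
  have [t2 [st2 [X2 R2 T2 F2]]] := IH2 _ st1 w2 R1.
  exists (t1 + t2), st2; split=> //; first exact: ExecSeq X1 X2.
    by nia.
  by move=> r; rewrite mem_cat negb_or => /andP[r1 r2]; rewrite F2 // F1.
- move=> /and3P[we w1 w2] R.
  have Ee := compile_exprP R we.
  case: eqP => e0.
    have [t [st1 [X1 R1 T1 F1]]] := IH2 h st w2 R.
    exists ((cost (compile_expr e)).+1 + t), st1; split=> //=.
    + by apply: ExecIfFalse => //; rewrite Ee.
    + by nia.
    + by move=> r; rewrite mem_cat negb_or => /andP[_ r2]; rewrite F1.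
  have [t [st1 [X1 R1 T1 F1]]] := IH1 h st w1 R.
  exists ((cost (compile_expr e)).+1 + t), st1; split=> //=.
  + by apply: ExecIfTrue => //; rewrite Ee; apply/eqP.
  + by nia.
  + by move=> r; rewrite mem_cat negb_or => /andP[r1 _]; rewrite F1.
- move=> /and3P[nv we wc] R.
  rewrite /loop; set n := heval inp E h e.
  pose f (i : nat) (p : store * nat) :=
    ((run inp E c (setv p.1 v i)).1, p.2 + (run inp E c (setv p.1 v i)).2.+1).
  rewrite -/f.
  set st1 := State (update (reg st) (rbound v) n) (Defs.mem st).
  set st2 := State (update (reg st1) (rvar v) 0) (Defs.mem st).
  set W := While _ _.
  have R2 : represents (setv h v 0) st2 by apply/represents_setv/represents_bound.
  have bnd0 : reg st2 (rbound v) = n.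
    by rewrite /= /update eqxx; case: eqP => //; rewrite /rvar /rbound; lia.
  (* Induction on the number [j] of iterations left. Times are compared as a telescoping sum, with
     the abstract time already spent on the left, to avoid subtraction. *)
  have loopW : forall j m, m + j = n -> forall st',
      represents (setv (iteri m f (h, 1)).1 v m) st' -> reg st' (rbound v) = n ->
      exists t st'', [/\ exec W st' t st'',
        represents (setv (iteri n f (h, 1)).1 v n) st'',
        t + overhead (HFor v e c) * (iteri m f (h, 1)).2 <=
          4 + overhead (HFor v e c) * (iteri n f (h, 1)).2
        & forall w, w \notin v :: assigned c -> reg st'' (rbound w) = reg st' (rbound w)].
    elim=> [|j IHj] m mj st' R' b'.
      have Em : m = n by lia.
      exists 4, st'; rewrite -Em; split=> //.
      apply: ExecWhileFalse; rewrite /= b'; have [_ -> _] := R'.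
      by rewrite /= PeanoNat.Nat.eqb_refl; lia.
    have [t1 [s1 [X1 R1 T1 F1]]] := IH _ st' wc R'.
    have [_ Rv1 _] := R1.
    have vm : var (run inp E c (setv (iteri m f (h, 1)).1 v m)).1 v = m.
      have [-> //] := run_frame inp E c (setv (iteri m f (h, 1)).1 v m).
      by rewrite /= PeanoNat.Nat.eqb_refl.
    set s2 := State (update (reg s1) (rvar v) m.+1) (Defs.mem s1).
    have Rs2 : represents (setv (iteri m.+1 f (h, 1)).1 v m.+1) s2 by apply: represents_setv.
    have bs2 : reg s2 (rbound v) = n.
      rewrite /s2 /= /update; case: eqP => [|_]; first by rewrite /rvar /rbound; lia.
      by rewrite F1.
    have [t2 [s3 [X3 R3 T3 F3]]] := IHj m.+1 (ltac:(lia)) s2 Rs2 bs2.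
    exists (4 + (t1 + 4) + t2), s3; split=> //.
    + apply: ExecWhileTrue X3.
        rewrite /= b'; have [_ -> _] := R'.
        by rewrite /= PeanoNat.Nat.eqb_refl; lia.
      apply: ExecSeq X1 _.
      rewrite /s2 (_ : m.+1 = eval s1 (Add (Reg (rvar v)) (Lit 1))).
        exact: ExecAssign.
      by rewrite /= Rv1 vm addn1.
    + move: T3; rewrite [X in X -> _]/=; move: T1.
      set tc := (run inp E c _).2; set o := overhead c.
      set T := (iteri n f _).2; set Tm := (iteri m f _).2.
      have tc0 : 0 < tc by apply: run_time.
      set ce := cost _; set o' := ce + 20 + o; rewrite mulnDr => T1' T3'.
      have : o * tc + 8 <= o' * tc.+1 by rewrite /o'; nia.
      by rewrite [overhead _]/= -/ce -/o -/o'; lia.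
    + move=> w nw; rewrite F3 // /s2 /= /update.
      case: eqP => [|_]; first by rewrite /rvar /rbound; lia.
      by apply: F1; move: nw; rewrite inE negb_or => /andP[].
  have [t [s3 [X3 R3 T3 F3]]] := loopW n 0 erefl st2 R2 bnd0.
  exists ((cost (compile_expr e)).+1 + (2 + t)), s3; split=> //.
  + apply: (@ExecSeq _ _ st st1 s3); last apply: ExecSeq X3.
      have En : n = eval st (compile_expr e) by rewrite (compile_exprP R we).
      by have := ExecAssign st (rbound v) (compile_expr e); rewrite -En.
    exact: (ExecAssign _ _ (Lit 0)).
  + move: T3; rewrite [X in X -> _]/= /=; set T := (iteri n f _).2.
    have : 0 < T by rewrite /T; elim: (n) => //= n' _; lia.
    set o := overhead c; set ce := cost _.
    rewrite muln1; nia.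
  + move=> w nw; rewrite F3 // /st2 /= /update.
    case: eqP => [|_]; first by rewrite /rvar /rbound; lia.
    case: eqP => [|//]; rewrite /rbound => wv.
    by move: nw; rewrite inE (_ : w = v) ?eqxx //; lia.
Qed.

End Compile.

(** * Sets of colours as binary numbers *)

Fixpoint bit (c X : nat) : bool := if c is c'.+1 then bit c' X./2 else odd X.

Fixpoint bitmask (q : nat) (b : nat -> bool) : nat :=
  if q is q'.+1 then b 0 + (bitmask q' (fun c => b c.+1)).*2 else 0.

Lemma bit0n c : bit c 0 = false.
Proof. by elim: c. Qed.

Lemma half_lt X q : X < 2 ^ q.+1 -> X./2 < 2 ^ q.
Proof. by rewrite expnS; lia. Qed.

Lemma bit_ext q X Y : X < 2 ^ q -> Y < 2 ^ q ->
  (forall c, c < q -> bit c X = bit c Y) -> X = Y.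
Proof.
elim: q X Y => [|q IH] X Y; first by rewrite expn0; lia.
move=> hX hY hb; rewrite -(odd_double_half X) -(odd_double_half Y).
rewrite [odd X](hb 0) // (IH X./2 Y./2) //; try exact: half_lt.
by move=> c cq; apply: (hb c.+1).
Qed.

Lemma bit_out q X c : X < 2 ^ q -> q <= c -> bit c X = false.
Proof.
elim: c q X => [|c IH] [|q] X; rewrite ?expn0 //.
- by case: X.
- by case: X => // _ _; rewrite bit0n.
- by move=> hX qc; apply: (IH q) => //; apply: half_lt.
Qed.

Lemma bit_bitmask q b c : bit c (bitmask q b) = (c < q) && b c.
Proof.
elim: q b c => [|q IH] b c /=; first exact: bit0n.
case: c => [|c] /=; first by rewrite oddD odd_double; case: (b 0).
rewrite halfD odd_double andbF add0n doubleK (_ : (b 0 : nat)./2 = 0); last by case: (b 0).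
by rewrite IH.
Qed.

Lemma bitmask_lt q b : bitmask q b < 2 ^ q.
Proof.
elim: q b => [|q IH] b //=; rewrite expnS.
by have := IH (fun c => b c.+1); case: (b 0) => /=; lia.
Qed.

(* Exchanges the bits [a] and [a.+1]. *)
Fixpoint swap (a X : nat) : nat :=
  if a is a'.+1 then (swap a' X./2).*2 + odd X
  else X./2./2 * 4 + (odd X).*2 + odd X./2.

Definition tr (a c : nat) : nat :=
  if c == a then a.+1 else if c == a.+1 then a else c.

Lemma trK a : involutive (tr a).
Proof.
move=> c; rewrite /tr; case: (eqVneq c a) => [->|n1].
  by rewrite (gtn_eqF (ltnSn a)) eqxx.
case: (eqVneq c a.+1) => [->|n2]; first by rewrite eqxx.
by rewrite (negbTE n1) (negbTE n2).
Qed.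

Lemma tr_lt a q c : a.+1 < q -> (tr a c < q) = (c < q).
Proof. by move=> aq; rewrite /tr; repeat (case: ifP => ?); lia. Qed.

Lemma half_swapS a X : (swap a.+1 X)./2 = swap a X./2.
Proof. by rewrite /=; case: (odd X); lia. Qed.

Lemma bit_swap a X c : bit c (swap a X) = bit (tr a c) X.
Proof.
elim: a X c => [|a IH] X c.
  have H1 : odd (swap 0 X) = odd X./2.
    by rewrite /= !oddD oddM andbF odd_double; case: (odd X./2).
  have H2 : (swap 0 X)./2 = (X./2./2).*2 + odd X.
    by rewrite /=; case: (odd X); case: (odd _) => /=; lia.
  case: c => [|[|c]]; rewrite /tr.
  - exact: H1.
  - by rewrite -[LHS]/(odd (swap 0 X)./2) H2 oddD odd_double /=; case: (odd X).
  - rewrite -[LHS]/(bit c (swap 0 X)./2./2) H2.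
    by rewrite (_ : (_ + _)./2 = X./2./2) //; case: (odd X); lia.
case: c => [|c]; first by rewrite /tr /= oddD odd_double; case: (odd X).
rewrite [LHS]/bit -/bit half_swapS IH /tr !eqSS.
by do ![case: ifP => _].
Qed.

Lemma swap_lt a q X : a.+1 < q -> X < 2 ^ q -> swap a X < 2 ^ q.
Proof.
elim: a q X => [|a IH] [|q] X // aq hX.
  case: q aq hX => // q _; rewrite !expnS /=; case: (odd X); case: (odd _); lia.
have := IH q X./2 aq (half_lt hX); rewrite expnS /=; case: (odd X); lia.
Qed.

Lemma bit_inj X Y : (forall c, bit c X = bit c Y) -> X = Y.
Proof.
move=> XY; apply: (@bit_ext (X + Y)) => [||c _]; last exact: XY.
  by apply: (leq_ltn_trans _ (ltn_expl (X + Y) _)) => //; lia.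
by apply: (leq_ltn_trans _ (ltn_expl (X + Y) _)) => //; lia.
Qed.

Lemma swapK a : involutive (swap a).
Proof. by move=> X; apply: bit_inj => c; rewrite !bit_swap trK. Qed.

Lemma swap_lower a X : (swap a X < X) = bit a.+1 X && ~~ bit a X.
Proof.
elim: a X => [|a IH] X; first by rewrite /=; case E1: (odd X); case E2: (odd X./2) => /=; lia.
rewrite -[RHS]/(bit a.+1 X./2 && ~~ bit a X./2) -IH /=.
by case E: (odd X); lia.
Qed.

Lemma swap_id a X : (swap a X == X) = (bit a.+1 X == bit a X).
Proof.
elim: a X => [|a IH] X; first by rewrite /=; case E1: (odd X); case E2: (odd X./2) => /=; lia.
rewrite -[RHS]/(bit a.+1 X./2 == bit a X./2) -IH /=.
by case E: (odd X); lia.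
Qed.

Lemma swap_gt0 a X : (0 < swap a X) = (0 < X).
Proof.
have swap0 : swap a 0 = 0 by elim: a => //= a ->.
case: X => [|X]; first by rewrite swap0.
by case E: (swap a X.+1) => //; rewrite -(swapK a X.+1) E swap0.
Qed.

Lemma bit_cat k x y c : x < 2 ^ k ->
  bit c (x + 2 ^ k * y) = if c < k then bit c x else bit (c - k) y.
Proof.
elim: k x c => [|k IH] x c hx.
  by move: hx; rewrite expn0 subn0 mul1n; case: x.
case: c => [|c]; first by rewrite /= oddD oddM expnS oddM addbF.
rewrite /= (_ : (x + _)./2 = x./2 + 2 ^ k * y) ?IH //; last by rewrite expnS; lia.
exact: half_lt.
Qed.

Lemma bit_ones k c : bit c (2 ^ k - 1) = (c < k).
Proof.
rewrite (_ : 2 ^ k - 1 = bitmask k xpredT) ?bit_bitmask ?andbT //.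
elim: k => //= k <-; rewrite expnS; have := expn_gt0 2 k; lia.
Qed.

(* The colours below [a], and those from [k] to [l]. *)
Definition two_blocks a k l := 2 ^ a - 1 + (2 ^ l - 2 ^ k).

Lemma bit_two_blocks a k l c : a <= k -> k <= l ->
  bit c (two_blocks a k l) = (c < a) || (k <= c < l).
Proof.
move=> ak kl; rewrite /two_blocks (_ : 2 ^ l - 2 ^ k = 2 ^ k * (2 ^ (l - k) - 1)).
  have le : 2 ^ a <= 2 ^ k by rewrite leq_exp2l.
  rewrite bit_cat; last by have := expn_gt0 2 a; lia.
  rewrite !bit_ones; case: (ltnP c k) => ck; first by rewrite orbF.
  by rewrite ltn_subLR // subnKC //; lia.
by rewrite mulnBr -expnD subnKC // muln1.
Qed.

Lemma two_blocks_lt a k l q : a <= k -> k <= l -> l <= q -> two_blocks a k l < 2 ^ q.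
Proof.
move=> ak kl lq; have : 2 ^ a <= 2 ^ k by rewrite leq_exp2l.
have : 2 ^ k <= 2 ^ l by rewrite leq_exp2l.
have : 2 ^ l <= 2 ^ q by rewrite leq_exp2l.
by rewrite /two_blocks; have := expn_gt0 2 a; lia.
Qed.

(** The bits of a number that no adjacent transposition lowers have this closure property: a set bit
    above an unset one could be moved down. *)
Lemma downset_threshold (b : nat -> bool) lo hi : lo <= hi ->
  (forall c, lo <= c -> c.+1 < hi -> b c.+1 -> b c) ->
  exists2 t, lo <= t <= hi & forall c, lo <= c -> c < hi -> b c = (c < t).
Proof.
elim: hi => [|hi IH] lh down; first by exists lo; [lia|move=> c; lia].
case: (ltnP hi lo) => hl.
  by exists lo; [lia|move=> c; lia].
case: IH => // [c h1 h2|t t1 t2]; first by apply: down => //; lia.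
case bh: (b hi).
  exists hi.+1; first by lia.
  have up m c : c + m = hi -> lo <= c -> b c.
    elim: m c => [|m IHm] c cm lc; first by rewrite -cm addn0 in bh.
    by apply: down => //; [lia|apply: IHm; lia].
  by move=> c h1 h2; rewrite h2 (up (hi - c)) //; lia.
exists t; first by lia.
move=> c h1 h2; case: (ltnP c hi) => ch; first exact: t2.
by rewrite (_ : c = hi) ?bh; lia.
Qed.

Lemma minimal_initial q S : S < 2 ^ q ->
  (forall a, a.+1 < q -> S <= swap a S) -> exists2 k, k <= q & S = 2 ^ k - 1.
Proof.
move=> Sq low; have [|k kq hk] := @downset_threshold (fun c => bit c S) 0 q (leq0n q).
  move=> c _ cq bc; have := low c cq; rewrite leqNgt swap_lower bc /=.
  by case: (bit c S).
exists k; first by lia.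
apply: (@bit_ext q) => // [|c cq]; last by rewrite hk // bit_ones.
have : 2 ^ k <= 2 ^ q by rewrite leq_exp2l //; lia.
by have := expn_gt0 2 k; lia.
Qed.

(** The transpositions that fix [2 ^ k - 1] are those that do not exchange [k - 1] and [k].
    Minimality therefore makes the bits downward closed on each side of [k] separately, which gives
    the thresholds [a] and [l]. *)
Lemma minimal_two_blocks q k X : k <= q -> X < 2 ^ q ->
  (forall a, a.+1 < q -> swap a (2 ^ k - 1) = 2 ^ k - 1 -> X <= swap a X) ->
  exists a l, [/\ a <= k, k <= l, l <= q & X = two_blocks a k l].
Proof.
move=> kq Xq low.
have down c : c.+1 < q -> c.+1 != k -> bit c.+1 X -> bit c X.
  move=> cq ck bc; have := low c cq; rewrite leqNgt swap_lower bc /=.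
  case: (bit c X) => //= /(_ _)/negP; case=> //.
  by apply/eqP; rewrite swap_id !bit_ones; lia.
have [|a ak ha] := @downset_threshold (fun c => bit c X) 0 k (leq0n k).
  by move=> c _ ck; apply: down; lia.
have [|l kl hl] := @downset_threshold (fun c => bit c X) k q kq.
  by move=> c kc cq; apply: down; lia.
exists a, l; split; [lia|lia|lia|].
apply: (@bit_ext q) => // [|c cq]; first by apply: two_blocks_lt; lia.
rewrite bit_two_blocks; [|lia|lia].
case: (ltnP c k) => ck; first by rewrite ha // orbF.
by rewrite hl //; lia.
Qed.

Fixpoint popcount_rec (f X : nat) : nat :=
  if f is f'.+1 then odd X + popcount_rec f' X./2 else 0.

(** The number itself is enough fuel, since halving decreases it. *)
Definition popcount X := popcount_rec X X.

Lemma popcount_half X : popcount X = odd X + popcount X./2.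
Proof.
have stable f g Y : Y <= f -> Y <= g -> popcount_rec f Y = popcount_rec g Y.
  have rec0 m : popcount_rec m 0 = 0 by elim: m.
  elim: f g Y => [|f IH] [|g] Y //.
  - by case: Y => // _ _; rewrite rec0.
  - by case: Y => // _ _; rewrite rec0.
  - by move=> Yf Yg /=; rewrite (IH g) //; lia.
case: X => // X; rewrite /popcount [LHS]/=; congr (_ + _).
by apply: stable => /=; lia.
Qed.

(** The successor is the sum with an incoming carry. Halving produces such a carry, so the two
    bounds are proved together. *)
Lemma popcountD X Y :
  popcount (X + Y) <= popcount X + popcount Y /\
  popcount (X + Y).+1 <= popcount X + popcount Y + 1.
Proof.
have [s] := ubnP (X + Y); elim: s X Y => // s IH X Y XY.
have [E|ne] := eqVneq (X + Y) 0.
  by have [-> ->] : X = 0 /\ Y = 0 by lia.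
have := IH X./2 Y./2 (ltac:(lia)); case=> h1 h2.
rewrite (popcount_half X) (popcount_half Y) (popcount_half (X + Y)).
rewrite (popcount_half (X + Y).+1).
have -> : (X + Y)./2 = X./2 + Y./2 + (odd X && odd Y).
  by case E1: (odd X); case E2: (odd Y) => /=; lia.
have -> : (X + Y).+1./2 = X./2 + Y./2 + (odd X || odd Y).
  by case E1: (odd X); case E2: (odd Y) => /=; lia.
by rewrite oddS oddD; case: (odd X); case: (odd Y); rewrite /= ?addn0 ?addn1; lia.
Qed.

(** An addition loses a one for every carry, and there is no carry exactly when no bit is shared.
    Disjointness thus becomes arithmetic on a table of cardinals. *)
Lemma popcount_disjoint X Y :
  (popcount X + popcount Y - popcount (X + Y) == 0) =
  all (fun c => ~~ (bit c X && bit c Y)) (iota 0 (X + Y)).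
Proof.
suff H : (popcount X + popcount Y == popcount (X + Y)) =
    all (fun c => ~~ (bit c X && bit c Y)) (iota 0 (X + Y)).
  by rewrite -H; have [] := popcountD X Y; lia.
have trunc x y m : x + y <= m -> all (fun c => ~~ (bit c x && bit c y)) (iota 0 m) =
    all (fun c => ~~ (bit c x && bit c y)) (iota 0 (x + y)).
  move=> h; rewrite -(subnKC h) iotaD all_cat add0n andb_idr // => _.
  apply/allP=> c; rewrite mem_iota => /andP[c1 _].
  rewrite (@bit_out c x c) //; apply: (leq_ltn_trans _ (ltn_expl c _)) => //; lia.
have [s] := ubnP (X + Y); elim: s X Y => // s IH X Y XY.
have [E|ne] := eqVneq (X + Y) 0.
  by have [-> ->] : X = 0 /\ Y = 0 by lia.
case E : (X + Y) => [|m]; first by lia.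
rewrite -[iota _ _]/(0 :: iota 1 m) (iotaDl 1 0 m) /= all_map.
rewrite (_ : all _ _ = all (fun c => ~~ (bit c X./2 && bit c Y./2)) (iota 0 m)) //.
rewrite trunc; last by lia.
rewrite -IH; last by lia.
rewrite -E (popcount_half X) (popcount_half Y) (popcount_half (X + Y)).
have -> : (X + Y)./2 = X./2 + Y./2 + (odd X && odd Y).
  by case E1: (odd X); case E2: (odd Y) => /=; lia.
have [] := popcountD X./2 Y./2.
by rewrite oddD; case: (odd X); case: (odd Y); rewrite /= ?addn0 ?addn1; lia.
Qed.

Lemma popcount_disjointP X Y :
  reflect (forall c, ~~ (bit c X && bit c Y))
          (popcount X + popcount Y - popcount (X + Y) == 0).
Proof.
rewrite popcount_disjoint; apply: (iffP allP) => [H c|H c _]; last exact: H.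
case: (ltnP c (X + Y)) => h; first by apply: H; rewrite mem_iota.
by rewrite (@bit_out c X c) //; apply: (leq_ltn_trans _ (ltn_expl c _)) => //; lia.
Qed.

(** * Families of colour sets as numbers in base [B] *)

Lemma digits_inj B T (F G : nat -> nat) :
  (forall t, F t < B) -> (forall t, G t < B) ->
  \sum_(t < T) F t * B ^ t = \sum_(t < T) G t * B ^ t ->
  forall t, t < T -> F t = G t.
Proof.
elim: T F G => // T IH F G hF hG.
rewrite !big_ord_recl !expn0 !muln1 /=.
have fact H : \sum_(i < T) H (bump 0 i) * B ^ bump 0 i = (\sum_(i < T) H i.+1 * B ^ i) * B.
  by rewrite big_distrl /=; apply: eq_bigr => i _; rewrite /bump add1n expnSr mulnA.
rewrite !fact => E.
have E0 : F 0 = G 0.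
  have := congr1 (modn^~ B) E.
  by rewrite (addnC (F 0)) (addnC (G 0)) !modnMDl !modn_small.
case=> [|t] // tT; apply: (IH (fun t => F t.+1) (fun t => G t.+1)) => //.
have B0 : 0 < B by apply: leq_ltn_trans (hF 0).
by move/eqP: E; rewrite E0 eqn_add2l eqn_pmul2r // => /eqP.
Qed.

Lemma digits_lt B T (F : nat -> nat) :
  (forall t, F t < B) -> \sum_(t < T) F t * B ^ t < B ^ T.
Proof.
move=> hF; elim: T => [|T IH]; first by rewrite big_ord0.
rewrite big_ord_recr expnS /=.
by apply: (@leq_trans (B ^ T + F T * B ^ T)); rewrite ?ltn_add2r // -mulSn leq_mul2r hF orbT.
Qed.

(** The address of [f] on [C], for [B = 2 ^ q]. Digits are placed by [id] and not by an enumeration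
    of [C], so the codes of an untouched component stay the same from one step to the next. *)
Definition code (T : finType) (B : nat) (id : T -> nat) (C : {set T}) (f : T -> nat) :=
  \sum_(y in C) f y * B ^ id y.

Section Code.
Variables (T : finType) (B : nat) (id : T -> nat) (C : {set T}).
Hypothesis id_inj : {in C &, injective id}.

Let digit (f : T -> nat) t := \sum_(y in C | id y == t) f y.

Lemma digit_id f y : y \in C -> digit f (id y) = f y.
Proof.
move=> yC; rewrite /digit (bigD1 y) ?yC ?eqxx //= big1 ?addn0 // => z.
by move=> /andP[/andP[zC /eqP Ez] zy]; rewrite (id_inj zC yC Ez) eqxx in zy.
Qed.

Lemma digit_lt f t : 0 < B -> {in C, forall y, f y < B} -> digit f t < B.
Proof.
move=> B0 hf; case: (pickP (fun y => (y \in C) && (id y == t))) => [y|no].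
  by move=> /andP[yC /eqP<-]; rewrite digit_id // hf.
by rewrite /digit big_pred0.
Qed.

Lemma code_digits n f : {in C, forall y, id y < n} ->
  code B id C f = \sum_(t < n) digit f t * B ^ t.
Proof.
move=> idn; rewrite /code /digit.
under [RHS]eq_bigr => t _ do rewrite big_distrl big_mkcondr /=.
rewrite exchange_big /=; apply: eq_bigr => y yC.
rewrite (bigD1 (Ordinal (idn y yC))) //= eqxx big1 ?addn0 // => t.
by rewrite -val_eqE /= eq_sym => /negbTE->.
Qed.

Lemma code_lt n f : {in C, forall y, id y < n} -> 0 < B ->
  {in C, forall y, f y < B} -> code B id C f < B ^ n.
Proof.
move=> idn B0 hf; rewrite (code_digits _ idn); apply: digits_lt => t.
exact: digit_lt.
Qed.

Lemma code_inj f g : 0 < B -> {in C, forall y, f y < B} ->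
  {in C, forall y, g y < B} -> code B id C f = code B id C g ->
  {in C, forall y, f y = g y}.
Proof.
move=> B0 hf hg E y yC.
have idn : {in C, forall z, id z < (\max_(z in C) id z).+1}.
  by move=> z zC; rewrite ltnS; apply: leq_bigmax_cond.
have := @digits_inj B _ (digit f) (digit g) _ _ _ (id y) (idn y yC).
by rewrite !digit_id //; apply=> [t|t|]; rewrite -?code_digits //; apply: digit_lt.
Qed.

End Code.

(** Descent on [U * 2 ^ q + W]. Transpositions first bring [U] to an initial segment; those that fix
    it then bring [W] to two blocks, and as the union is [[0, k)] the second block ends at [k]. *)
Lemma canonical_pair q k (Q : nat -> nat -> Prop) : k <= q ->
  (forall a U W, a.+1 < q -> Q U W -> Q (swap a U) (swap a W)) ->
  forall U W, U < 2 ^ q -> W < 2 ^ q ->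
  (forall t, bit t U || bit t W = (t < k)) -> Q U W ->
  exists i j, [/\ j <= i, i <= k & Q (2 ^ i - 1) (two_blocks j i k)].
Proof.
move=> kq Qs U W; have [m] := ubnP (U * 2 ^ q + W).
elim: m U W => // m IH U W; rewrite ltnS => hm Uq Wq UW QUW.
(* The premise on the bits puts [a.+1] below [k], so the transposition preserves the union
   [[0, k)]. *)
have step a : a.+1 < q -> bit a.+1 U || bit a.+1 W ->
    swap a U * 2 ^ q + swap a W < U * 2 ^ q + W ->
    exists i j, [/\ j <= i, i <= k & Q (2 ^ i - 1) (two_blocks j i k)].
  move=> aq ba lt; apply: (IH (swap a U) (swap a W)); rewrite ?swap_lt //.
  - exact: leq_trans lt hm.
  - by move=> t; rewrite !bit_swap UW; apply: tr_lt; rewrite -UW.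
  - exact: Qs.
have [/existsP[a lt]|noU] := boolP [exists a : 'I_q, (a.+1 < q) && (swap a U < U)].
  move: lt => /andP[aq lt]; apply: (step a) => //.
    by move: lt; rewrite swap_lower => /andP[->].
  have := swap_lt aq Wq; move: lt; set x := swap a U; set y := swap a W.
  move=> xU yq; apply: leq_trans (_ : x.+1 * 2 ^ q <= _); first by rewrite mulSn; lia.
  by apply: leq_trans (leq_addr _ _); rewrite leq_mul2r xU orbT.
have [|i iq EU] := minimal_initial Uq.
  move=> a aq; rewrite leqNgt; apply: contra noU => lt.
  by apply/existsP; exists (Ordinal (ltnW aq)); rewrite /= aq.
have [/existsP[a /and3P[aq Ea lt]]|noW] := boolP
    [exists a : 'I_q, [&& a.+1 < q, swap a U == U & swap a W < W]].
  apply: (step a) => //; last by rewrite (eqP Ea) ltn_add2l.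
  by move: lt; rewrite swap_lower => /andP[-> _]; rewrite orbT.
have [|j [l [ji il lq EW]]] := minimal_two_blocks iq Wq.
  move=> a aq; rewrite -EU => Ea; rewrite leqNgt; apply: contra noW => lt.
  by apply/existsP; exists (Ordinal (ltnW aq)); rewrite /= aq Ea eqxx.
have bits t : (t < i) || ((t < j) || (i <= t < l)) = (t < k).
  by rewrite -UW EU EW bit_ones bit_two_blocks.
have ik : i <= k.
  by case: (ltnP k i) => // ki; have := bits k; rewrite ki ltnn.
exists i, j; split=> //; suff <- : l = k by rewrite -EU -EW.
apply/eqP; rewrite eqn_leq; apply/andP; split; rewrite leqNgt; apply/negP => lt.
  by have := bits k; rewrite ltnn ik lt !orbT.
by have := bits l; rewrite lt ltnn andbF orbF => h; move: h; lia.
Qed.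

(** * Odometer arithmetic with digits from 1 to [N] *)

Section Odometer.
Variables (N L : nat) (X : nat -> nat).
Hypotheses (N0 : 0 < N) (hX : forall a, a < L -> 0 < X a <= N).

(** Digits start at 1 because the colour set of a vertex is nonempty: there are [2 ^ q - 1] of
    them. *)
Definition rank M (Y : nat -> nat) := \sum_(a < M) (Y a).-1 * N ^ a.

Lemma rank_lt M : M <= L -> rank M X < N ^ M.
Proof.
elim: M => [|M IH] ML; first by rewrite /rank big_ord0.
rewrite /rank big_ord_recr expnS /= -/(rank M X).
have /andP[x0 xN] := hX ML.
apply: (@leq_trans (N ^ M + (X M).-1 * N ^ M)); first by rewrite ltn_add2r IH // ltnW.
by rewrite -mulSn prednK // leq_mul2r xN orbT.
Qed.

Lemma rank_digit a : a < L -> X a = ((rank L X %/ N ^ a) %% N).+1.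
Proof.
move=> aL; have /andP[x0 xN] := hX aL.
rewrite /rank -(subnKC aL) big_split_ord /= big_ord_recr /= -/(rank a X).
set high := \sum_(i < _) _.
have [r ->] : exists r, high = r * N * N ^ a.
  exists (\sum_(i < L - a.+1) (X (a.+1 + i)).-1 * N ^ i).
  rewrite !big_distrl /=; apply: eq_bigr => i _.
  by rewrite expnD expnS -!mulnA; congr (_ * _); rewrite mulnA mulnC.
have Na : 0 < N ^ a by rewrite expn_gt0 N0.
rewrite -addnA -mulnDl addnC divnMDl // divn_small ?rank_lt 1?ltnW // addn0.
by rewrite addnC modnMDl modn_small ?prednK // -ltnS prednK.
Qed.

Lemma rank_eq M Y : (forall a, a < M -> X a = Y a) -> rank M X = rank M Y.
Proof. by move=> XY; apply: eq_bigr => a _; rewrite XY. Qed.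

(** The last digit is the most significant, so lowering it lowers the rank whatever happens to the
    others. Copying relies on this, as a transposition of colours changes all sets at once. *)
Lemma rank_last Y : 0 < L -> 0 < Y L.-1 -> X L.-1 < Y L.-1 -> rank L X < rank L Y.
Proof.
move=> L0 y0 lt; have [M EL] : exists M, L = M.+1 by exists L.-1; rewrite prednK.
have hM : rank M X < N ^ M by apply: rank_lt; rewrite EL.
rewrite EL /= in y0 lt *; rewrite /rank !big_ord_recr /= -/(rank M X) -/(rank M Y).
have /andP[x0 _] : 0 < X M <= N by apply: hX; rewrite EL.
apply: (@leq_trans (N ^ M + (X M).-1 * N ^ M)); first by rewrite ltn_add2r.
rewrite -mulSn prednK //; apply: leq_trans (leq_addl _ _).
by rewrite leq_mul2r -ltnS prednK // lt orbT.
Qed.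

End Odometer.

Lemma rank_digits N L it : 0 < N -> it < N ^ L ->
  rank N L (fun a => ((it %/ N ^ a) %% N).+1) = it.
Proof.
move=> N0; elim: L it => [|L IH] it; first by rewrite /rank big_ord0 expn0; case: it.
rewrite expnSr => hit; rewrite /rank big_ord_recr /=.
have NL : 0 < N ^ L by rewrite expn_gt0 N0.
rewrite (modn_small (_ : it %/ N ^ L < N)); last by rewrite ltn_divLR // mulnC.
rewrite [RHS](divn_eq it (N ^ L)) addnC; congr (_ + _).
rewrite -[RHS]IH ?ltn_mod //; apply: eq_bigr => a _ /=; congr (_ * _).
have Na : 0 < N ^ a by rewrite expn_gt0 N0.
have E : N ^ L = N ^ (L - a.+1) * N * N ^ a by rewrite -mulnA -expnS -expnD subnK.
rewrite {1}(divn_eq it (N ^ L)); move: (it %/ N ^ L) (it %% N ^ L) => Q r.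
by rewrite E mulnA divnMDl // mulnA modnMDl.
Qed.

Lemma odometer_digit N it a : 0 < N ->
  (it.+1 %/ N ^ a) %% N =
    if N ^ a %| it.+1 then (if (it %/ N ^ a) %% N == N.-1 then 0
                            else ((it %/ N ^ a) %% N).+1)
    else (it %/ N ^ a) %% N.
Proof.
move=> N0; have Na : 0 < N ^ a by rewrite expn_gt0 N0.
rewrite divnS //; case: (N ^ a %| it.+1); rewrite ?add0n // add1n.
set x := it %/ N ^ a; rewrite -addn1 -modnDml.
have := ltn_pmod x N0; case: eqP => [->|ne] lt; first by rewrite addn1 prednK // modnn.
by rewrite addn1 modn_small //; lia.
Qed.

(** A carry reaches digit [a] exactly when [N ^ a] divides the new count; this becomes the loop
    invariant of the increment. *)
Lemma odometer_carry N it a : 0 < N ->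
  (N ^ a.+1 %| it.+1) = (N ^ a %| it.+1) && ((it %/ N ^ a) %% N == N.-1).
Proof.
move=> N0; have Na : 0 < N ^ a by rewrite expn_gt0 N0.
case: (boolP (N ^ a %| it.+1)) => [d|nd] /=; last first.
  by apply/negbTE; apply: contra nd; apply: dvdn_trans; rewrite dvdn_exp2l.
have -> : it.+1 = ((it %/ N ^ a).+1) * N ^ a.
  by rewrite -[LHS](divnK d) divnS // d.
rewrite expnS dvdn_pmul2r // /dvdn -addn1 -modnDml.
set x := it %/ N ^ a; have := ltn_pmod x N0.
case: eqP => E1; case: eqP => E2 //; move: (x %% N) E1 E2 => r E1 E2 lt.
  by case: E2; move: E1; case: (ltngtP r.+1 N) => // h; [rewrite modn_small; lia|lia|lia].
by case: E1; rewrite E2 addn1 prednK // modnn.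
Qed.

Lemma bit_pow2 t c : bit t (2 ^ c) = (t == c).
Proof.
elim: c t => [|c IH] [|t] //=; first exact: bit0n.
  by rewrite expnS oddM.
by rewrite expnS mul2n doubleK IH.
Qed.

(** * Contractions *)

Section Contract.
Variables (V : finType) (H : trigraph V) (u v w : V).
Hypothesis wV : w \notin vertices H.

Let H' := contract H (u, v, w).
Let rest := vertices H :\: [set u; v].

Lemma w_notin_rest : w \notin rest.
Proof. by apply: contra wV; rewrite inE => /andP[]. Qed.

Lemma rest_neq x : x \in rest -> (x == w) = false.
Proof. by move=> xr; apply/negbTE; apply: contraTneq xr => ->; apply: w_notin_rest. Qed.

Lemma black_rest x y : x \in rest -> y \in rest -> black H' x y = black H x y.
Proof. by move=> xr yr; rewrite /= xr yr !rest_neq //= orbF. Qed.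

Lemma red_rest x y : x \in rest -> y \in rest -> red H' x y = red H x y.
Proof. by move=> xr yr; rewrite /= xr yr !rest_neq //= orbF. Qed.

Lemma black_new x : x \in rest -> black H' w x = black H u x && black H v x.
Proof.
by move=> xr; rewrite /= -/rest (negbTE w_notin_rest) xr eqxx (rest_neq xr) /= orbF.
Qed.

Lemma red_new x : x \in rest -> red H' w x =
  (edge H u x || edge H v x) && ~~ (black H u x && black H v x).
Proof.
by move=> xr; rewrite /= -/rest (negbTE w_notin_rest) xr eqxx (rest_neq xr) /= orbF.
Qed.

Lemma black_new_sym x : x \in rest -> black H' x w = black H' w x.
Proof.
by move=> xr; rewrite /= -/rest (negbTE w_notin_rest) xr eqxx (rest_neq xr) /= !orbF.
Qed.

Lemma red_new_sym x : x \in rest -> red H' x w = red H' w x.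
Proof.
by move=> xr; rewrite /= -/rest (negbTE w_notin_rest) xr eqxx (rest_neq xr) /= !orbF.
Qed.

Lemma black_newxx : black H' w w = false.
Proof. by rewrite /= -/rest (negbTE w_notin_rest) !andbF. Qed.

Lemma verticesP x : x \in vertices H' -> x = w \/ x \in rest.
Proof. by rewrite in_setU1 => /orP[/eqP|]; [left|right]. Qed.

Lemma contract_red_vertices x y :
  red H' x y -> x \in vertices H' /\ y \in vertices H'.
Proof.
rewrite /= -/rest !in_setU1 => /or3P[]/and3P[/= h1 h2 _]; split.
all: by rewrite ?h1 ?h2 ?orbT.
Qed.

End Contract.

Section Trigraph.
Variables (V T : finType) (e : rel T).
Implicit Types (H : trigraph V) (part : V -> {set T}).

Definition part_step part (p : V * V * V) : V -> {set T} :=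
  let: (u, v, w) := p in fun x => if x == w then part u :|: part v else part x.

(* [part x] is the set of original vertices contracted into [x]. *)
Record trigraph_inv H part : Prop := TrigraphInv {
  red_sym : symmetric (red H);
  red_vertices : forall x y, red H x y -> x \in vertices H /\ y \in vertices H;
  black_sym : {in vertices H &, symmetric (black H)};
  red_black : forall x y, red H x y -> ~~ black H x y;
  black_irr : {in vertices H, forall x, black H x x = false};
  part_disjoint : {in vertices H &, forall x y p, p \in part x -> p \in part y -> x = y};
  part_neq0 : {in vertices H, forall x, part x != set0};
  part_cover : forall p, exists2 x, x \in vertices H & p \in part x;
  black_edges : {in vertices H &, forall x y p r, black H x y ->
    p \in part x -> r \in part y -> e p r};
  non_edges : {in vertices H &, forall x y p r, x != y -> ~~ edge H x y ->
    p \in part x -> r \in part y -> ~~ e p r} }.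

(** A black edge at the new vertex comes from black edges at both [u] and [v], a non-edge from
    non-edges at both; only red edges lose information about the input graph. *)
Lemma trigraph_inv_step H part u v w : trigraph_inv H part ->
  symmetric e ->
  u \in vertices H -> v \in vertices H -> u != v -> w \notin vertices H ->
  trigraph_inv (contract H (u, v, w)) (part_step part (u, v, w)).
Proof.
move=> [rs rv bs rb bi pd p0 pc be ne] es uV vV uv wV.
set H' := contract _ _; set part' := part_step _ _.
pose rest := vertices H :\: [set u; v].
have pw : part' w = part u :|: part v by rewrite /part' /= eqxx.
have pr x : x \in rest -> part' x = part x.
  by move=> xr; rewrite /part' /= (rest_neq wV xr).
have rV x : x \in rest -> x \in vertices H by rewrite inE => /andP[].
have ru x : x \in rest -> (x != u) /\ (x != v).
  by rewrite !inE negb_or => /andP[/andP[-> ->]].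
split.
- have sy x y : red H' x y -> red H' y x.
    move=> h; have [] := contract_red_vertices h.
    move=> /verticesP[ex|xr] /verticesP[ey|yr].
    + by move: h; rewrite ex ey.
    + by move: h; rewrite ex (red_new_sym wV).
    + by move: h; rewrite ey (red_new_sym wV).
    + by move: h; rewrite !(red_rest wV) // rs.
  by move=> x y; apply/idP/idP; apply: sy.
- exact: contract_red_vertices.
- move=> x y /verticesP[->|xr] /verticesP[->|yr] //.
  + by rewrite (black_new_sym wV).
  + by rewrite (black_new_sym wV).
  + by rewrite !(black_rest wV) // bs ?rV.
- move=> x y h; have [] := contract_red_vertices h.
  move=> /verticesP[ex|xr] /verticesP[ey|yr].
  + by rewrite ex ey (black_newxx _ _ wV).
  + by move: h; rewrite ex (red_new wV) // (black_new wV) // => /andP[].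
  + move: h; rewrite ey (red_new_sym wV) // (black_new_sym wV) //.
    by rewrite (red_new wV) // (black_new wV) // => /andP[].
  + by move: h; rewrite (red_rest wV) // (black_rest wV) //; apply: rb.
- move=> x /verticesP[->|xr]; first exact: black_newxx.
  by rewrite (black_rest wV) // bi ?rV.
- move=> x y /verticesP[->|xr] /verticesP[->|yr] // p.
  + rewrite pw (pr y yr) inE => /orP[pu|pv] py; have [y1 y2] := ru y yr.
      by have := pd _ _ uV (rV _ yr) _ pu py => E; rewrite E eqxx in y1.
    by have := pd _ _ vV (rV _ yr) _ pv py => E; rewrite E eqxx in y2.
  + rewrite pw (pr x xr) inE => px /orP[pu|pv]; have [y1 y2] := ru x xr.
      by have := pd _ _ uV (rV _ xr) _ pu px => E; rewrite E eqxx in y1.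
    by have := pd _ _ vV (rV _ xr) _ pv px => E; rewrite E eqxx in y2.
  + by rewrite !pr // => h1 h2; apply: pd h1 h2; apply: rV.
- move=> x /verticesP[->|xr]; last by rewrite pr // p0 ?rV.
  rewrite pw; have /set0Pn[p pu] := p0 _ uV.
  by apply/set0Pn; exists p; rewrite inE pu.
- move=> p; have [x xV px] := pc p.
  have [xr|] := boolP (x \in rest).
    by exists x; rewrite ?pr // in_setU1 -/rest xr orbT.
  rewrite !inE xV andbT negbK => xuv; exists w; first by rewrite in_setU1 eqxx.
  by rewrite pw inE; case/orP: xuv => /eqP <-; rewrite px ?orbT.
- move=> x y /verticesP[->|xr] /verticesP[->|yr] p r.
  + by rewrite (black_newxx _ _ wV).
  + rewrite (black_new wV) // pw (pr y yr) inE => /andP[b1 b2] /orP[pu|pv] ry.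
      exact: (be _ _ uV (rV _ yr) _ _ b1 pu ry).
    exact: (be _ _ vV (rV _ yr) _ _ b2 pv ry).
  + rewrite (black_new_sym wV) // (black_new wV) // pw (pr x xr) inE.
    move=> /andP[b1 b2] px /orP[ru'|rv']; rewrite es.
      exact: (be _ _ uV (rV _ xr) _ _ b1 ru' px).
    exact: (be _ _ vV (rV _ xr) _ _ b2 rv' px).
  + by rewrite (black_rest wV) // !pr // => h1 h2 h3; apply: (be _ _ (rV _ xr) (rV _ yr) _ _ h1 h2 h3).
- have noedge x y p r : y \in rest -> x \in [set u; v] ->
     ~~ edge H' w y -> p \in part x -> r \in part y -> ~~ e p r.
    move=> yr xuv; rewrite /edge (black_new wV) // (red_new wV) //.
    have [y1 y2] := ru y yr.
    have edge_of z : edge H z y = black H z y || red H z y by [].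
    rewrite negb_or negb_and => /andP[h1 h2].
    have h3 : ~~ edge H x y.
      move: h2 xuv; rewrite h1 andbT negb_or => /andP[a b].
      by rewrite !inE => /orP[]/eqP->.
    have xV : x \in vertices H by move: xuv; rewrite !inE => /orP[]/eqP->.
    apply: ne => //; rewrite ?rV //.
    by move: xuv; rewrite !inE => /orP[]/eqP->; rewrite eq_sym.
  move=> x y /verticesP[->|xr] /verticesP[->|yr] p r.
  + by rewrite eqxx.
  + rewrite pw pr // inE => _ nw /orP[pu|pv] ry.
      by apply: (noedge u y) => //; rewrite !inE eqxx.
    by apply: (noedge v y) => //; rewrite !inE eqxx ?orbT.
  + rewrite pw pr // inE => _ nw px /orP[pu|pv]; rewrite es.
      apply: (noedge u x) => //; rewrite ?inE ?eqxx //.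
      by rewrite /edge -(black_new_sym wV) // -(red_new_sym wV).
    apply: (noedge v x) => //; rewrite ?inE ?eqxx ?orbT //.
    by rewrite /edge -(black_new_sym wV) // -(red_new_sym wV).
  + rewrite !pr // /edge (black_rest wV) // (red_rest wV) // => xy nxy px ry.
    by apply: ne nxy px ry => //; apply: rV.
Qed.

Lemma red_component_sub H x : red_component H x \subset vertices H.
Proof. by apply/subsetP=> y; rewrite inE => /andP[]. Qed.

Lemma mem_red_component H x : x \in vertices H -> x \in red_component H x.
Proof. by move=> xV; rewrite inE xV connect0. Qed.

Lemma red_component_closed H part x y z : trigraph_inv H part ->
  y \in red_component H x -> red H y z -> z \in red_component H x.
Proof.
move=> hH; rewrite !inE => /andP[yV xy] yz; have [_ ->] := red_vertices hH yz.
exact: connect_trans xy (connect1 yz).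
Qed.

Lemma red_component_same H part x y : trigraph_inv H part ->
  y \in red_component H x -> red_component H y = red_component H x.
Proof.
move=> hH; rewrite inE => /andP[yV xy]; apply/setP=> z; rewrite !inE.
have cs : connect_sym (red H) by apply: sym_connect_sym; exact: red_sym hH.
by rewrite (same_connect cs xy).
Qed.

Lemma connect_stays (r : rel V) (D : {set V}) x y :
  (forall y z, y \in D -> r y z -> z \in D) ->
  x \in D -> connect r x y -> y \in D.
Proof.
move=> cl xD /connectP[p]; elim: p x xD => [|z p IH] x xD /=; first by move=> _ ->.
by move=> /andP[xz pp]; apply: IH pp; apply: cl xz.
Qed.

Lemma red_component_min H (D : {set V}) x :
  (forall y z, y \in D -> red H y z -> z \in D) ->
  x \in D -> red_component H x \subset D.
Proof.
move=> cl xD; apply/subsetP=> y; rewrite inE => /andP[_].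
exact: connect_stays cl xD.
Qed.

Section Step.
Variables (H : trigraph V) (part : V -> {set T}) (u v w : V).
Hypotheses (hH : trigraph_inv H part) (es : symmetric e)
  (uV : u \in vertices H) (vV : v \in vertices H) (uv : u != v)
  (wV : w \notin vertices H).

Let H' := contract H (u, v, w).
Let part' := part_step part (u, v, w).
Let C' := red_component H' w.
Let hH' : trigraph_inv H' part'.
Proof. exact: trigraph_inv_step. Qed.

(* The component of [w], as it was before the contraction. *)
Definition merged : {set V} := [set u; v] :|: C' :\ w.

Lemma C'_rest x : x \in C' :\ w -> x \in vertices H :\: [set u; v].
Proof.
rewrite in_setD1 => /andP[xw /(subsetP (red_component_sub _ _))].
by move/verticesP => [E|//]; rewrite E eqxx in xw.
Qed.

Lemma merged_sub : merged \subset vertices H.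
Proof.
apply/subsetP=> x; rewrite inE => /orP[|/C'_rest]; last by rewrite inE => /andP[].
by rewrite !inE => /orP[]/eqP->.
Qed.

(** A red neighbour of [u] or [v] outside the pair becomes a red neighbour of [w]: a red edge is not
    black, so the edges from [u] and [v] are not both black. *)
Lemma merged_closed y z : y \in merged -> red H y z -> z \in merged.
Proof.
have wC : w \in C' by apply: mem_red_component; rewrite in_setU1 eqxx.
move=> yM yz; have [yV zV] := red_vertices hH yz.
have [zuv|nz] := boolP (z \in [set u; v]); first by rewrite inE zuv.
have zr : z \in vertices H :\: [set u; v] by rewrite inE nz.
rewrite inE (negbTE nz) /= in_setD1 (rest_neq wV zr) /=.
have [yuv|ny] := boolP (y \in [set u; v]); last first.
  move: yM; rewrite inE (negbTE ny) /= => yC.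
  have yr := C'_rest yC; move: yC; rewrite in_setD1 => /andP[_ yC].
  by apply: (red_component_closed hH' yC); rewrite (red_rest wV).
apply: (red_component_closed hH' wC); rewrite (red_new wV) //.
have nb := red_black hH yz; move: yuv; rewrite !inE => /orP[]/eqP E; rewrite -?E.
  by rewrite /edge yz (negbTE nb) orbT.
by rewrite /edge yz (negbTE nb) !orbT andbF.
Qed.

(** No red edge enters [merged] from outside, so the old and the new component are each closed under
    the red edges of the other trigraph. The table entries of such a component stay valid. *)
Lemma red_component_other x : x \in vertices H -> x \notin merged ->
  [/\ x \in vertices H', x \notin C' & red_component H x = red_component H' x].
Proof.
move=> xV xM; have xr : x \in vertices H :\: [set u; v].
  by rewrite inE xV andbT; apply: contra xM => h; rewrite inE h.
have xw := rest_neq wV xr.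
have xV' : x \in vertices H' by rewrite in_setU1 xr orbT.
have xC : x \notin C' by apply: contra xM => h; rewrite inE in_setD1 xw h orbT.
split=> //; apply/eqP; rewrite eqEsubset; apply/andP; split.
  have clos y z : y \in red_component H' x :\: merged -> red H y z ->
      z \in red_component H' x :\: merged.
    rewrite inE => /andP[yM yC] yz.
    have zM : z \notin merged.
      by apply: contra yM => zM; apply: merged_closed zM _; rewrite (red_sym hH).
    have nr t : t \in vertices H -> t \notin merged -> t \in vertices H :\: [set u; v].
      move=> tV tM; rewrite inE tV andbT; apply: contra tM => h.
      by rewrite inE h.
    have [yV zV] := red_vertices hH yz.
    by rewrite inE zM; apply: (red_component_closed hH' yC); rewrite (red_rest wV) // nr.
  apply: subset_trans (_ : _ \subset red_component H' x :\: merged) _; last exact: subsetDl.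
  by apply: red_component_min clos _; rewrite inE xM mem_red_component.
apply: red_component_min; last exact: mem_red_component.
have CM y : y \in red_component H x -> y \notin merged.
  move=> yC; apply: contra xM => yM.
  have /subsetP -> // := red_component_min merged_closed yM.
  by rewrite (red_component_same hH yC) mem_red_component.
move=> y z yC yz; have yM := CM y yC.
have yr : y \in vertices H :\: [set u; v].
  rewrite inE (subsetP (red_component_sub _ _) y yC) andbT.
  by apply: contra yM => h; rewrite inE h.
have [_ /verticesP[E|zr]] := contract_red_vertices yz.
  case/negP: yM; rewrite inE in_setD1 (rest_neq wV yr) /=; apply/orP; right.
  have wC : w \in C' by apply: mem_red_component; rewrite in_setU1 eqxx.
  by apply: (red_component_closed hH' wC); rewrite (red_sym hH') -E.
by apply: (red_component_closed hH yC); rewrite -(red_rest wV yr zr).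
Qed.

End Step.

(** * Realizable families of colour sets *)

Variable q : nat.

(** The colouring is total but constrained on the parts of [C] alone. The sets are exact, which is
    what lets black edges be checked on them. *)
Definition realizable part (C : {set V}) (f : V -> nat) : Prop :=
  exists c : {ffun T -> 'I_q},
    {in C &, forall x y p r, p \in part x -> r \in part y -> e p r -> c p != c r} /\
    {in C, forall x t, t < q -> bit t (f x) = [exists p in part x, c p == t :> nat]}.

Lemma realizable_ext part part' (C : {set V}) f f' :
  {in C, part =1 part'} -> {in C, f =1 f'} ->
  realizable part C f -> realizable part' C f'.
Proof.
move=> Ep Ef [c [c1 c2]]; exists c; split=> [x y xC yC p r|x xC t tq].
  by rewrite -!Ep //; apply: c1.
by rewrite -Ef // -Ep // c2.
Qed.

Lemma realizable_swap a part C f : a.+1 < q ->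
  realizable part C f -> realizable part C (fun x => swap a (f x)).
Proof.
move=> aq [c [c1 c2]]; pose trq (i : 'I_q) := Ordinal (etrans (tr_lt i aq) (ltn_ord i)).
exists [ffun p => trq (c p)]; split=> [x y xC yC p r px ry epr|x xC t tq].
  rewrite !ffunE; apply: contra (c1 _ _ xC yC _ _ px ry epr) => /eqP/(congr1 val) /=.
  by move/(inv_inj (@trK a))/val_inj->.
rewrite bit_swap c2 ?tr_lt //; apply: eq_existsb => p; congr (_ && _).
by rewrite ffunE /= -(inj_eq (inv_inj (@trK a))) trK.
Qed.

Lemma realizable_gt0 part (C : {set V}) f x :
  realizable part C f -> x \in C -> part x != set0 -> 0 < f x.
Proof.
move=> [c [_ c2]] xC /set0Pn[p px]; case E : (f x) => //.
have := c2 x xC (c p) (ltn_ord _); rewrite E bit0n => /esym/existsP; case.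
by exists p; rewrite px eqxx.
Qed.

Section Glue.
Variables (H : trigraph V) (part : V -> {set T}).
Hypotheses (hH : trigraph_inv H part) (q0 : 0 < q).

(** Vertices in different red components are joined by a black edge, and then their parts are
    completely adjacent, or by none, and then there is no edge between their parts. Properness
    across components thus depends on the colour sets only. *)
Lemma realizable_glue (D : {set V}) f : D \subset vertices H ->
  (forall y z, y \in D -> red H y z -> z \in D) ->
  realizable part D f <->
  {in D &, forall x y, black H x y -> forall t, t < q -> ~~ (bit t (f x) && bit t (f y))} /\
  {in D, forall x, realizable part (red_component H x) f}.
Proof.
move=> DV cl; have inD x : x \in D -> x \in vertices H by apply: (subsetP DV).
split=> [[c [c1 c2]]|[bl comp]].
  split=> [x y xD yD bxy t tq|x xD]; last first.
    have sub := red_component_min cl xD.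
    exists c; split=> [y z yC zC|y yC]; first by apply: c1; apply: (subsetP sub).
    by apply: c2; apply: (subsetP sub).
  rewrite !c2 //; apply/negP=> /andP[/existsP[p /andP[px /eqP cp]] /existsP[r /andP[ry /eqP cr]]].
  have := c1 x y xD yD p r px ry (black_edges hH (inD _ xD) (inD _ yD) bxy px ry).
  by rewrite -val_eqE /= cp cr eqxx.
have cs : connect_sym (red H) by apply: sym_connect_sym; exact: red_sym hH.
pose good x (c : {ffun T -> 'I_q}) := x \in D ->
  {in red_component H x &, forall y z p r, p \in part y -> r \in part z -> e p r -> c p != c r} /\
  {in red_component H x, forall y t, t < q -> bit t (f y) = [exists p in part y, c p == t :> nat]}.
have /fin_all_exists[col hcol] : forall x, exists c, good x c.
  move=> x; have [xD|/negbTE xD] := boolP (x \in D); last first.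
    by exists [ffun=> Ordinal q0]; rewrite /good xD.
  by have [c hc] := comp x xD; exists c.
(* Components are coloured independently; taking the colouring chosen at the root makes all vertices
   of one component use the same one. *)
pose c := [ffun p => if [pick x in D | p \in part x] is Some x
                     then col (root (red H) x) p else Ordinal q0].
have cE x p : x \in D -> p \in part x -> c p = col (root (red H) x) p.
  move=> xD px; rewrite ffunE; case: pickP => [y /andP[yD py]|/(_ x)]; last by rewrite xD px.
  by rewrite (part_disjoint hH (inD _ yD) (inD _ xD) py px).
have rD x : x \in D -> root (red H) x \in D.
  by move=> xD; apply: connect_stays cl xD (connect_root _ x).
have inroot x : x \in D -> x \in red_component H (root (red H) x).
  by move=> xD; rewrite inE inD // cs connect_root.
have cbit x t : x \in D -> t < q -> bit t (f x) = [exists p in part x, c p == t :> nat].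
  move=> xD tq; have [_ h2] := hcol _ (rD x xD); rewrite (h2 _ (inroot _ xD)) //.
  apply: eq_existsb => p; case px: (p \in part x) => //=.
  by rewrite (cE _ _ xD px).
exists c; split=> [x y xD yD p r px ry epr|x xD t tq]; last exact: cbit.
have [xy|nxy] := boolP (connect (red H) x y).
  rewrite (cE _ _ xD px) (cE _ _ yD ry).
  have Er : root (red H) y = root (red H) x by apply/eqP; rewrite root_connect // cs.
  rewrite Er; have [h1 _] := hcol _ (rD x xD).
  apply: h1 px ry epr; rewrite ?inroot //.
  by rewrite -Er inroot.
have xy : x != y by apply: contraNneq nxy => ->; apply: connect0.
have [bxy|nb] := boolP (black H x y).
  apply/eqP=> E; have := bl x y xD yD bxy (c p) (ltn_ord _); rewrite !cbit ?ltn_ord //.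
  case/negP; apply/andP; split; apply/existsP; first by exists p; rewrite px eqxx.
  by exists r; rewrite ry E eqxx.
have ne : ~~ edge H x y.
  by rewrite /edge negb_or nb; apply: contra nxy => h; apply: connect1.
by have := non_edges hH (inD _ xD) (inD _ yD) xy ne px ry; rewrite epr.
Qed.

End Glue.

(** One colouring serves on both sides: contraction merges [part u] and [part v] without changing
    which input vertices are covered, and [U], [W] are the colours used on each. *)
Lemma realizable_contract part (C : {set V}) u v w f' : symmetric e ->
  u \notin C -> v \notin C -> w \notin C -> u != v ->
  realizable (part_step part (u, v, w)) (w |: C) f' <->
  exists U W, [/\ U < 2 ^ q, W < 2 ^ q,
    forall t, t < q -> bit t (f' w) = bit t U || bit t W
    & realizable part ([set u; v] :|: C)
        (fun x => if x == u then U else if x == v then W else f' x)].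
Proof.
move=> es uC vC wC uv; set part' := part_step _ _.
have pw : part' w = part u :|: part v by rewrite /part' /= eqxx.
have neq x z : x \in C -> z \notin C -> (x == z) = false.
  by move=> xC zC; apply/negbTE; apply: contraNneq zC => <-.
have pC x : x \in C -> part' x = part x.
  by move=> xC; rewrite /part' /= (neq _ _ xC wC).
have wI : w \in w |: C by rewrite setU11.
split=> [[c [c1 c2]]|[U [W [hU hW UW [c [c1 c2]]]]]].
  exists (bitmask q (fun t => [exists p in part u, c p == t :> nat])).
  exists (bitmask q (fun t => [exists p in part v, c p == t :> nat])).
  split; [exact: bitmask_lt|exact: bitmask_lt| |].
    move=> t tq; rewrite !bit_bitmask tq c2 //= pw.
    apply/existsP/orP => [[p]|[]/existsP[p /andP[pp cp]]].
    - by rewrite inE => /andP[/orP[pp|pp] cp]; [left|right]; apply/existsP; exists p; rewrite pp.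
    - by exists p; rewrite inE pp cp.
    - by exists p; rewrite inE pp cp orbT.
  exists c; split.
    have rep x : x \in [set u; v] :|: C -> exists2 x', x' \in w |: C & part x \subset part' x'.
      rewrite in_setU => /orP[|xC]; last by exists x; rewrite ?pC // in_setU1 xC orbT.
      by rewrite !inE => /orP[]/eqP->; exists w; rewrite // pw ?subsetUl ?subsetUr.
    move=> x y /rep[x' x'C /subsetP sx] /rep[y' y'C /subsetP sy] p r px ry.
    exact: c1 x'C y'C _ _ (sx _ px) (sy _ ry).
  move=> x; rewrite in_setU => /orP[xuv|xC] t tq.
    move: xuv; rewrite !inE; case: eqP => [-> _|_ /= /eqP ->].
      by rewrite bit_bitmask tq.
    by rewrite eqxx bit_bitmask tq.
  rewrite (neq _ _ xC uC) (neq _ _ xC vC) c2 ?pC // in_setU1 xC orbT //.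
exists c; split.
  have rep x p : x \in w |: C -> p \in part' x ->
      exists2 x', x' \in [set u; v] :|: C & p \in part x'.
    rewrite in_setU1 => /orP[/eqP->|xC]; last by rewrite pC //; exists x; rewrite ?inE ?xC ?orbT.
    by rewrite pw inE => /orP[pp|pp]; [exists u|exists v]; rewrite ?inE ?eqxx ?orbT.
  by move=> x y xC yC p r /(rep _ _ xC)[x' hx px] /(rep _ _ yC)[y' hy ry]; apply: c1 px ry.
move=> x; rewrite in_setU1 => /orP[/eqP->|xC] t tq; last first.
  have := c2 x; rewrite (neq _ _ xC uC) (neq _ _ xC vC) pC //; apply=> //.
  by rewrite !inE xC !orbT.
have := c2 u; rewrite eqxx => cu; have := c2 v; rewrite eqxx eq_sym (negbTE uv) => cv.
rewrite UW // cu ?cv //; first last.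
- by rewrite !inE eqxx ?orbT.
- by rewrite !inE eqxx ?orbT.
rewrite pw; apply/orP/existsP => [[]/existsP[p /andP[pp cp]]|[p]].
- by exists p; rewrite inE pp cp.
- by exists p; rewrite inE pp cp orbT.
- by rewrite inE => /andP[/orP[pp|pp] cp]; [left|right]; apply/existsP; exists p; rewrite pp.
Qed.

End Trigraph.

Lemma nth_flatten_const (A : Type) (x0 : A) k (ss : seq (seq A)) i j :
  all (fun s => size s == k) ss -> i < size ss -> j < k ->
  nth x0 (flatten ss) (i * k + j) = nth x0 (nth [::] ss i) j.
Proof.
elim: ss i => //= s ss IH [|i] /andP[/eqP hs hss] hi hj.
  by rewrite mul0n nth_cat hs hj.
rewrite nth_cat hs mulSn -addnA ltnNge leq_addr /= addKn.
exact: IH.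
Qed.

Lemma size_flatten_const (A : Type) k (ss : seq (seq A)) :
  all (fun s => size s == k) ss -> size (flatten ss) = size ss * k.
Proof. by elim: ss => //= s ss IH /andP[/eqP hs hss]; rewrite size_cat hs IH // mulSn. Qed.

Lemma colorable1 n (e : rel 'I_n) : colorable 1 e = [forall x, forall y, ~~ e x y].
Proof.
apply/existsP/forallP => [[c /forallP h] x|h].
  apply/forallP=> y; have /forallP/(_ y)/implyP h2 := h x.
  by apply/negP => /h2; rewrite (ord1 (c x)) (ord1 (c y)).
exists [ffun=> ord0]; apply/forallP=> x; apply/forallP=> y.
by have /forallP/(_ y)/negbTE-> := h x.
Qed.

Lemma colorable_widen q n (e : rel 'I_n) : irreflexive e -> n <= q -> colorable q e.
Proof.
move=> irr nq; apply/existsP; exists [ffun x => widen_ord nq x].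
apply/forallP=> x; apply/forallP=> y; apply/implyP=> exy; rewrite !ffunE.
apply: contraTneq exy => /(congr1 val) /= /val_inj ->.
by rewrite irr.
Qed.

Lemma edgeless_contract (V : finType) (H : trigraph V) p :
  (forall x y, ~~ edge H x y) -> forall x y, ~~ edge (contract H p) x y.
Proof.
case: p => [[u v] w] h; have hb x y : black H x y = false.
  by apply/negbTE; have := h x y; rewrite /edge negb_or => /andP[].
have hr x y : red H x y = false.
  by apply/negbTE; have := h x y; rewrite /edge negb_or => /andP[].
by move=> x y; rewrite /edge /= /edge !hb !hr /= !andbF.
Qed.

(** * The trigraphs along a contraction sequence *)

Section Sequence.
Variables (n : nat) (e : rel 'I_n) (s : seq (name n * name n * name n)).
Hypotheses (es : symmetric e) (ei : irreflexive e)
  (hs : contraction_sequence (trigraph_of_graph e) s).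

Definition trigraph_at i := foldl (@contract _) (trigraph_of_graph e) (take i s).

Definition part0 (a : name n) : {set 'I_n} := [set x | lshift n x == a].

Definition part_at i := foldl (@part_step _ _) part0 (take i s).

Definition su (p0 : name n * name n * name n) i := (nth p0 s i).1.1.
Definition sv (p0 : name n * name n * name n) i := (nth p0 s i).1.2.
Definition sw (p0 : name n * name n * name n) i := (nth p0 s i).2.

Lemma trigraph_atS p0 i : i < size s ->
  trigraph_at i.+1 = contract (trigraph_at i) (su p0 i, sv p0 i, sw p0 i).
Proof.
move=> hi; rewrite /trigraph_at (take_nth p0 hi) -cats1 foldl_cat /= /su /sv /sw.
by case: (nth _ _ _) => [[]].
Qed.

Lemma part_atS p0 i : i < size s ->
  part_at i.+1 = part_step (part_at i) (su p0 i, sv p0 i, sw p0 i).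
Proof.
move=> hi; rewrite /part_at (take_nth p0 hi) -cats1 foldl_cat /= /su /sv /sw.
by case: (nth _ _ _) => [[]].
Qed.

Lemma sequence_at i : i <= size s -> contraction_sequence (trigraph_at i) (drop i s).
Proof.
elim: i => [|i IH] hi; first by rewrite /trigraph_at take0 drop0.
case E : s => [|p0 s'] ; first by rewrite E in hi.
have := IH (ltnW hi); rewrite (drop_nth p0 hi) -E (trigraph_atS p0 hi) /su /sv /sw.
by case: (nth p0 s i) => [[u v] w] /= /and5P[].
Qed.

Lemma step_at p0 i : i < size s ->
  [/\ su p0 i \in vertices (trigraph_at i), sv p0 i \in vertices (trigraph_at i),
      su p0 i != sv p0 i & sw p0 i \notin vertices (trigraph_at i)].
Proof.
move=> hi; have := sequence_at (ltnW hi); rewrite (drop_nth p0 hi) /su /sv /sw.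
by case: (nth p0 s i) => [[u v] w] /= /and5P[].
Qed.

Lemma card_at i : i <= size s -> #|vertices (trigraph_at i)| + i = n.
Proof.
elim: i => [|i IH] hi.
  rewrite /trigraph_at take0 addn0 /= card_imset ?card_ord //.
  exact: lshift_inj.
case E : s => [|p0 s'] ; first by rewrite E in hi.
rewrite (trigraph_atS p0 hi) -[in RHS](IH (ltnW hi)).
have [uV vV uv wV] := step_at p0 hi.
have -> : vertices (contract (trigraph_at i) (su p0 i, sv p0 i, sw p0 i)) =
  sw p0 i |: (vertices (trigraph_at i) :\: [set su p0 i; sv p0 i]) by [].
rewrite cardsU1 (w_notin_rest _ _ wV) addnS -addSn; congr (_ + _).
have := cardsID [set su p0 i; sv p0 i] (vertices (trigraph_at i)).
rewrite (setIidPr _); last by apply/subsetP=> x; rewrite !inE => /orP[]/eqP->.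
by rewrite cards2 uv; lia.
Qed.

Lemma size_sequence : (size s).+1 = n.
Proof.
rewrite -[RHS](card_at (leqnn _)); have := sequence_at (leqnn (size s)).
by rewrite drop_size /= => /eqP->; rewrite add1n.
Qed.

Lemma trigraph_inv_at i : i <= size s -> trigraph_inv e (trigraph_at i) (part_at i).
Proof.
elim: i => [|i IH] hi; last first.
  case E : s => [|p0 s'] ; first by rewrite E in hi.
  rewrite (trigraph_atS p0 hi) (part_atS p0 hi).
  have [uV vV uv wV] := step_at p0 hi.
  exact: trigraph_inv_step (IH (ltnW hi)) es uV vV uv wV.
rewrite /trigraph_at /part_at take0 /=.
have inj : injective (@lshift n n) by apply: lshift_inj.
split=> //=.
- move=> x y _ _; apply/existsP/existsP => -[a /existsP[b /and3P[h1 h2 h3]]];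
    by exists b; apply/existsP; exists a; rewrite h1 h2 es.
- move=> x _; apply/negbTE/existsP => -[a /existsP[b /and3P[/eqP -> /eqP/inj -> ]]].
  by rewrite ei.
- by move=> x y _ _ p; rewrite !inE => /eqP -> /eqP ->.
- by move=> x /imsetP[a _ ->]; apply/set0Pn; exists a; rewrite inE.
- by move=> p; exists (lshift n p); rewrite ?inE //; apply: imset_f.
- move=> x y _ _ p r /existsP[a /existsP[b /and3P[/eqP -> /eqP -> ab]]].
  by rewrite !inE => /eqP/inj -> /eqP/inj ->.
- move=> x y _ _ p r _; rewrite /edge /= orbF !inE => ne /eqP Ex /eqP Ey.
  apply: contra ne => pr; apply/existsP; exists p; apply/existsP; exists r.
  by rewrite Ex Ey !eqxx.
Qed.

Lemma red_component0 x : x \in vertices (trigraph_at 0) ->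
  red_component (trigraph_at 0) x = [set x].
Proof.
rewrite /trigraph_at take0 => xV; apply/setP=> y; rewrite in_set1 inE.
apply/andP/eqP => [[_ /connectP[[|z p] //= _ ->]]|->] //.
Qed.

Lemma vertices_last p0 : 0 < size s ->
  vertices (trigraph_at (size s)) = [set sw p0 (size s).-1].
Proof.
move=> s0; have := sequence_at (leqnn (size s)); rewrite drop_size /= => /cards1P[z Ez].
rewrite Ez; have hi : (size s).-1 < size s by rewrite prednK.
have := trigraph_atS p0 hi; rewrite prednK // => E.
have : sw p0 (size s).-1 \in vertices (trigraph_at (size s)).
  by rewrite E in_setU1 eqxx.
by rewrite Ez inE => /eqP->.
Qed.

Lemma nth_trigraphs i : i <= size s ->
  nth (trigraph_of_graph e) (trigraphs (trigraph_of_graph e) s) i = trigraph_at i.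
Proof.
by case: i => [|i] hi; rewrite /trigraphs /trigraph_at ?take0 //= nth_scanl.
Qed.

Lemma component_size d i x :
  all (red_components_le d) (trigraphs (trigraph_of_graph e) s) ->
  i <= size s -> x \in vertices (trigraph_at i) ->
  #|red_component (trigraph_at i) x| <= d.
Proof.
move=> /(all_nthP (trigraph_of_graph e)) h hi xV.
have := h i; rewrite nth_trigraphs // /trigraphs /= size_scanl ltnS.
by move=> /(_ hi)/forallP/(_ x)/implyP; apply.
Qed.

Lemma colorableP q : colorable q e <->
  exists2 f, (forall x, f x < 2 ^ q) &
    realizable e q (part_at (size s)) (vertices (trigraph_at (size s))) f.
Proof.
have inv := trigraph_inv_at (leqnn (size s)).
split=> [/existsP[c /forallP hc]|[f _ [c [c1 _]]]].
  exists (fun x => bitmask q (fun t => [exists p in part_at (size s) x, c p == t :> nat])).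
    by move=> x; apply: bitmask_lt.
  exists c; split=> [x y _ _ p r _ _ pr|x _ t tq].
    by have /forallP/(_ r)/implyP := hc p; apply.
  by rewrite bit_bitmask tq.
apply/existsP; exists c; apply/forallP=> p; apply/forallP=> r; apply/implyP=> pr.
have [x xV px] := part_cover inv p; have [y yV ry] := part_cover inv r.
exact: (c1 x y xV yV p r px ry pr).
Qed.

(* An edge of the input graph is between the two contracted vertices when its
   ends first fall in the same part. *)
Lemma edgelessP p0 :
  [forall x, forall y, ~~ e x y] <->
  forall i, i < size s -> ~~ edge (trigraph_at i) (su p0 i) (sv p0 i).
Proof.
split=> [/forallP h i _|h].
  suff: forall x y, ~~ edge (trigraph_at i) x y by apply.
  rewrite /trigraph_at; elim/last_ind: (take i s) => [|s' p IH] x y.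
    rewrite /edge /= orbF; apply/existsP => -[a /existsP[b /and3P[_ _ ab]]].
    by have /forallP/(_ b) := h a; rewrite ab.
  by rewrite -cats1 foldl_cat; apply: edgeless_contract.
(* No edge lies inside a part: a pair that first meets in the part of [w] comes from [u] and [v],
   which are not adjacent. The last part contains every input vertex. *)
suff H i : i <= size s -> forall x p r, x \in vertices (trigraph_at i) ->
    p \in part_at i x -> r \in part_at i x -> ~~ e p r.
  apply/forallP=> p; apply/forallP=> r.
  have inv := trigraph_inv_at (leqnn (size s)).
  have [x xV px] := part_cover inv p; have [y yV ry] := part_cover inv r.
  have := sequence_at (leqnn (size s)); rewrite drop_size /= => /cards1P[z Ez].
  move: xV yV px ry; rewrite Ez !inE => /eqP-> /eqP->; apply: H => //.
  by rewrite Ez inE.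
elim: i => [|i IH] hi x p r.
  rewrite /trigraph_at /part_at take0 /= => _; rewrite !inE => /eqP E1 /eqP E2.
  by rewrite (@lshift_inj n n p r) ?ei // E1 E2.
have [uV vV uv wV] := step_at p0 hi.
have inv := trigraph_inv_at (ltnW hi).
rewrite (trigraph_atS p0 hi) (part_atS p0 hi).
move=> /verticesP[->|xr]; last first.
  rewrite /part_step (rest_neq wV xr); apply: IH => //; first exact: ltnW.
  by move: xr; rewrite inE => /andP[].
have ne := non_edges inv uV vV uv (h i hi).
rewrite /part_step eqxx !inE => /orP[pu|pv] /orP[ru|rv].
- exact: (IH (ltnW hi) _ _ _ uV).
- exact: ne.
- by rewrite es; apply: ne.
- exact: (IH (ltnW hi) _ _ _ vV).
Qed.

(** * Addresses in the encoded input *)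

Section Encode.
Variable q : nat.
Let inp := nth 0 (encode q e s).
Let mats := flatten [seq adjacency_matrix H | H <- trigraphs (trigraph_of_graph e) s].
Let trips := flatten [seq [:: val p.1.1; val p.1.2; val p.2] | p <- s].

Definition adj i (x y : name n) : nat :=
  if black (trigraph_at i) x y then 1 else if red (trigraph_at i) x y then 2 else 0.

Let size_trips : size trips = size s * 3.
Proof. by rewrite (@size_flatten_const _ 3) ?size_map // all_map; apply/allP. Qed.

Lemma size_adjacency_matrix (H : trigraph (name n)) :
  size (adjacency_matrix H) = (n + n) * (n + n).
Proof. by rewrite /adjacency_matrix size_allpairs -cardE card_ord. Qed.

Lemma all_size_adjacency (l : seq (trigraph (name n))) :
  all (fun m => size m == (n + n) * (n + n)) [seq adjacency_matrix H | H <- l].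
Proof. by elim: l => //= H l ->; rewrite size_adjacency_matrix eqxx. Qed.

Lemma encode_triple p0 i : i < size s ->
  [/\ inp (2 + i * 3) = su p0 i, inp (2 + i * 3).+1 = sv p0 i
    & inp (2 + i * 3).+2 = sw p0 i].
Proof.
move=> hi.
have hk k : k < 3 -> inp (2 + (i * 3 + k)) =
    nth 0 [:: val (su p0 i); val (sv p0 i); val (sw p0 i)] k.
  move=> k3; rewrite /inp /encode -[_ ++ _]/([:: q, n & trips ++ mats]) /=.
  rewrite nth_cat size_trips (_ : i * 3 + k < _); last by lia.
  rewrite nth_flatten_const ?size_map //; last by rewrite all_map; apply/allP.
  by rewrite (nth_map p0).
have := hk 0 isT; have := hk 1 isT; have := hk 2 isT.
by rewrite addn0 addn1 addn2 !addnS.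
Qed.

Lemma encode_adj i (x y : name n) : i <= size s ->
  inp (2 + (size s * 3 + i * ((n + n) * (n + n)) + x * (n + n) + y)) = adj i x y.
Proof.
move=> hi; rewrite /inp /encode -[_ ++ _]/([:: q, n & trips ++ mats]) /=.
rewrite add0n nth_cat size_trips ltnNge -!addnA leq_addr /= addKn addnA.
have [xl yl] := (ltn_ord x, ltn_ord y).
rewrite -addnA /mats nth_flatten_const; first last.
- by nia.
- by rewrite size_map /= size_scanl ltnS.
- exact: all_size_adjacency.
rewrite (nth_map (trigraph_of_graph e)); last by rewrite /= size_scanl ltnS.
rewrite nth_trigraphs // /adjacency_matrix nth_flatten_const; first last.
- exact: yl.
- by rewrite size_map -cardE card_ord.
- by apply/allP=> m /mapP[z _ ->]; rewrite size_map -cardE card_ord.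
rewrite (nth_map x) -?cardE ?card_ord // (nth_map x) -?cardE ?card_ord //.
by rewrite !nth_ord_enum.
Qed.

Lemma size_encode : size (encode q e s) = 2 + (size s * 3 + n * ((n + n) * (n + n))).
Proof.
rewrite /encode -[_ ++ _]/([:: q, n & trips ++ mats]) /= size_cat size_trips.
rewrite /mats (@size_flatten_const _ ((n + n) * (n + n))); last first.
  exact: all_size_adjacency.
by rewrite size_map /= size_scanl size_sequence.
Qed.

End Encode.
End Sequence.

(** * The program *)

Declare Scope prog_scope.
Delimit Scope prog_scope with prog.
Notation "$ v" := (HVar v) (at level 1, format "$ v") : prog_scope.
Notation "# k" := (HLit k) (at level 1, format "# k") : prog_scope.
Notation "k ![ i ]" := (HArr k i) (at level 2, left associativity, format "k ![ i ]") : prog_scope.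
Notation "a + b" := (HAdd a b) : prog_scope.
Notation "a - b" := (HSub a b) : prog_scope.
Notation "v ::= e" := (HSet v e) (at level 70, e at level 60) : prog_scope.
Notation "'put' k ; i ::= e" := (HPut k i e)
  (at level 70, k at level 9, i at level 60, e at level 60) : prog_scope.
Notation "c1 ;; c2" := (HSeq c1 c2) (at level 80, right associativity) : prog_scope.
Notation "'for' v < e 'do' c 'od'" := (HFor v e c)
  (at level 70, v at level 9, e at level 60, c at level 90) : prog_scope.
Notation "'when' e 'then' c1 'else' c2 'fi'" := (HIf e c1 c2)
  (at level 70, e at level 60, c1 at level 90, c2 at level 90) : prog_scope.

Notation rAns := 0 (only parsing).
Notation rQ := 1 (only parsing).
Notation rN := 2 (only parsing).
Notation rN2 := 3 (only parsing).
Notation rM := 4 (only parsing).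
Notation rP2 := 5 (only parsing).
Notation rK := 6 (only parsing).
Notation rWt := 7 (only parsing).
Notation rMp := 8 (only parsing).
Notation rX := 10 (only parsing).
Notation rMB := 11 (only parsing).
Notation rSP := 12 (only parsing).
Notation rI := 13 (only parsing).
Notation rA := 14 (only parsing).
Notation rY := 15 (only parsing).
Notation rRow := 16 (only parsing).
Notation rHf := 17 (only parsing).
Notation rVal := 18 (only parsing).
Notation rC := 19 (only parsing).
Notation rU := 20 (only parsing).
Notation rV := 21 (only parsing).
Notation rW := 22 (only parsing).
Notation rRo := 23 (only parsing).
Notation rG := 24 (only parsing).
Notation rBase := 25 (only parsing).
Notation rLen := 26 (only parsing).
Notation rB := 27 (only parsing).
Notation rLa := 28 (only parsing).
Notation rLb := 29 (only parsing).
Notation rT := 30 (only parsing).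
Notation rNP := 31 (only parsing).
Notation rNQ := 32 (only parsing).
Notation rOk := 33 (only parsing).
Notation rCd := 34 (only parsing).
Notation rCe := 35 (only parsing).
Notation rCy := 36 (only parsing).
Notation rJ := 37 (only parsing).
Notation rS := 38 (only parsing).
Notation rZ := 39 (only parsing).
Notation rPu := 40 (only parsing).
Notation rPv := 41 (only parsing).
Notation rIt := 42 (only parsing).
Notation rL := 43 (only parsing).
Notation rD := 44 (only parsing).
Notation rStep := 45 (only parsing).
Notation rR := 46 (only parsing).
Notation rE := 47 (only parsing).

(* [aRow x] is [x] times the row length [2 n], and [aMB i] the address of the i-th
   adjacency matrix; the i-th contraction is of [aU i] and [aV i] to [aW i].  [aPw],
   [aHalf], [aPc] and [aSw] tabulate powers of 2, halves, cardinals and adjacent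
   transpositions.  [aMul (aMP x + X)] is [X] times the weight of the vertex [x], and
   [aTab] the table of realizable functions.  The i-th record consists of the
   [aLen i] entries from [aRow i] on of [aP], the vertices merged at step [i], and of
   [aLB], which labels their components; [aRB x] and [aRG x] are the record and the
   label of the component of [x].  [aX] is the assignment searched, [aAcc] the codes
   of its restrictions, and [aPu], [aPv] list the pairs [(U, W)]. *)
Notation aRow := 0 (only parsing).
Notation aMB := 1 (only parsing).
Notation aU := 2 (only parsing).
Notation aV := 3 (only parsing).
Notation aW := 4 (only parsing).
Notation aPw := 5 (only parsing).
Notation aHalf := 6 (only parsing).
Notation aPc := 7 (only parsing).
Notation aSw := 8 (only parsing).
Notation aPos := 9 (only parsing).
Notation aMul := 10 (only parsing).
Notation aMP := 11 (only parsing).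
Notation aTab := 12 (only parsing).
Notation aP := 13 (only parsing).
Notation aLB := 14 (only parsing).
Notation aLen := 15 (only parsing).
Notation aRB := 16 (only parsing).
Notation aRG := 17 (only parsing).
Notation aX := 18 (only parsing).
Notation aAcc := 19 (only parsing).
Notation aPu := 20 (only parsing).
Notation aPv := 21 (only parsing).

Section Program.
Local Open Scope prog_scope.

(** Truncated subtraction one way and the other: at least one difference is nonzero exactly when the
    values differ. *)
Definition ne (a b : hexpr) : hexpr := (a - b) + (b - a).

Definition double_e (a : hexpr) : hexpr := a + a.

Definition setup_rows : hcom :=
  for rX < $rN2 do put aRow; $rX ::= $rM ;; rM ::= $rM + $rN2 od.

Definition setup_steps : hcom :=
  for rI < $rN - #1 do
    put aMB; $rI ::= $rMB ;; rMB ::= $rMB + $rM ;;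
    put aU; $rI ::= HInp $rSP ;;
    put aV; $rI ::= HInp ($rSP + #1) ;;
    put aW; $rI ::= HInp ($rSP + #2) ;;
    rSP ::= $rSP + #3
  od.

Definition setup : hcom :=
  rQ ::= HInp #0 ;; rN ::= HInp #1 ;; rN2 ::= $rN + $rN ;; rM ::= #0 ;;
  setup_rows ;;
  rMB ::= (($rN + $rN) + $rN) - #1 ;; rSP ::= #2 ;;
  setup_steps.

(* The entry of the current adjacency matrix, which starts at address [$rMB]. *)
Definition adj_e (x y : hexpr) : hexpr := HInp ($rMB + (aRow![x] + y)).

(** For [q = 1] the time bound is [d ^ 2 * n], and a scan of the adjacency matrix would exceed it.
    One entry per contraction is enough. *)
Definition edgeless : hcom :=
  rAns ::= #1 ;;
  for rI < $rN - #1 do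
    rMB ::= aMB![$rI] ;;
    when adj_e (aU![$rI]) (aV![$rI]) then rAns ::= #0 else HSkip fi
  od.

Definition powers_table : hcom :=
  for rA < $rQ do put aPw; $rA ::= $rP2 ;; rP2 ::= $rP2 + $rP2 od.

(** Each value fills the two entries that halve to it. The tables reach [2 ^ (q + 1)] because
    cardinals are looked up at sums of two sets. *)
Definition bits_table : hcom :=
  for rY < $rP2 do
    put aHalf; $rY + $rY ::= $rY ;;
    put aHalf; ($rY + $rY) + #1 ::= $rY ;;
    put aPc; $rY + $rY ::= aPc![$rY] ;;
    put aPc; ($rY + $rY) + #1 ::= aPc![$rY] + #1
  od.

(** A transposition at [a > 0] leaves bit 0 alone and acts on the half as the transposition at
    [a - 1], so its row is read off the previous one. *)
Definition swap_row : hcom :=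
  for rX < $rP2 do
    rHf ::= aHalf![$rX] ;;
    when $rA
    then rVal ::= double_e (aSw![($rRow - $rP2) + $rHf]) + ($rX - double_e $rHf)
    else rVal ::= (double_e (double_e (aHalf![$rHf])) + double_e ($rX - double_e $rHf))
                  + ($rHf - double_e (aHalf![$rHf])) fi ;;
    put aSw; $rRow + $rX ::= $rVal ;;
    when $rX - $rVal then put aPos; $rX ::= $rRow + #1 else HSkip fi
  od.

Definition swap_table : hcom :=
  for rA < $rQ - #1 do swap_row ;; rRow ::= $rRow + $rP2 od.

Definition tables : hcom :=
  rP2 ::= #1 ;; powers_table ;; put aPw; $rQ ::= $rP2 ;; rK ::= $rP2 - #1 ;;
  bits_table ;; rRow ::= #0 ;; swap_table.

(** Repeated addition stands in for multiplication; after [2 ^ q] rounds [$rC] is the weight of the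
    next vertex. *)
Definition multiples : hcom :=
  for rY < $rP2 do put aMul; $rMp + $rY ::= $rC ;; rC ::= $rC + $rWt od.

Definition new_vertex (x : nat) : hcom :=
  put aMP; $x ::= $rMp ;; rC ::= #0 ;;
  multiples ;;
  rWt ::= $rC ;; rMp ::= $rMp + $rP2.

(** A leaf is a single input vertex, so exactly the sets of one colour are realizable. *)
Definition singletons : hcom :=
  for rA < $rQ do put aTab; aMul![aMP![$rX] + aPw![$rA]] ::= #1 od.

Definition leaves : hcom :=
  rWt ::= #1 ;; rMp ::= #0 ;;
  for rX < $rN do new_vertex rX ;; singletons od.

Definition load_step : hcom :=
  rU ::= aU![$rStep] ;; rV ::= aV![$rStep] ;; rW ::= aW![$rStep] ;;
  rBase ::= aRow![$rStep] ;; rMB ::= aMB![$rStep].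

(** The record of the component of [w] may list vertices of other components too, hence the filter
    by label; [w] itself gives way to [u] and [v]. *)
Definition collect : hcom :=
  for rB < aLen![$rR] do
    when ne (aLB![$rRo + $rB]) $rG then HSkip else
      when ne (aP![$rRo + $rB]) $rW
      then put aP; $rBase + $rLen ::= aP![$rRo + $rB] ;; rLen ::= $rLen + #1
      else HSkip fi fi
  od.

Definition init_labels : hcom :=
  for rB < $rLen do put aLB; $rBase + $rB ::= $rB od.

Definition relabel : hcom :=
  for rC < $rLen do
    when ne (aLB![$rBase + $rC]) $rLa then HSkip
    else put aLB; $rBase + $rC ::= $rLb fi
  od.

(** A whole class is relabelled at each red pair, which is the source of the cubic term and spares a
    union-find structure. *)
Definition join_labels : hcom :=
  for rA < $rLen do
    for rB < $rLen do
      when ne (adj_e (aP![$rBase + $rA]) (aP![$rBase + $rB])) #2 then HSkip else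
        rLa ::= aLB![$rBase + $rA] ;; rLb ::= aLB![$rBase + $rB] ;; relabel
      fi
    od
  od.

Definition publish : hcom :=
  for rB < $rLen do
    put aRB; aP![$rBase + $rB] ::= $rStep ;;
    put aRG; aP![$rBase + $rB] ::= aLB![$rBase + $rB]
  od.

Definition split_step : hcom :=
  load_step ;;
  rR ::= aRB![$rW] ;; rG ::= aRG![$rW] ;; rRo ::= aRow![$rR] ;;
  put aP; $rBase ::= $rU ;; put aP; $rBase + #1 ::= $rV ;; rLen ::= #2 ;;
  collect ;;
  put aLen; $rStep ::= $rLen ;;
  init_labels ;; join_labels ;; publish.

(** The walk starts from a record of index [n - 1] for the single last vertex; its label 0 is
    supplied by fresh memory. *)
Definition backward : hcom :=
  rW ::= aW![$rN - #2] ;;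
  put aLen; $rN - #1 ::= #1 ;; put aP; aRow![$rN - #1] ::= $rW ;;
  put aRB; $rW ::= $rN - #1 ;;
  for rI < $rN - #1 do rStep ::= ($rN - #2) - $rI ;; split_step od.

Definition scale : hcom := for rX < $rK do rC ::= $rC + $rNP od.

(** With [L = $rLen - 2], these are the numbers of states of odometers with [L] and [L - 1] digits.
    Both start at 1, which is right for [L = 0] as well. *)
Definition ranges : hcom :=
  rNQ ::= #1 ;; rNP ::= #1 ;;
  for rA < $rLen - #2 do
    rNQ ::= $rNP ;; rC ::= #0 ;; scale ;; rNP ::= $rC
  od.

Definition check_black : hcom :=
  for rA < $rLen do
    for rB < $rLen do
      when ne (adj_e (aP![$rBase + $rA]) (aP![$rBase + $rB])) #1 then HSkip else
        when (aPc![aX![$rA]] + aPc![aX![$rB]]) - aPc![aX![$rA] + aX![$rB]]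
        then rOk ::= #0 else HSkip fi
      fi
    od
  od.

Definition clear_codes : hcom := for rA < $rLen do put aAcc; $rA ::= #0 od.

Definition sum_codes : hcom :=
  for rA < $rLen do
    rL ::= aLB![$rBase + $rA] ;;
    put aAcc; $rL ::= aAcc![$rL] + aMul![aMP![aP![$rBase + $rA]] + aX![$rA]]
  od.

Definition check_codes : hcom :=
  for rA < $rLen do
    when aTab![aAcc![aLB![$rBase + $rA]]] then HSkip else rOk ::= #0 fi
  od.

Definition check_leaf : hcom :=
  rOk ::= #1 ;; check_black ;; clear_codes ;; sum_codes ;; check_codes.

(** Positions 0 and 1 of [aX] hold [U] and [W]; the odometer starts at position 2. *)
Definition reset (bound : hexpr) : hcom :=
  for rA < bound do put aX; $rA + #2 ::= #1 od.

Definition tick (bound : hexpr) : hcom :=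
  rCy ::= #1 ;;
  for rA < bound do
    when $rCy then
      when $rK - aX![$rA + #2]
      then put aX; $rA + #2 ::= aX![$rA + #2] + #1 ;; rCy ::= #0
      else put aX; $rA + #2 ::= #1 fi
    else HSkip fi
  od.

Definition rest_code : hcom :=
  rCd ::= aMul![aMP![$rW] + $rS] ;;
  for rA < $rLen - #2 do
    rCd ::= $rCd + aMul![aMP![aP![$rBase + ($rA + #2)]] + aX![$rA + #2]]
  od.

Definition mark_leaf : hcom :=
  check_leaf ;;
  when $rOk then rest_code ;; put aTab; $rCd ::= #1 else HSkip fi ;;
  tick ($rLen - #3).

Definition mark_range : hcom :=
  reset ($rLen - #3) ;;
  for rIt < $rNQ do mark_leaf od.

(** Every part is nonempty, so a family with an empty set is not realizable and is skipped; tables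
    are characterised at nonempty sets only. *)
Definition mark_nonempty : hcom :=
  when aX![#0] then
    when aX![#1] then
      when aX![$rLen - #1] then mark_range else HSkip fi
    else HSkip fi
  else HSkip fi.

Definition mark_pairs : hcom :=
  for rT < $rZ do
    put aX; #0 ::= aPu![$rT] ;; put aX; #1 ::= aPv![$rT] ;;
    when $rLen - #2 then put aX; $rLen - #1 ::= $rVal else HSkip fi ;;
    mark_nonempty
  od.

(** The new colour goes to [U], to [W] or to both: three extensions of each listed pair, made in
    constant time. *)
Definition all_pairs : hcom :=
  for rT < $rZ do
    rPu ::= aPu![$rT] ;; rPv ::= aPv![$rT] ;;
    put aPu; $rT ::= $rPu + aPw![$rD] ;;
    put aPu; $rT + $rZ ::= $rPu ;;
    put aPv; $rT + $rZ ::= $rPv + aPw![$rD] ;;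
    put aPu; ($rT + $rZ) + $rZ ::= $rPu + aPw![$rD] ;;
    put aPv; ($rT + $rZ) + $rZ ::= $rPv + aPw![$rD]
  od ;;
  rZ ::= ($rZ + $rZ) + $rZ.

Definition canonical_pairs : hcom :=
  rZ ::= #0 ;;
  for rI < $rD + #2 do
    for rJ < $rI + #1 do
      put aPu; $rZ ::= aPw![$rI] - #1 ;;
      put aPv; $rZ ::= (aPw![$rJ] - #1) + (aPw![$rD + #1] - aPw![$rI]) ;;
      rZ ::= $rZ + #1
    od
  od.

(** With [k = $rD], the loops run through the last sets [two_blocks a k.+1 l] for
    [a <= k + 1 <= l <= q]. If [w] is alone in its component they repeat the same work, at a cost
    polynomial in [q]. *)
Definition mark_last : hcom :=
  for rI < $rD + #2 do
    for rJ < $rQ - $rD do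
      rVal ::= (aPw![$rI] - #1) + (aPw![($rD + #1) + $rJ] - aPw![$rD + #1]) ;;
      mark_pairs
    od
  od.

Definition mark : hcom :=
  rZ ::= #1 ;; put aPu; #0 ::= #0 ;; put aPv; #0 ::= #0 ;;
  for rD < $rQ do
    rS ::= aPw![$rD + #1] - #1 ;;
    when $rLen - #2 then all_pairs else canonical_pairs fi ;;
    mark_last
  od.

Definition copy : hcom :=
  rRo ::= $rRow - #1 ;;
  rCd ::= aMul![aMP![$rW] + $rS] ;; rCe ::= aMul![aMP![$rW] + aSw![$rRo + $rS]] ;;
  for rA < $rLen - #2 do
    rCd ::= $rCd + aMul![aMP![aP![$rBase + ($rA + #2)]] + aX![$rA + #2]] ;;
    rCe ::= $rCe + aMul![aMP![aP![$rBase + ($rA + #2)]] + aSw![$rRo + aX![$rA + #2]]]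
  od ;;
  put aTab; $rCd ::= aTab![$rCe].

(** [$rRow] holds an offset plus one, so that 0 can mean that the last set is minimal already. *)
Definition find_row : hcom :=
  rRow ::= #0 ;; rE ::= #0 ;;
  for rA < $rQ - #1 do
    when ne (aSw![$rE + $rS]) $rS then HSkip else
      when aX![$rLen - #1] - aSw![$rE + aX![$rLen - #1]]
      then rRow ::= $rE + #1 else HSkip fi
    fi ;;
    rE ::= $rE + $rP2
  od.

Definition fill_initial_range : hcom :=
  for rIt < $rNP do
    find_row ;; when $rRow then copy else HSkip fi ;; tick ($rLen - #2)
  od.

Definition fill_initial : hcom :=
  for rD < $rQ do
    rS ::= aPw![$rD + #1] - #1 ;; reset ($rLen - #2) ;; fill_initial_range
  od.

Definition fill_range : hcom :=
  for rIt < $rNP do copy ;; tick ($rLen - #2) od.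

Definition fill : hcom :=
  for rS < $rP2 do
    when aPos![$rS] then
      rRow ::= aPos![$rS] ;; reset ($rLen - #2) ;; fill_range
    else HSkip fi
  od.

Definition contract_step : hcom :=
  load_step ;; rLen ::= aLen![$rStep] ;;
  new_vertex rW ;; ranges ;; mark ;;
  when $rLen - #2 then fill_initial else HSkip fi ;;
  fill.

Definition forward : hcom := for rStep < $rN - #1 do contract_step od.

Definition answer : hcom :=
  rW ::= aW![$rN - #2] ;; rAns ::= #0 ;;
  for rS < $rK do
    when aTab![aMul![aMP![$rW] + ($rS + #1)]] then rAns ::= #1 else HSkip fi
  od.

Definition coloring : hcom :=
  setup ;;
  when $rN - $rQ then
    when $rQ - #1 then tables ;; leaves ;; backward ;; forward ;; answer
    else edgeless fi
  else rAns ::= #1 fi.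

Lemma wf_coloring : wf coloring.
Proof. by vm_compute. Qed.

End Program.

(** * Correctness *)

Arguments run : simpl never.
Arguments wp : simpl never.
Arguments upd : simpl never.
Arguments name : simpl never.

Ltac wstep :=
  match goal with
  | |- wp _ _ (HSeq _ _) _ _ => apply: wp_seq
  | |- wp _ _ (HSet _ _) _ _ => apply: wp_set
  | |- wp _ _ (HPut _ _ _) _ _ => apply: wp_put
  | |- wp _ _ HSkip _ _ => apply: wp_skip
  end; rewrite /=.

Ltac wsteps := repeat wstep.

Tactic Notation "wcall" open_constr(L) := wsteps; eapply wp_call; [eapply L|]; rewrite /=.

Ltac wif := match goal with |- wp _ _ (HIf _ _ _) _ _ => apply: wp_if end; rewrite /=.

Lemma updE f i x j : upd f i x j = if j == i then x else f j.
Proof. by []. Qed.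

Lemma upd_same f i x : upd f i x i = x.
Proof. by rewrite /upd eqxx. Qed.

Lemma upd_other f i x j : j <> i -> upd f i x j = f j.
Proof. by rewrite /upd => /eqP/negbTE->. Qed.

Lemma dist_eq0 a b : a - b + (b - a) = 0 -> a = b. Proof. by lia. Qed.

Lemma dist_neq0 a b : a - b + (b - a) != 0 -> a <> b. Proof. by lia. Qed.

Definition empty_store : store := HStore (fun=> 0) (fun _ _ => 0).

(** * Reading the input, and the case of one colour *)

Section Setup.
Variables (q n : nat) (e : rel 'I_n) (s : seq (name n * name n * name n))
  (x0 : name n) (m E : nat).
Hypotheses (es : symmetric e) (ei : irreflexive e)
  (hs : contraction_sequence (trigraph_of_graph e) s)
  (hm : size s = m) (hE : 2 + (m * 3 + n * ((n + n) * (n + n))) <= E).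

Let p0 := (x0, x0, x0).
Let inp := nth 0 (encode q e s).
Let n0 : n = m.+1. Proof. by rewrite -hm (size_sequence hs). Qed.

Let nm1 : n - 1 = m. Proof. by rewrite n0 subn1. Qed.

Record is_setup (h : store) : Prop := IsSetup {
  setup_q : var h rQ = q;
  setup_n : var h rN = n;
  setup_row : forall x, x < n + n -> arr h aRow x = x * (n + n);
  setup_mb : forall i, i < m ->
    arr h aMB i = 2 + (m * 3 + i * ((n + n) * (n + n)));
  setup_u : forall i, i < m -> arr h aU i = su s p0 i;
  setup_v : forall i, i < m -> arr h aV i = sv s p0 i;
  setup_w : forall i, i < m -> arr h aW i = sw s p0 i }.

Lemma raw_inp h a : a < 2 + (m * 3 + n * ((n + n) * (n + n))) ->
  raw inp E h a = inp a.
Proof. by move=> ha; rewrite /raw (leq_trans ha hE). Qed.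

Lemma raw_head h a : a < 2 + m * 3 -> raw inp E h a = inp a.
Proof. by move=> ha; apply/raw_inp/(leq_trans ha); rewrite leq_add2l leq_addr. Qed.

Lemma setup_rows_spec h : var h rN2 = n + n -> var h rM = 0 ->
  wp inp E setup_rows h (fun h1 t =>
    [/\ forall x, x < n + n -> arr h1 aRow x = x * (n + n),
        var h1 rM = (n + n) * (n + n) & t <= (n + n) * 4 + 1]).
Proof.
move=> hN hM.
apply: (wp_for (B := 2) (I := fun i h1 =>
  (forall x, x < i -> arr h1 aRow x = x * (n + n)) /\ var h1 rM = i * (n + n))).
- by rewrite hM.
- move=> i g /= hi [h1 h2]; wsteps; rewrite h2 hN.
  split; last by [].
  split; last by lia.
  move=> x xi; rewrite updE; case: eqP => [->//|ne]; apply: h1; lia.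
- by move=> g t /=; rewrite hN => -[h1 h2] ht; split=> //; lia.
Qed.

Lemma setup_steps_spec h :
  var h rN = n -> var h rM = (n + n) * (n + n) -> var h rMB = 2 + m * 3 ->
  var h rSP = 2 ->
  wp inp E setup_steps h (fun h1 t =>
    [/\ forall i, i < m ->
          arr h1 aMB i = 2 + (m * 3 + i * ((n + n) * (n + n))),
        forall i, i < m -> arr h1 aU i = su s p0 i,
        forall i, i < m -> arr h1 aV i = sv s p0 i,
        forall i, i < m -> arr h1 aW i = sw s p0 i
      & t <= n * 10 + 1]).
Proof.
move=> hN hM hMB hSP.
apply: (wp_for (B := 6) (I := fun k h1 =>
  [/\ forall i, i < k ->
        arr h1 aMB i = 2 + (m * 3 + i * ((n + n) * (n + n))),
        forall i, i < k -> arr h1 aU i = su s p0 i,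
        forall i, i < k -> arr h1 aV i = sv s p0 i,
        forall i, i < k -> arr h1 aW i = sw s p0 i
      & var h1 rMB = 2 + (m * 3 + k * ((n + n) * (n + n))) /\ var h1 rSP = 2 + k * 3])).
- by rewrite hMB hSP !mul0n !addn0; split.
- move=> i g /= hi [h1 h2 h3 h4 [h5 h6]]; wsteps; rewrite h5 h6 hM.
  rewrite hN nm1 in hi.
  have hi' : i < size s by rewrite hm.
  have [t1 t2 t3] := encode_triple hs q p0 hi'.
  have b2 : 2 + i * 3 + 2 < 2 + m * 3 by lia.
  have b1 : 2 + i * 3 + 1 < 2 + m * 3 by lia.
  have b0 : 2 + i * 3 < 2 + m * 3 by lia.
  rewrite !raw_head //.
  rewrite addn1 addn2 -/inp in t1 t2 t3 *; rewrite t1 t2 t3.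
  split; last by [].
  split; last by split; lia.
  + by move=> x xi; rewrite updE; case: eqP => [->//|ne]; apply: h1; lia.
  + by move=> x xi; rewrite updE; case: eqP => [->//|ne]; apply: h2; lia.
  + by move=> x xi; rewrite updE; case: eqP => [->//|ne]; apply: h3; lia.
  + by move=> x xi; rewrite updE; case: eqP => [->//|ne]; apply: h4; lia.
- move=> g t /=; rewrite hN nm1 => -[h1 h2 h3 h4 _] ht.
  by split=> //; lia.
Qed.

Lemma setup_spec h : wp inp E setup h (fun h1 t => is_setup h1 /\ t <= n * 20 + 20).
Proof.
rewrite /setup; wsteps.
have raw0 h' : raw inp E h' 0 = q by rewrite raw_head.
have raw1 h' : raw inp E h' 1 = n by rewrite raw_head.
apply: (wp_call (setup_rows_spec _ _)) => //=; first by rewrite raw1.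
move=> g t [g1 g2 g3]; wsteps.
apply: (wp_call (setup_steps_spec _ _ _ _)) => //=.
  by rewrite raw1 {1 2 3}n0; lia.
move=> g' t' [k1 k2 k3 k4 k5]; split; last by lia.
by split=> //=; rewrite ?raw0 ?raw1.
Qed.

Lemma raw_adj h i (x y : name n) : i < m ->
  raw inp E h (2 + (m * 3 + i * ((n + n) * (n + n))) + (x * (n + n) + y)) = adj e s i x y.
Proof.
move=> hi; have [xl yl] := (ltn_ord x, ltn_ord y).
rewrite raw_inp; last by nia.
have hi' : i <= size s by rewrite hm ltnW.
by rewrite -(encode_adj hs q _ _ hi') hm; congr (nth 0 _ _); lia.
Qed.

Lemma edgeless_spec h : is_setup h ->
  wp inp E edgeless h (fun h1 t =>
    var h1 rAns = [forall x, forall y, ~~ e x y] :> nat /\ t <= n * 10 + 10).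
Proof.
move=> hh; rewrite /edgeless; wsteps.
apply: (wp_for (B := 5) (I := fun k h1 => var h1 rAns =
   [forall i : 'I_(m), (i < k) ==>
      ~~ edge (trigraph_at e s i) (su s p0 i) (sv s p0 i)] :> nat)) => /=.
- by rewrite (_ : [forall i, _] = true) //; apply/forallP.
- move=> i g hi hI; rewrite (setup_n hh) nm1 in hi.
  wsteps.
  have step (b : bool) : ~~ edge (trigraph_at e s i) (su s p0 i) (sv s p0 i) = b ->
     [forall j : 'I_(m), (j < i.+1) ==>
        ~~ edge (trigraph_at e s j) (su s p0 j) (sv s p0 j)] =
     [forall j : 'I_(m), (j < i) ==>
        ~~ edge (trigraph_at e s j) (su s p0 j) (sv s p0 j)] && b.
    move=> Eb; apply/forallP/andP => [H|[/forallP H hb] j].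
      split; last by rewrite -Eb; have := H (Ordinal hi); rewrite /= ltnSn.
      by apply/forallP=> j; apply/implyP=> ji; have := H j; rewrite (leq_trans ji).
    rewrite ltnS leq_eqVlt; apply/implyP=> /orP[/eqP->|ji]; first by rewrite Eb.
    by have := H j; rewrite ji.
  wif; rewrite (setup_u hh hi) (setup_v hh hi) (setup_mb hh hi)
      (setup_row hh (ltn_ord _)) raw_adj // /adj => Ee.
  + wsteps; split=> //; rewrite (step false) ?andbF //.
    by rewrite /edge; move: Ee; case: (black _ _ _) => //; case: (red _ _ _).
  + wsteps; split=> //; rewrite (step true) ?andbT //.
    by rewrite /edge; move: Ee; case: (black _ _ _) => //; case: (red _ _ _).
- rewrite (setup_n hh) => g t /= ->; rewrite nm1 => ht.
  split; last by lia.
  congr (nat_of_bool _); apply/forallP/idP.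
    move=> H; apply/(edgelessP es ei hs p0); rewrite hm => i hi.
    by have := H (Ordinal hi); rewrite /= hi.
  by move/(edgelessP es ei hs p0); rewrite hm => H i; apply/implyP=> _; apply: H.
Qed.

End Setup.

(** * Tables of colour sets and of weights *)

Section Tables.
Variables (q : nat) (inp : nat -> nat) (E : nat).

(* [aPos] holds 0 at the numbers that no swap lowers, and elsewhere the successor
   of the offset of a lowering row of [aSw]. *)
Definition pos_ok (b : nat) (pos : nat -> nat) (X : nat) : Prop :=
  (pos X = 0 /\ forall a, a < b -> X <= swap a X) \/
  (exists2 a, a < b & pos X = (a * 2 ^ q).+1 /\ swap a X < X).

Record is_tables (h : store) : Prop := IsTables {
  tables_p2 : var h rP2 = 2 ^ q;
  tables_k : var h rK = 2 ^ q - 1;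
  tables_pw : forall a, a <= q -> arr h aPw a = 2 ^ a;
  tables_pc : forall X, X < (2 ^ q).*2 -> arr h aPc X = popcount X;
  tables_sw : forall a X, a.+1 < q -> X < 2 ^ q -> arr h aSw (a * 2 ^ q + X) = swap a X;
  tables_pos : forall X, X < 2 ^ q -> pos_ok q.-1 (arr h aPos) X }.

Lemma powers_table_spec h : var h rQ = q -> var h rP2 = 1 ->
  wp inp E powers_table h (fun h1 t => [/\ var h1 rP2 = 2 ^ q,
    forall a, a < q -> arr h1 aPw a = 2 ^ a & t <= q * 3 + 1]).
Proof.
move=> hq hp.
apply: (wp_for (B := 2) (I := fun i h1 => var h1 rP2 = 2 ^ i /\
    forall a, a < i -> arr h1 aPw a = 2 ^ a)) => //.
- move=> i g /= hi [h1 h2]; wsteps; rewrite h1; split=> //; split.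
    by rewrite expnS; lia.
  by move=> a ai; rewrite updE; case: eqP => [->//|ne]; apply: h2; lia.
- by move=> g t /=; rewrite hq => -[h1 h2] ht; split=> //; lia.
Qed.

Lemma bits_table_spec h : var h rP2 = 2 ^ q -> arr h aPc 0 = 0 ->
  wp inp E bits_table h (fun h1 t =>
    [/\ forall X, X < (2 ^ q).*2 -> arr h1 aHalf X = X./2,
        forall X, X < (2 ^ q).*2 -> arr h1 aPc X = popcount X
      & t <= 2 ^ q * 5 + 1]).
Proof.
move=> hp hc.
apply: (wp_for (B := 4) (I := fun y h1 => [/\ arr h1 aPc 0 = 0,
   forall X, X < y.*2 -> arr h1 aHalf X = X./2 &
   forall X, X < y.*2 -> arr h1 aPc X = popcount X])) => //.
- move=> y g /= hy [h0 h1 h2]; wsteps; split=> //.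
  have ey : arr g aPc y = popcount y.
    by case: (posnP y) => [->|y0]; [rewrite h0|apply: h2; lia].
  have p0 : popcount (y + y) = popcount y.
    by rewrite popcount_half addnn odd_double doubleK.
  have p1 : popcount (y + y + 1) = popcount y + 1.
    by rewrite popcount_half addn1 addnn /= odd_double uphalf_double addnC.
  split.
  + rewrite !updE; case: eqP; first by lia.
    by case: eqP => // E0; rewrite (_ : y = 0) ?h0 //; lia.
  + move=> X hX; rewrite !updE; case: eqP => [->|n1]; first by lia.
    by case: eqP => [->|n2]; [lia|apply: h1; lia].
  + move=> X hX; rewrite !updE; case: eqP => [->|n1].
      by rewrite p1; case: eqP => [e|_]; [lia|rewrite ey].
    by case: eqP => [->|n2]; [rewrite p0|apply: h2; lia].
- by move=> g t /=; rewrite hp => -[_ h1 h2] ht; split=> //; lia.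
Qed.

Lemma swap_row_spec a h : a.+1 < q ->
  var h rA = a -> var h rP2 = 2 ^ q -> var h rRow = a * 2 ^ q ->
  (forall X, X < 2 ^ q -> arr h aHalf X = X./2) ->
  (forall b X, b < a -> X < 2 ^ q -> arr h aSw (b * 2 ^ q + X) = swap b X) ->
  (forall X, X < 2 ^ q -> pos_ok a (arr h aPos) X) ->
  wp inp E swap_row h (fun h1 t =>
    [/\ forall b X, b < a.+1 -> X < 2 ^ q -> arr h1 aSw (b * 2 ^ q + X) = swap b X,
        forall X, X < 2 ^ q -> pos_ok a.+1 (arr h1 aPos) X
      & t <= 2 ^ q * 10 + 1]).
Proof.
move=> aq ha hp hr hh hs hpos.
apply: (wp_for (B := 7) (I := fun Y h1 => [/\
   forall b X, b < a -> X < 2 ^ q -> arr h1 aSw (b * 2 ^ q + X) = swap b X,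
   forall X, X < Y -> arr h1 aSw (a * 2 ^ q + X) = swap a X &
   forall X, X < 2 ^ q -> pos_ok (if X < Y then a.+1 else a) (arr h1 aPos) X])) => //.
- move=> Y g /=; rewrite hp => hY [h1 h2 h3]; wsteps.
  have hhY : arr h aHalf Y = Y./2 by apply: hh.
  have Y2 : Y./2 < 2 ^ q by lia.
  (* The common end of both branches, with [val] the value that either of them computes. *)
  have tail : forall val tt, val = swap a Y -> tt <= 2 ->
    wp inp E (put 8; $16 + $10 ::= $18;;
       when $10 - $18 then put 9; $10 ::= $16 + #1 else HSkip fi)%prog
    (setv (setv (setv (overlay (10 :: assigned
         (17 ::= 6![$10];;
          when $14 then 18 ::= double_e (8![$16 - $5 + $17]) + ($10 - double_e $17)
          else 18 ::= double_e (double_e (6![$17])) + double_e ($10 - double_e $17) +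
                        ($17 - double_e (6![$17])) fi;;
          put 8; $16 + $10 ::= $18;;
          when $10 - $18 then put 9; $10 ::= $16 + #1 else HSkip fi)%prog)
       [:: 8; 9] h g) 10 Y) 17 Y./2) 18 val)
     (fun h0 t => [/\ forall b X, b < a -> X < 2 ^ q -> arr h0 8 (b * 2 ^ q + X) = swap b X,
     forall X, X < Y.+1 -> arr h0 8 (a * 2 ^ q + X) = swap a X
   & forall X, X < 2 ^ q -> pos_ok (if X < Y.+1 then a.+1 else a) (arr h0 9) X] /\
  1 + (tt + t) <= 7).
    move=> val tt -> htt; wsteps; rewrite hr.
    have sw0 b X : b < a -> X < 2 ^ q ->
      upd (arr g 8) (a * 2 ^ q + Y) (swap a Y) (b * 2 ^ q + X) = swap b X.
      move=> ba Xq; rewrite updE; case: eqP => [|_]; last exact: h1.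
      by have : b.+1 * 2 ^ q <= a * 2 ^ q by [rewrite leq_mul2r ba orbT]; rewrite mulSn; lia.
    have sw1 X : X < Y.+1 -> upd (arr g 8) (a * 2 ^ q + Y) (swap a Y) (a * 2 ^ q + X) = swap a X.
      move=> XY; rewrite updE; case: eqP => [e|ne]; last by apply: h2; lia.
      by rewrite (_ : X = Y) //; lia.
    wif => lt; wsteps; (split; last by lia); (split=> // X Xq).
      rewrite /pos_ok !updE; case: eqP => [->|ne].
        by rewrite ltnSn; right; exists a => //; split; [rewrite hr addn1|lia].
      by have := h3 X Xq; rewrite (_ : (X < Y.+1) = (X < Y)) //; lia.
    case: (eqVneq X Y) => [->|ne]; last first.
      by have := h3 X Xq; rewrite (_ : (X < Y.+1) = (X < Y)) //; lia.
    rewrite ltnSn; have := h3 Y hY; rewrite ltnn => -[[e1 e2]|[b ba e1]].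
      left; split=> // b; rewrite ltnS leq_eqVlt => /orP[/eqP->|/e2//].
      by move/eqP: lt; lia.
    by right; exists b => //; apply: ltnW.
  wif; rewrite ha => ea; wsteps; rewrite ?hhY; apply: tail => //; rewrite ?ha ?hr ?hp ?hhY.
    have -> : a * 2 ^ q - 2 ^ q = a.-1 * 2 ^ q.
      by case: (a) => // b; rewrite mulSn addKn.
    have -> : swap a Y = (swap a.-1 Y./2).*2 + odd Y by case: (a) ea.
    rewrite h1 //; last by move: ea; clear; lia.
    by have := odd_double_half Y; lia.
  by rewrite ea hh //= ; case E1: (odd Y); case E2: (odd Y./2) => /=; lia.
- move=> g t /=; rewrite hp => -[h1 h2 h3] ht; split=> [b X|X Xq|]; last by lia.
    by rewrite ltnS leq_eqVlt => /orP[/eqP->|ba] Xq; [apply: h2|apply: h1].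
  by have := h3 X Xq; rewrite Xq.
Qed.

Lemma swap_table_spec h : var h rQ = q -> var h rP2 = 2 ^ q -> var h rRow = 0 ->
  (forall X, X < 2 ^ q -> arr h aHalf X = X./2) ->
  (forall X, arr h aPos X = 0) ->
  wp inp E swap_table h (fun h1 t =>
    [/\ forall a X, a.+1 < q -> X < 2 ^ q -> arr h1 aSw (a * 2 ^ q + X) = swap a X,
        forall X, X < 2 ^ q -> pos_ok q.-1 (arr h1 aPos) X
      & t <= q * (2 ^ q * 10 + 4) + 1]).
Proof.
move=> hq hp hr hh hpos.
apply: (wp_for (B := 2 ^ q * 10 + 2) (I := fun a h1 => [/\ var h1 rRow = a * 2 ^ q,
   forall b X, b < a -> X < 2 ^ q -> arr h1 aSw (b * 2 ^ q + X) = swap b X &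
   forall X, X < 2 ^ q -> pos_ok a (arr h1 aPos) X])) => //=.
- by split=> // X _; left; split=> //; apply: hpos.
- move=> a g; rewrite hq => ha [g1 g2 g3]; wsteps.
  apply: (wp_call (swap_row_spec (a := a) _ _ _ _ _ _ _)) => //=; first by lia.
  move=> g' t [k1 k2 k3]; wsteps; split; last by lia.
  by rewrite g1 hp mulSn addnC.
- rewrite hq => g t [h1 h2 h3] ht; split; [|by rewrite -subn1|by move: ht; nia].
  by move=> a X aq; apply: h2; lia.
Qed.

Lemma tables_spec h : 0 < q -> var h rQ = q -> arr h aPc 0 = 0 ->
  (forall X, arr h aPos X = 0) ->
  wp inp E tables h (fun h1 t => is_tables h1 /\ t <= 40 * (q * 2 ^ q)).
Proof.
move=> q0 hq hc hpos; wsteps; rewrite /tables; wsteps.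
apply: (wp_call (powers_table_spec _ _)) => //= g t [g1 g2 g3]; wsteps; rewrite g1 hq.
apply: (wp_call (bits_table_spec _ _)) => //= k t' [k1 k2 k3]; wsteps.
apply: (wp_call (swap_table_spec _ _ _ _ _)) => //=.
  by move=> X Xq; apply: k1; lia.
move=> l t'' [l1 l2 l3].
have P0 : 0 < 2 ^ q by rewrite expn_gt0.
split; last by nia.
split=> //= a aq; rewrite updE; case: eqP => [->//|ne]; apply: g2; lia.
Qed.

Definition mul_ok (k : nat) (h : store) : Prop :=
  [/\ var h rWt = (2 ^ q) ^ k, var h rMp = k * 2 ^ q
    & forall t X, t < k -> X < 2 ^ q ->
        arr h aMul (t * 2 ^ q + X) = X * (2 ^ q) ^ t].

Lemma new_vertex_spec k x h : var h rP2 = 2 ^ q -> mul_ok k h ->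
  x != rC -> x != rY -> x != rWt -> x != rMp ->
  wp inp E (new_vertex x) h (fun h1 t => [/\ mul_ok k.+1 h1,
    arr h1 aMP = upd (arr h aMP) (var h x) (k * 2 ^ q) & t <= 2 ^ q * 4 + 10]).
Proof.
move=> hp [hw hm hmul] x1 x2 x3 x4; rewrite /new_vertex; wsteps.
apply: (wp_for (B := 2) (I := fun Y h1 => [/\ var h1 rC = Y * (2 ^ q) ^ k,
    forall t X, t < k -> X < 2 ^ q -> arr h1 aMul (t * 2 ^ q + X) = X * (2 ^ q) ^ t &
    forall X, X < Y -> arr h1 aMul (k * 2 ^ q + X) = X * (2 ^ q) ^ k])) => //=.
  move=> Y g; rewrite hp => hY [g1 g2 g3]; wsteps; rewrite hm hw g1.
  split=> //; split; first by rewrite mulSn addnC.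
    move=> t X tk Xq; rewrite updE; case: eqP => [e|_]; last exact: g2.
    have : t.+1 * 2 ^ q <= k * 2 ^ q by rewrite leq_mul2r tk orbT.
    by rewrite mulSn; lia.
  move=> X XY; rewrite updE; case: eqP => [e|ne]; last by apply: g3; lia.
  by rewrite (_ : X = Y) //; lia.
rewrite hp => g t [g1 g2 g3] ht; wsteps; split; last by lia.
  split=> /=; first by rewrite g1 expnS.
    by rewrite hm hp mulSn addnC.
  by move=> j X; rewrite ltnS leq_eqVlt => /orP[/eqP->|jk] Xq; [apply: g3|apply: g2].
by rewrite hm.
Qed.

End Tables.

(** * The table invariant and the leaves *)

Section TabInv.
Variables (q n : nat) (e : rel 'I_n) (s : seq (name n * name n * name n)).

(* The vertex [x] of the [i]-th trigraph has the weight [(2 ^ q) ^ id x]; the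
   colour sets [f] of a component are tabulated at their weighted sum. *)
Record tab_inv (i : nat) (id : name n -> nat) (h : store) : Prop := TabInv {
  ti_mul : mul_ok q (n + i) h;
  ti_mp : {in vertices (trigraph_at e s i), forall x : name n, arr h aMP x = id x * 2 ^ q};
  ti_id : {in vertices (trigraph_at e s i), forall x, id x < n + i};
  ti_inj : {in vertices (trigraph_at e s i) &, injective id};
  ti_zero : forall a, (2 ^ q) ^ (n + i) <= a -> arr h aTab a = 0;
  ti_tab : {in vertices (trigraph_at e s i), forall x f,
    {in red_component (trigraph_at e s i) x, forall y, 0 < f y < 2 ^ q} ->
    arr h aTab (code (2 ^ q) id (red_component (trigraph_at e s i) x) f) != 0 <->
    realizable e q (part_at s i) (red_component (trigraph_at e s i) x) f} }.

(** A power of [B] times a nonzero digit lies between two consecutive powers, which determines the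
    position and then the digit. *)
Lemma weight_inj B a b x y : a < B -> b < B -> 0 < a -> 0 < b ->
  a * B ^ x = b * B ^ y -> a = b /\ x = y.
Proof.
move=> aB bB a0 b0 E; have B0 : 0 < B by apply: leq_ltn_trans aB.
suff xy : x = y by move/eqP: E; rewrite xy eqn_pmul2r ?expn_gt0 ?B0 // => /eqP.
have H a' b' x' y' : a' < B -> 0 < a' -> 0 < b' -> x' < y' -> a' * B ^ x' <> b' * B ^ y'.
  move=> aB' a0' b0' lt E'; have : a' * B ^ x' < B ^ x'.+1.
    by rewrite expnS ltn_mul2r aB' expn_gt0 B0.
  rewrite E' ltnNge; case/negP; apply: leq_trans (leq_pmull _ b0').
  by rewrite leq_pexp2l.
by case: (ltngtP x y) => // lt; [case: (H a b x y)|case: (H b a y x)].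
Qed.

Lemma singletons_spec inp E h x k : var h rX = x -> var h rQ = q ->
  arr h aMP x = x * 2 ^ q -> mul_ok q k h -> x < k ->
  (forall a, a <= q -> arr h aPw a = 2 ^ a) ->
  wp inp E singletons h (fun h1 t =>
    (forall b, (arr h1 aTab b != 0) <->
      (arr h aTab b != 0 \/ exists2 c, c < q & b = 2 ^ c * (2 ^ q) ^ x)) /\
    t <= q * 2 + 1).
Proof.
move=> hx hq hmp [_ _ hmul] xk hpw.
apply: (wp_for (B := 1) (I := fun a h1 => forall b, (arr h1 aTab b != 0) <->
      (arr h aTab b != 0 \/ exists2 c, c < a & b = 2 ^ c * (2 ^ q) ^ x))) => //=.
- by move=> b; split=> [|[//|[c]]]; [left|].
- move=> a g; rewrite hq => ha g1; wsteps; split=> // b.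
  rewrite hx hmp (hpw _ (ltnW ha)) hmul //; last by rewrite ltn_exp2l.
  rewrite updE; case: (b =P _) => [->|ne].
    by split=> // _; right; exists a.
  rewrite g1; split=> -[h0|[c ca Eb]]; [by left|by right; exists c => //; apply: ltnW|by left|].
  right; exists c => //; move: ca; rewrite ltnS leq_eqVlt => /orP[/eqP ca|//].
  by case: ne; rewrite Eb ca.
- by rewrite hq => g t h1 h2; split=> //; lia.
Qed.

Lemma leaves_spec inp E h : 0 < q -> symmetric e -> irreflexive e ->
  contraction_sequence (trigraph_of_graph e) s ->
  var h rN = n -> var h rQ = q -> is_tables q h ->
  (forall a, arr h aTab a = 0) ->
  wp inp E leaves h (fun h1 t =>
    tab_inv 0 (fun x => x) h1 /\ t <= n * (2 ^ q * 4 + q * 2 + 20) + 10).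
Proof.
move=> q0 es ei hs hn hq ht h0; rewrite /leaves; wsteps.
apply: (wp_for (B := 2 ^ q * 4 + q * 2 + 11) (I := fun k h1 => [/\ mul_ok q k h1,
   forall x, x < k -> arr h1 aMP x = x * 2 ^ q &
   forall b, (arr h1 aTab b != 0) <->
     exists x c, [/\ x < k, c < q & b = 2 ^ c * (2 ^ q) ^ x]])) => //=.
- split=> //.
  by move=> b; rewrite h0; split=> // -[x [c []]].
- rewrite hn => k g hk [g1 g2 g3]; wsteps.
  wcall new_vertex_spec => //=; [exact: tables_p2 ht|exact: g1|].
  move=> g' t [k1 k2 k3].
  wcall (@singletons_spec _ _ _ k k.+1) => //=; [by rewrite k2 upd_same|exact: tables_pw ht|].
  move=> g'' t' [l1 l2]; split; last by lia.
  split=> //.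
    by move=> x xk; rewrite k2 updE; case: eqP => [->//|ne]; apply: g2; lia.
  move=> b; rewrite l1 g3; split=> [[[x [c [xk cq Eb]]]|[c cq Eb]]|[x [c [xk cq Eb]]]].
  + by exists x, c; split=> //; apply: ltnW.
  + by exists k, c.
  + move: xk; rewrite ltnS leq_eqVlt => /orP[/eqP xk|xk]; last by left; exists x, c.
    by right; exists c; rewrite // Eb xk.
rewrite hn => g t [g1 g2 g3] ht'; split; last by nia.
have P0 : 0 < 2 ^ q by rewrite expn_gt0.
have V0 x : x \in vertices (trigraph_at e s 0) -> x < n.
  by rewrite /trigraph_at take0 => /imsetP[y _ ->]; apply: (ltn_ord y).
split; rewrite ?addn0 //=.
- by move=> x xV; apply: g2; apply: V0.
- by move=> x y _ _ /val_inj.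
- move=> a ha; apply/eqP; apply: contraTT ha => /g3[x [c [xn cq ->]]].
  rewrite -ltnNge; apply: (@leq_trans ((2 ^ q) ^ x.+1)).
    by rewrite expnS ltn_mul2r expn_gt0 P0 ltn_exp2l.
  by rewrite leq_pexp2l.
- move=> x xV f; rewrite (red_component0 xV) => hf.
  have fx : 0 < f x < 2 ^ q by apply: hf; rewrite inE.
  move: (fx) => /andP[f0 f1].
  rewrite /code big_set1; rewrite g3.
  move: (xV); rewrite {1}/trigraph_at take0 => /imsetP[p _ Ep].
  have px p' : p' \in part_at s 0 x -> p' = p.
    by rewrite /part_at take0 inE Ep => /eqP/lshift_inj.
  have pp : p \in part_at s 0 x by rewrite /part_at take0 inE Ep.
  split=> [[y [c [yn cq Ec]]]|[c [_ c2]]].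
    have [Ef Ey] : f x = 2 ^ c /\ val x = y.
      by apply: weight_inj Ec; rewrite ?expn_gt0 // ltn_exp2l.
    (* A constant colouring is proper on one vertex, because [e] is irreflexive. *)
    exists [ffun=> Ordinal cq]; split=> [y1 y2|y1].
      rewrite !inE => /eqP-> /eqP-> p1 p2 /px-> /px->.
      by rewrite ei.
    rewrite inE => /eqP-> j jq; rewrite Ef.
    have -> : [exists p0 in part_at s 0 x, [ffun=> Ordinal cq] p0 == j :> nat] = (j == c).
      apply/existsP/eqP => [[p' /andP[_]]|->]; first by rewrite ffunE => /eqP<-.
      by exists p; rewrite pp ffunE /=.
    by rewrite bit_pow2.
  exists (val x), (val (c p)); split; rewrite ?V0 ?ltn_ord //.
  suff -> : f x = 2 ^ val (c p) by [].
  apply: (@bit_ext q) => // [|j jq]; first by rewrite ltn_exp2l // ltn_ord.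
  rewrite bit_pow2 c2 ?inE //; apply/existsP/eqP => [[p' /andP[/px-> /eqP//]]|->].
  by exists p; rewrite pp eqxx.
Qed.

End TabInv.

(** * The backward pass: red components of all trigraphs *)

Section Backward.
Variables (q n : nat) (e : rel 'I_n) (s : seq (name n * name n * name n))
  (x0 : name n) (m d E : nat).
Hypotheses (es : symmetric e) (ei : irreflexive e)
  (hs : contraction_sequence (trigraph_of_graph e) s)
  (hm : size s = m) (hE : 2 + (m * 3 + n * ((n + n) * (n + n))) <= E)
  (hd : all (red_components_le d) (trigraphs (trigraph_of_graph e) s)).

Let p0 := (x0, x0, x0).
Let inp := nth 0 (encode q e s).
Let n0 : n = m.+1. Proof. by rewrite -hm (size_sequence hs). Qed.
Let nm1 : n - 1 = m. Proof. by rewrite n0 subn1. Qed.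

Let H i := trigraph_at e s i.
Let u i := su s p0 i.
Let v i := sv s p0 i.
Let w i := sw s p0 i.

Definition merged_at i : {set name n} := merged (H i) (u i) (v i) (w i).

Let inv i : i <= m -> trigraph_inv e (H i) (part_at s i).
Proof. by move=> hi; apply: trigraph_inv_at; rewrite ?hm. Qed.

Let HS i : i < m -> H i.+1 = contract (H i) (u i, v i, w i).
Proof. by move=> hi; apply: trigraph_atS; rewrite hm. Qed.

Let stepP i : i < m -> [/\ u i \in vertices (H i), v i \in vertices (H i),
  u i != v i & w i \notin vertices (H i)].
Proof. by move=> hi; apply: step_at; rewrite ?hm. Qed.

Definition slot i a := i * (n + n) + a.

(** Labels stay below the size of the record because they index the accumulators of codes later on.
    With [u] and [v] at the head, positions 0 and 1 are theirs in every search. *)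
Record is_record (h : store) (i : nat) (pl : seq (name n)) : Prop := IsRecord {
  rec_len : arr h aLen i = size pl;
  rec_p : forall a, a < size pl -> arr h aP (slot i a) = nth x0 pl a;
  rec_uniq : uniq pl;
  rec_head : exists tl, pl = [:: u i, v i & tl];
  rec_mem : pl =i merged_at i;
  rec_lb : forall a, a < size pl -> arr h aLB (slot i a) < size pl;
  rec_conn : forall a b, a < size pl -> b < size pl ->
    (arr h aLB (slot i a) == arr h aLB (slot i b)) =
    connect (red (H i)) (nth x0 pl a) (nth x0 pl b) }.

(* The red component of the vertex [x] of the [i]-th trigraph is the set of the
   entries of the record [aRB x] that are labelled [aRG x]. *)
Definition located (h : store) (i : nat) (x : name n) : Prop :=
  exists pl : seq (name n),
  [/\ i <= arr h aRB x <= m, arr h aLen (arr h aRB x) = size pl,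
      uniq pl /\ size pl <= d.+1,
      forall a, a < size pl -> arr h aP (slot (arr h aRB x) a) = nth x0 pl a
    & {subset red_component (H i) x <= pl} /\
      forall a, a < size pl -> (arr h aLB (slot (arr h aRB x) a) == arr h aRG x) =
        (nth x0 pl a \in red_component (H i) x)].

Lemma size_uniq_name (pl : seq (name n)) : uniq pl -> size pl <= n + n.
Proof. by move=> /card_uniqP <-; rewrite -[X in _ <= X](card_ord (n + n)); apply: max_card. Qed.

Lemma slot_neq R i a b : R != i -> a < n + n -> b < n + n -> slot R a <> slot i b.
Proof.
move=> Ri an bn; rewrite /slot => E1; case/eqP: Ri.
have n2 : 0 < n + n by apply: leq_ltn_trans an.
by have := congr1 (divn^~ (n + n)) E1; rewrite !divnMDl // !divn_small // !addn0.
Qed.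

Lemma slot_inj i a b : slot i a = slot i b -> a = b.
Proof. by rewrite /slot; lia. Qed.

Definition tail_of (pl : seq (name n)) i (x : name n) : bool :=
  (x \in red_component (H i.+1) (w i)) && (x != w i).

Lemma collect_spec h i R (pl pl' : seq (name n)) :
  pl' = [:: u i, v i & [seq x <- pl | tail_of pl i x]] -> i < m -> R != i ->
  var h rR = R -> var h rRo = R * (n + n) -> var h rBase = i * (n + n) ->
  var h rW = w i -> var h rLen = 2 ->
  arr h aP (slot i 0) = u i -> arr h aP (slot i 1) = v i ->
  arr h aLen R = size pl -> uniq pl ->
  (forall a, a < size pl -> arr h aP (slot R a) = nth x0 pl a) ->
  (forall a, a < size pl -> (arr h aLB (slot R a) == var h rG) =
        (nth x0 pl a \in red_component (H i.+1) (w i))) ->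
  size pl' <= n + n ->
  wp inp E collect h (fun h1 t =>
    [/\ var h1 rLen = size pl',
        forall a, a < size pl' -> arr h1 aP (slot i a) = nth x0 pl' a,
        forall R' a, R' != i -> a < n + n -> arr h1 aP (slot R' a) = arr h aP (slot R' a)
      & t <= size pl * 6 + 1]).
Proof.
move=> -> im Ri hR hRo hB hW hL hu hv hlen upl hp hlb hsz.
pose tl b := [seq x <- take b pl | tail_of pl i x].
have sub b : size (tl b) <= size [seq x <- pl | tail_of pl i x].
  by rewrite -{2}(cat_take_drop b pl) filter_cat size_cat leq_addr.
have spl := size_uniq_name upl.
apply: (wp_for (B := 5) (I := fun b h1 =>
  let pl' := [:: u i, v i & tl b] in
  [/\ var h1 rLen = size pl',
      forall a, a < size pl' -> arr h1 aP (slot i a) = nth x0 pl' a &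
      forall R' a, R' != i -> a < n + n -> arr h1 aP (slot R' a) = arr h aP (slot R' a)])).
- rewrite /tl take0 /=; split=> // -[|[|a]] //.
- move=> b g; rewrite [heval _ _ _ _]/= hR hlen => hb /= [g1 g2 g3].
  have tlS : tl b.+1 = if tail_of pl i (nth x0 pl b) then rcons (tl b) (nth x0 pl b) else tl b.
    by rewrite /tl (take_nth x0 hb) filter_rcons.
  have keep k : k <= 5 -> tail_of pl i (nth x0 pl b) = false ->
     [/\ var g 26 = (size (tl b.+1)).+2,
      forall a : nat, a < (size (tl b.+1)).+2 -> arr g 13 (slot i a) = nth x0 [:: u i, v i & tl b.+1] a
      & forall R' a, R' != i -> a < n + n -> arr g 13 (slot R' a) = arr h 13 (slot R' a)] /\ k <= 5.
    by move=> k5 nt; rewrite tlS nt.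
  have bn : b < n + n by apply: leq_trans spl.
  have Pb : arr g 13 (R * (n + n) + b) = nth x0 pl b.
    by rewrite -hp // -g3 // /slot.
  have Lb := hlb b hb; rewrite /slot in Lb.
  wif => /= c1; wsteps.
    apply: keep => //; rewrite /tail_of -Lb; apply/negbTE/nandP; left.
    by apply/eqP; move: (dist_neq0 c1); rewrite hRo.
  have inC : nth x0 pl b \in red_component (H i.+1) (w i).
    by rewrite -Lb; apply/eqP; move: (dist_eq0 c1); rewrite hRo.
  wif; rewrite hRo Pb hW => c2; wsteps.
    have tT : tail_of pl i (nth x0 pl b).
      by rewrite /tail_of inC; apply/eqP=> E1; case: (dist_neq0 c2); rewrite E1.
    have szb := sub b.+1; rewrite tlS tT size_rcons in szb.
    rewrite tlS tT size_rcons g1 addn1 hB; split=> //; split=> //.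
      move=> a ha; rewrite updE; case: eqP => [E1|ne].
        have -> : a = (size (tl b)).+2 by apply: (@slot_inj i).
        by rewrite hRo Pb /= nth_rcons ltnn eqxx.
      have ha' : a < (size (tl b)).+2.
        by move: ha; rewrite ltnS leq_eqVlt => /orP[/eqP ea|//]; case: ne; rewrite ea.
      rewrite g2 //; case: a ha' {ha ne} => [|[|a]] //= ha'.
      by rewrite nth_rcons (_ : a < size (tl b)).
    move=> R' a R'i an; rewrite updE -g3 //; case: eqP => // E1.
    have hsz' : (size (tl b)).+2 < n + n by move: hsz szb => /=; lia.
    by case: (slot_neq R'i an hsz').
  apply: keep => //; rewrite /tail_of inC /=.
  by apply/negbTE; rewrite negbK; apply/eqP/val_inj/(dist_eq0 c2).
- rewrite [heval _ _ _ _]/= hR hlen => g t /= [g1 g2 g3] ht.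
  have Et : tl (size pl) = [seq x <- pl | tail_of pl i x] by rewrite /tl take_size.
  by rewrite -Et; split=> //; lia.
Qed.

Lemma init_labels_spec h i len : var h rLen = len -> var h rBase = i * (n + n) ->
  len <= n + n ->
  wp inp E init_labels h (fun h1 t =>
    [/\ forall a, a < len -> arr h1 aLB (slot i a) = a,
        forall R a, R != i -> a < n + n -> arr h1 aLB (slot R a) = arr h aLB (slot R a)
      & t <= len * 2 + 1]).
Proof.
move=> hL hB ln.
apply: (wp_for (B := 1) (I := fun b h1 =>
  (forall a, a < b -> arr h1 aLB (slot i a) = a) /\
  forall R a, R != i -> a < n + n -> arr h1 aLB (slot R a) = arr h aLB (slot R a))) => //=.
- move=> b g; rewrite hL => hb [g1 g2]; wsteps; rewrite hB; split=> //; split.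
    move=> a ab; rewrite updE; case: eqP => [/(@slot_inj i)//|ne]; apply: g1.
    by move: ab; rewrite ltnS leq_eqVlt => /orP[/eqP ab|//]; case: ne; rewrite ab.
  move=> R a Ri an; rewrite updE -g2 //; case: eqP => // E1.
  by case: (slot_neq Ri an (leq_trans hb ln) E1).
- by rewrite hL => g t [g1 g2] ht; split=> //; lia.
Qed.

Lemma relabel_spec h i len (lab : nat -> nat) : var h rLen = len ->
  var h rBase = i * (n + n) -> len <= n + n ->
  (forall a, a < len -> arr h aLB (slot i a) = lab a) ->
  wp inp E relabel h (fun h1 t =>
    [/\ forall a, a < len -> arr h1 aLB (slot i a) =
          if lab a == var h rLa then var h rLb else lab a,
        forall R a, R != i -> a < n + n -> arr h1 aLB (slot R a) = arr h aLB (slot R a)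
      & t <= len * 4 + 1]).
Proof.
move=> hL hB ln hlab.
apply: (wp_for (B := 3) (I := fun b h1 =>
  (forall a, a < len -> arr h1 aLB (slot i a) =
     if (a < b) && (lab a == var h rLa) then var h rLb else lab a) /\
  forall R a, R != i -> a < n + n -> arr h1 aLB (slot R a) = arr h aLB (slot R a))) => //=.
- move=> b g; rewrite hL => hb [g1 g2].
  have gb : arr g aLB (i * (n + n) + b) = lab b by have := g1 b hb; rewrite ltnn.
  wif; rewrite hB gb => c; wsteps; (split; last by []); split=> //.
    move=> a al; rewrite g1 //; case: (eqVneq a b) => [->|ab].
      by rewrite ltnn ltnSn /=; case: eqP => // /(dist_neq0 c).
    by rewrite (ltnS a b) (leq_eqVlt a b) (negbTE ab).
  + move=> a al; rewrite hB updE; case: eqP => [/(@slot_inj i) ->|ne].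
      by rewrite ltnSn (dist_eq0 c) eqxx.
    rewrite g1 // (ltnS a b) (leq_eqVlt a b); case: (eqVneq a b) => [ab|//].
    by case: ne; rewrite ab.
  + move=> R a Ri an; rewrite hB updE -g2 //; case: eqP => // E1.
    by case: (slot_neq Ri an (leq_trans hb ln) E1).
- rewrite hL => g t [g1 g2] ht; split=> //; last by lia.
  by move=> a al; rewrite g1 // al.
Qed.

(** The equivalence is kept as two implications: equal labels imply connection, and visited red
    pairs have equal labels. Both survive a relabelling, while full connection only emerges at the
    end. *)
Lemma join_labels_spec h i (pl : seq (name n)) : is_setup q s x0 m h -> i < m ->
  var h rLen = size pl -> var h rBase = i * (n + n) ->
  var h rMB = 2 + (m * 3 + i * ((n + n) * (n + n))) -> size pl <= n + n ->
  (forall a, a < size pl -> arr h aP (slot i a) = nth x0 pl a) ->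
  (forall a, a < size pl -> arr h aLB (slot i a) = a) ->
  wp inp E join_labels h (fun h1 t =>
    [/\ forall a, a < size pl -> arr h1 aLB (slot i a) < size pl,
        forall a b, a < size pl -> b < size pl ->
          arr h1 aLB (slot i a) = arr h1 aLB (slot i b) ->
          connect (red (H i)) (nth x0 pl a) (nth x0 pl b),
        forall a b, a < size pl -> b < size pl ->
          red (H i) (nth x0 pl a) (nth x0 pl b) ->
          arr h1 aLB (slot i a) = arr h1 aLB (slot i b),
        forall R a, R != i -> a < n + n -> arr h1 aLB (slot R a) = arr h aLB (slot R a)
      & t <= size pl * (size pl * (size pl * 4 + 6) + 2) + 1]).
Proof.
move=> hh im hL hB hMB ln hP hlab; set len := size pl in hL ln hP hlab *.
have hi := inv (ltnW im).
have cs : connect_sym (red (H i)) by apply: sym_connect_sym; exact: red_sym hi.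
(* [done] holds of the pairs visited so far, which the nested loops take in lexicographic order. *)
pose J done h1 :=
  [/\ forall a, a < len -> arr h1 aLB (slot i a) < len,
        forall a b, a < len -> b < len ->
          arr h1 aLB (slot i a) = arr h1 aLB (slot i b) ->
          connect (red (H i)) (nth x0 pl a) (nth x0 pl b),
        forall a b, a < len -> b < len -> done a b ->
          red (H i) (nth x0 pl a) (nth x0 pl b) ->
          arr h1 aLB (slot i a) = arr h1 aLB (slot i b) &
        forall R a, R != i -> a < n + n -> arr h1 aLB (slot R a) = arr h aLB (slot R a)].
apply: (wp_for (B := len * (len * 4 + 6) + 1) (I := fun a => J (fun a' _ => a' < a))).
- split=> //; first by move=> a al; rewrite hlab.
  by move=> a b al bl; rewrite !hlab // => ->; apply: connect0.
- move=> a g; rewrite [heval _ _ _ _]/= hL => al Ja.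
  apply: (wp_for (B := len * 4 + 5) (I := fun b => J (fun a' b' => (a' < a) || (a' == a) && (b' < b)))).
  + by case: Ja => g1 g2 g3 g4; split=> // a' b' al' bl'; rewrite ltn0 andbF orbF; apply: g3.
  + move=> b g'; rewrite [heval _ _ _ _]/= hL => bl /= Jb.
    have EP c : c < len -> arr h aP (i * (n + n) + c) = nth x0 pl c by move=> cl; apply: hP.
    wif; rewrite hB !EP // (setup_row hh (ltn_ord _)) hMB raw_adj // => c.
      wsteps; (split; last by lia).
      case: Jb => g1 g2 g3 g4; split=> // a' b' al' bl'.
      move=> hdone rd; apply: g3 => //; move: hdone.
      case/orP=> [->//|/andP[/eqP Ea]]; rewrite ltnS leq_eqVlt => /orP[/eqP Eb|->]; last first.
        by rewrite Ea eqxx orbT.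
      case: (dist_neq0 c); rewrite /adj -Ea -Eb.
      by rewrite (negbTE (red_black hi rd)) rd.
    have rab : red (H i) (nth x0 pl a) (nth x0 pl b).
      by move: (dist_eq0 c); rewrite /adj; case: (black _ _ _) => //; case: (red _ _ _).
    wsteps; rewrite hB; case: Jb => /= g1 g2 g3 g4.
    wcall (@relabel_spec _ i len (fun c => arr g' 14 (slot i c))) => //=.
    move=> g'' t [k1 k2 k3]; split; last by lia.
    rewrite -/(slot i a) -/(slot i b) in k1 *.
    have rl c' : c' < len -> arr g'' 14 (slot i c') < len.
      by move=> cl; rewrite k1 //; case: ifP => _; apply: g1.
    split=> //=.
    * move=> c1 c2 h1 h2; rewrite !k1 //; do 2 case: ifP => [/eqP|_] => //.
      - by move=> E1 E2 _; apply: g2 => //; rewrite E1 E2.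
      - move=> E1 E2; apply: connect_trans (g2 _ _ h1 al E1) _.
        by apply: connect_trans (connect1 rab) _; apply: g2.
      - move=> E1 E2; rewrite cs; apply: connect_trans (g2 _ _ h2 al E1) _.
        by apply: connect_trans (connect1 rab) _; apply: g2.
      - exact: g2.
    * move=> c1 c2 h1 h2; rewrite !k1 // => hdone rd.
      case/orP: hdone => [lt|/andP[/eqP Ea]].
        by rewrite (g3 c1 c2) // lt.
      rewrite ltnS leq_eqVlt => /orP[/eqP Eb|lt].
        by rewrite Ea Eb eqxx; case: ifP.
      by rewrite (g3 c1 c2) // Ea eqxx lt orbT.
    * by move=> R c' Ri cn; rewrite k2 // g4.
  + rewrite [heval _ _ _ _]/= hL => g' t /= Jb ht; split; last by lia.
    case: Jb => g1 g2 g3 g4; split=> // a' b' al' bl' hdone; apply: g3 => //.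
    by move: hdone; rewrite ltnS leq_eqVlt => /orP[/eqP->|->//]; rewrite eqxx bl' orbT.
- rewrite [heval _ _ _ _]/= hL => g t /= [g1 g2 g3 g4] ht; split=> //; last by lia.
  by move=> a b al bl; apply: g3.
Qed.

Lemma publish_spec h i (pl : seq (name n)) : var h rStep = i ->
  var h rLen = size pl -> var h rBase = i * (n + n) -> uniq pl ->
  (forall a, a < size pl -> arr h aP (slot i a) = nth x0 pl a) ->
  wp inp E publish h (fun h1 t =>
    [/\ forall x : name n, arr h1 aRB x = if x \in pl then i else arr h aRB x,
        forall x : name n, arr h1 aRG x =
          if x \in pl then arr h aLB (slot i (index x pl)) else arr h aRG x
      & t <= size pl * 3 + 1]).
Proof.
move=> hS hL hB upl hP.
apply: (wp_for (B := 2) (I := fun b h1 =>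
  (forall x : name n, arr h1 aRB x = if x \in take b pl then i else arr h aRB x) /\
  (forall x : name n, arr h1 aRG x =
     if x \in take b pl then arr h aLB (slot i (index x pl)) else arr h aRG x))).
- by rewrite take0.
- move=> b g; rewrite [heval _ _ _ _]/= hL => bl /= [g1 g2]; wsteps.
  have EP : arr h aP (i * (n + n) + b) = nth x0 pl b by apply: hP.
  rewrite hB hS EP; split=> //.
  have nx (x : name n) : ((x : nat) == nth x0 pl b) = (x == nth x0 pl b) by [].
  split=> x; rewrite updE (take_nth x0 bl) mem_rcons inE nx; case: eqP => [->|_] //=.
  by rewrite index_uniq.
- rewrite [heval _ _ _ _]/= hL => g t /=; rewrite take_size => -[g1 g2] ht.
  by split=> //; lia.
Qed.

Lemma component_le i x : i <= m -> x \in vertices (H i) -> #|red_component (H i) x| <= d.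
Proof. by move=> hi; apply: component_size => //; rewrite hm. Qed.

(** A component of at most [d] vertices loses [w] and gains [u] and [v], hence [d + 1]. *)
Lemma merged_seq i pl : i < m -> uniq pl ->
  {subset red_component (H i.+1) (w i) <= pl} ->
  let pl' := [:: u i, v i & [seq x <- pl | tail_of pl i x]] in
  [/\ pl' =i merged_at i, uniq pl' & size pl' <= d.+1].
Proof.
move=> im upl sub pl'; have [uV vV uv wV] := stepP im.
have memt x : (x \in [seq x <- pl | tail_of pl i x]) =
    (x \in red_component (H i.+1) (w i) :\ w i).
  rewrite mem_filter /tail_of in_setD1 [in RHS]andbC.
  by case xC: (x \in red_component (H i.+1) (w i)) => //=; rewrite sub // andbT.
have rest x : x \in red_component (H i.+1) (w i) :\ w i ->
    x \in vertices (H i) :\: [set u i; v i].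
  by rewrite HS //; apply: C'_rest.
split.
- by move=> x; rewrite /merged_at /merged -HS // !inE memt in_setD1 !inE orbA.
- rewrite /pl' /= inE negb_or uv /= filter_uniq // !memt andbT.
  by apply/andP; split; apply/negP=> /rest; rewrite !inE eqxx ?orbT.
- rewrite /pl' /=; have : size [seq x <- pl | tail_of pl i x] <= #|red_component (H i.+1) (w i) :\ w i|.
    by rewrite -(card_uniqP (filter_uniq _ upl)) (eq_card memt).
  have wC : w i \in vertices (H i.+1) by rewrite HS // in_setU1 eqxx.
  have := cardsD1 (w i) (red_component (H i.+1) (w i)).
  rewrite mem_red_component // => E1; have := component_le im wC.
  by rewrite E1 add1n => h1 h2; apply: leq_ltn_trans h2 h1.
Qed.

Lemma split_step_spec h i : is_setup q s x0 m h -> i < m -> var h rStep = i ->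
  (forall x, x \in vertices (H i.+1) -> located h i.+1 x) ->
  wp inp E split_step h (fun h1 t =>
    [/\ forall x, x \in vertices (H i) -> located h1 i x,
        exists pl, is_record h1 i pl /\ size pl <= d.+1,
        forall R, R != i -> arr h1 aLen R = arr h aLen R /\
          forall a, a < n + n -> arr h1 aP (slot R a) = arr h aP (slot R a) /\
             arr h1 aLB (slot R a) = arr h aLB (slot R a)
      & t <= 60 * d.+1 ^ 3]).
Proof.
move=> hh im hS loc; have [uV vV uv wV] := stepP im.
have wC : w i \in vertices (H i.+1) by rewrite HS // in_setU1 eqxx.
have [pl [R1 R2 [R3 R3'] R4 [R5 R6]]] := loc _ wC.
set R := arr h aRB (w i) in R1 R2 R4 R6.
have Ri : R != i by apply/eqP => E1; move: R1; rewrite E1 ltnn.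
have Rn : R < n + n by have /andP[_ ?] := R1; rewrite n0; lia.
have [] := merged_seq im R3 R5; set pl' := [:: _, _ & _].
have Epl : pl' = [:: u i, v i & [seq x <- pl | tail_of pl i x]] by [].
clearbody pl' => M1 M2 M3.
have szn := size_uniq_name M2.
have inn : i < n + n by rewrite n0; lia.
rewrite /split_step /load_step; wsteps.
rewrite !hS (setup_u hh im) (setup_v hh im) (setup_w hh im) (setup_mb hh im).
rewrite (setup_row hh (x := i) inn) -/R (setup_row hh Rn).

have n2 : 1 < n + n by rewrite n0; lia.
have s0 : i * (n + n) = slot i 0 by rewrite /slot addn0.
have s1 : slot i 0 + 1 = slot i 1 by rewrite /slot addn0.
have ne01 : slot i 0 <> slot i 1 by rewrite /slot; lia.
have PR (f : nat -> nat) x y R' a : R' != i -> a < n + n ->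
    upd (upd f (slot i 0) x) (slot i 1) y (slot R' a) = f (slot R' a).
  by move=> R'i an; rewrite !upd_other //; apply: slot_neq => //; lia.
wcall (@collect_spec _ i R pl pl') => //=; rewrite ?s0 ?s1.
- by rewrite (upd_other _ _ ne01) upd_same.
- by rewrite upd_same.
- by move=> a al; rewrite PR ?R4 //; apply: leq_trans al (size_uniq_name R3).
move=> g t [c1 c2 c3 c4].
have {}c3 R' a : R' != i -> a < n + n -> arr g aP (slot R' a) = arr h aP (slot R' a).
  by move=> R'i an; rewrite c3 // PR.
wsteps; rewrite hS.
wcall (@init_labels_spec _ i (size pl')) => //=.
move=> g1 t1 [k1 k2 k3].
wcall (@join_labels_spec _ i pl') => //=.
  by case: (hh) => *; split.
move=> g2 t2 [l1 l2 l3 l4 l5].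
wcall (@publish_spec _ i pl') => //=.
move=> g3 t3 [r1 r2 r3].
have hi := inv (ltnW im).
have clos y z : y \in pl' -> red (H i) y z -> z \in pl'.
  rewrite !M1; exact: merged_closed hi es uV vV uv wV y z.
have conn a b : a < size pl' -> b < size pl' ->
    (arr g2 aLB (slot i a) == arr g2 aLB (slot i b)) =
    connect (red (H i)) (nth x0 pl' a) (nth x0 pl' b).
  move=> al bl; apply/eqP/idP => [|ab]; first exact: l2.
  (* All pairs have been visited, so the label class of [a] is closed under red edges and contains
     everything connected to [a]. *)
  pose D := [set y | (y \in pl') && (arr g2 aLB (slot i (index y pl')) == arr g2 aLB (slot i a))].
  have : nth x0 pl' b \in D.
    apply: connect_stays ab; last by rewrite inE mem_nth // index_uniq ?eqxx.
    move=> y z; rewrite !inE => /andP[yp /eqP <-] yz; have zp := clos _ _ yp yz.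
    by rewrite zp /=; apply/eqP/esym/l3; rewrite ?index_mem // !nth_index.
  by rewrite inE index_uniq // => /andP[_ /eqP].
split.
(* A vertex of the merged set now points to the new record. For any other, the component is
   unchanged and its record, at a different index, still stands. *)
- move=> x xV; have [xM|xM] := boolP (x \in pl').
    exists pl'; rewrite /= r1 xM upd_same; split=> //.
    + by rewrite leqnn ltnW.
    + split; last first.
        move=> a al; rewrite r2 xM conn ?index_mem // nth_index // inE.
        rewrite (sym_connect_sym (red_sym hi)) andb_idl // => _.
        have : nth x0 pl' a \in pl' by apply: mem_nth.
        by rewrite M1; apply/subsetP/merged_sub.
      move=> y yC; rewrite M1; move: yC; apply/subsetP.
      apply: red_component_min; last by rewrite -M1.
      by move=> y' z; apply: (merged_closed hi es uV vV uv wV).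
  have [xV' _ Ecomp] := red_component_other hi es uV vV uv wV xV
     (ltac:(by rewrite -/(merged_at i) -M1)).
  rewrite -HS // in xV' Ecomp; have [px [X1 X2 X3 X4 X5]] := loc x xV'.
  have Rx : arr h aRB x != i by apply/eqP => E1; move: X1; rewrite E1 ltnn.
  exists px; rewrite /= r1 (negbTE xM) upd_other; last by apply/eqP.
  split=> //; first by have /andP[h1 ->] := X1; rewrite (ltnW h1).
    move=> a al; rewrite c3 ?X4 //.
    by apply: leq_trans al (size_uniq_name (proj1 X3)).
  rewrite Ecomp r2 (negbTE xM); case: X5 => X5 X6; split=> // a al.
  have an : a < n + n by apply: leq_trans al (size_uniq_name (proj1 X3)).
  by rewrite l4 // k2 // X6.
- exists pl'; split=> //; split=> //=.
  + by rewrite upd_same.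
  + by rewrite Epl; eexists.
- move=> R' R'i /=; rewrite upd_other; last by apply/eqP.
  split=> // a an; rewrite c3 //; split=> //.
  by rewrite l4 // k2.
- move: c4 k3 l5 r3 R3' M3; rewrite -/(size pl').
  move: (size pl) (size pl') => sp sp' c4 k3 l5 r3 R3' M3.
  have : sp' * (sp' * (sp' * 4 + 6) + 2) <= d.+1 * (d.+1 * (d.+1 * 4 + 6) + 2).
    by apply: leq_mul => //; rewrite leq_add2r; apply: leq_mul => //; rewrite leq_add2r leq_mul2r M3 orbT.
  rewrite !expnS expn0; nia.
Qed.

Lemma is_record_same h h1 R pl :
  arr h1 aLen R = arr h aLen R ->
  (forall a, a < n + n -> arr h1 aP (slot R a) = arr h aP (slot R a) /\
     arr h1 aLB (slot R a) = arr h aLB (slot R a)) ->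
  is_record h R pl -> is_record h1 R pl.
Proof.
move=> EL EPB [r1 r2 r3 r4 r5 r6 r7].
have lt a : a < size pl -> a < n + n by move=> al; apply: leq_trans al (size_uniq_name r3).
split=> //; first by rewrite EL.
- by move=> a al; have [-> _] := EPB a (lt a al); apply: r2.
- by move=> a al; have [_ ->] := EPB a (lt a al); apply: r6.
- by move=> a b al bl; have [_ ->] := EPB a (lt a al); have [_ ->] := EPB b (lt b bl); apply: r7.
Qed.

Lemma backward_spec h : is_setup q s x0 m h -> 0 < m ->
  (forall a, arr h aLB a = 0) -> (forall a, arr h aRG a = 0) ->
  wp inp E backward h (fun h1 t =>
    (forall i, i < m -> exists pl, is_record h1 i pl /\ size pl <= d.+1) /\
    t <= n * (60 * d.+1 ^ 3 + 10) + 20).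
Proof.
move=> hh m0 hLB hRG; rewrite /backward; wsteps.
have nm2 : n - 2 = m.-1 by rewrite n0; lia.
have m1 : m.-1 < m by rewrite prednK.
have mn : m < n + n by rewrite n0; lia.
rewrite (setup_n hh) nm2 nm1 (setup_w hh m1) (setup_row hh mn).
pose z := sw s p0 m.-1; rewrite -/p0 -/z.
have Vz : vertices (H m) = [set z].
  by have := vertices_last hs p0; rewrite hm => /(_ m0).
apply: (wp_for (B := 60 * d.+1 ^ 3 + 1) (I := fun k h1 =>
  (forall x, x \in vertices (H (m - k)) -> located h1 (m - k) x) /\
  (forall R, m - k <= R < m -> exists pl, is_record h1 R pl /\ size pl <= d.+1))).
- rewrite subn0; split; last by move=> R; rewrite leqNgt andNb.
  move=> x; rewrite Vz inE => /eqP->.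
  exists [:: z]; rewrite /= !upd_same; split=> //; first by rewrite leqnn.
    by case=> // _; rewrite /slot addn0 upd_same.
  split; first by move=> y; rewrite !inE Vz inE => /andP[].
  by case=> // _; rewrite hLB hRG eqxx /= mem_red_component ?Vz ?inE.
- move=> k g; rewrite [heval _ _ _ _]/= (setup_n hh) nm1 => km [g1 g2].
  have Ek : (m - k.+1).+1 = m - k by lia.
  wcall (@split_step_spec _ (m - k.+1)) => //=.
  + by case: (hh) => *; split.
  + by lia.
  + by rewrite (setup_n hh) nm2; lia.
  + by rewrite Ek.
  move=> g' t [k1 k2 k3 k4]; split; last by lia.
  split=> // R; rewrite leq_eqVlt => /andP[/orP[/eqP <-|lt] Rm]; first exact: k2.
  have [|pl [P1 P2]] := g2 R; first by rewrite -Ek lt.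
  have Ri : R != m - k.+1 by lia.
  exists pl; split=> //; apply: is_record_same P1; by have [] := k3 R Ri.
- rewrite [heval _ _ _ _]/= (setup_n hh) nm1 subnn => g t [g1 g2] ht; split; last first.
    by move: ht; rewrite n0; nia.
  by move=> i im; have [|pl [P1 P2]] := g2 i; [rewrite im|exists pl; split=> //; apply: is_record_same P1].
Qed.

End Backward.

(** * The odometer as a program *)

Section Odometer.
Variables (inp : nat -> nat) (E N : nat).

Definition digit N it a := ((it %/ N ^ a) %% N).+1.

Definition digits_at (L it : nat) (X : nat -> nat) : Prop :=
  forall a, a < L -> X a.+2 = digit N it a.

Lemma reset_spec h bound L : heval inp E h bound = L ->
  wp inp E (reset bound) h (fun h1 t =>
    [/\ digits_at L 0 (arr h1 aX), arr h1 aX 0 = arr h aX 0, arr h1 aX 1 = arr h aX 1,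
        forall a, L.+2 <= a -> arr h1 aX a = arr h aX a & t <= L * 2 + 1]).
Proof.
move=> hL; apply: (wp_for (B := 1) (I := fun k h1 =>
  [/\ forall a, a < k -> arr h1 aX a.+2 = 1, arr h1 aX 0 = arr h aX 0,
     arr h1 aX 1 = arr h aX 1 & forall a, L.+2 <= a -> arr h1 aX a = arr h aX a])).
- by [].
- move=> k g; rewrite hL => hk /= [g1 g2 g3 g4]; wsteps; rewrite addn2.
  split=> //; split=> //.
  + by move=> a; rewrite ltnS updE eqSS eqSS; case: eqP => // ne ak; apply: g1; lia.
  + by move=> a aL; rewrite updE; case: eqP => [ea|_]; [lia|apply: g4].
- rewrite hL => g t /= [g1 g2 g3 g4] ht; split=> //; last by lia.
  by move=> a aL; rewrite g1 // /digit div0n mod0n.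
Qed.

Lemma tick_spec h bound L it : 0 < N -> var h rK = N ->
  heval inp E (setv h rCy 1) bound = L -> digits_at L it (arr h aX) ->
  wp inp E (tick bound) h (fun h1 t =>
    [/\ digits_at L it.+1 (arr h1 aX), arr h1 aX 0 = arr h aX 0, arr h1 aX 1 = arr h aX 1,
        forall a, L.+2 <= a -> arr h1 aX a = arr h aX a & t <= L * 5 + 2]).
Proof.
move=> N0 hK hL hX; rewrite /tick; wsteps.
(* The flag tells whether a carry reaches digit [k]; digits below [k] already show the new count,
   the others still the old one. *)
apply: (wp_for (B := 4) (I := fun k h1 =>
  [/\ (var h1 rCy != 0) = (N ^ k %| it.+1),
      forall a, a < L -> arr h1 aX a.+2 = digit N (if a < k then it.+1 else it) a,
      arr h1 aX 0 = arr h aX 0, arr h1 aX 1 = arr h aX 1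
    & forall a, L.+2 <= a -> arr h1 aX a = arr h aX a])).
- by split=> //=; rewrite ?expn0 ?dvd1n.
- move=> k g; rewrite hL => hk /= [g1 g2 g3 g4 g5].
  have gk := g2 k hk; rewrite ltnn in gk.
  have dig := odometer_digit it k N0; have carry := odometer_carry it k N0.
  have upd_ok x (b : bool) : x = digit N it.+1 k -> b = (N ^ k.+1 %| it.+1) ->
     [/\ b = (N ^ k.+1 %| it.+1),
     forall a : nat, a < L -> upd (arr g 18) k.+2 x a.+2 = digit N (if a < k.+1 then it.+1 else it) a,
     upd (arr g 18) k.+2 x 0 = arr h 18 0, upd (arr g 18) k.+2 x 1 = arr h 18 1
   & forall a : nat, L.+1 < a -> upd (arr g 18) k.+2 x a = arr h 18 a].
    move=> Ex Eb; split=> //.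
    + move=> a aL; rewrite updE !eqSS; case: eqP => [->|ne]; first by rewrite ltnSn.
      by rewrite g2 // (_ : (a < k.+1) = (a < k)) //; move: ne; clear; lia.
    + move=> a aL; rewrite updE; case: eqP => [ea|_]; last exact: g5.
      by move: aL hk; rewrite ea; clear; lia.
  wif => c1.
    rewrite c1 in g1; rewrite -g1 /= in dig carry.
    wif; rewrite addn2 gk hK => c2; wsteps; rewrite !addn2 ?gk ?addn1; (split; last by []).
      have ne : ((it %/ N ^ k) %% N == N.-1) = false.
        by apply/negP=> /eqP e1; move: c2; rewrite /digit e1 prednK // subnn.
      by apply: upd_ok; rewrite /digit ?dig ?carry ne.
    have eq : (it %/ N ^ k) %% N == N.-1.
      move: c2 (ltn_pmod (it %/ N ^ k) N0); rewrite /digit; move: (_ %% N) => r.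
      by clear - N0; lia.
    by apply: upd_ok; rewrite /digit ?dig ?carry eq // c1.
  rewrite c1 in g1; rewrite -g1 /= in dig carry.
  wsteps; (split; last by []); split=> //; first by rewrite c1 carry.
  move=> a aL; rewrite g2 //; case: (eqVneq a k) => [->|ne].
    by rewrite ltnn ltnSn /digit dig.
  by rewrite (_ : (a < k.+1) = (a < k)) //; move: ne; clear; lia.
- rewrite hL => g t /= [g1 g2 g3 g4 g5] ht; split=> //; last by lia.
  by move=> a aL; rewrite g2 // aL.
Qed.

End Odometer.

Lemma slots_sum (T : finType) (x0 : T) (pl : seq T) (C : {set T}) (F : T -> nat) :
  uniq pl -> {subset C <= pl} ->
  \sum_(y in C) F y = \sum_(a < size pl | nth x0 pl a \in C) F (nth x0 pl a).
Proof.
move=> upl sub; have -> : \sum_(y in C) F y = \sum_(y <- pl | y \in C) F y.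
  rewrite -[RHS]big_filter big_uniq ?filter_uniq //=; apply: eq_bigl => y.
  by rewrite mem_filter; case yC: (y \in C) => //=; rewrite sub.
by rewrite (big_nth x0) big_mkord.
Qed.

(** * Testing one assignment on the old components *)

Section Leaf.
Variables (q n : nat) (e : rel 'I_n) (s : seq (name n * name n * name n))
  (x0 : name n) (m d E : nat).
Hypotheses (q0 : 0 < q) (es : symmetric e) (ei : irreflexive e)
  (hs : contraction_sequence (trigraph_of_graph e) s)
  (hm : size s = m) (hE : 2 + (m * 3 + n * ((n + n) * (n + n))) <= E).

Let p0 := (x0, x0, x0).
Let inp := nth 0 (encode q e s).
Let n0 : n = m.+1. Proof. by rewrite -hm (size_sequence hs). Qed.

Let H i := trigraph_at e s i.
Let u i := su s p0 i.
Let v i := sv s p0 i.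
Let w i := sw s p0 i.

Variables (i : nat) (pl : seq (name n)) (id : name n -> nat).
Hypotheses (im : i < m).

Let len := size pl.
Let hi : trigraph_inv e (H i) (part_at s i).
Proof. by apply: trigraph_inv_at => //; rewrite hm ltnW. Qed.

Definition weight a := (2 ^ q) ^ id (nth x0 pl a).

Record step_ctx (h : store) : Prop := StepCtx {
  ctx_setup : is_setup q s x0 m h;
  ctx_tables : is_tables q h;
  ctx_record : is_record e s x0 h i pl;
  ctx_len : var h rLen = len;
  ctx_base : var h rBase = i * (n + n);
  ctx_mb : var h rMB = 2 + (m * 3 + i * ((n + n) * (n + n)));
  ctx_w : var h rW = w i;
  ctx_id : {in vertices (H i), forall x, id x < n + i};
  ctx_inj : {in vertices (H i) &, injective id};
  ctx_mul : forall a X, a < len -> X < 2 ^ q ->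
    arr h aMul (arr h aMP (nth x0 pl a) + X) = X * weight a;
  ctx_mulw : forall X, X < 2 ^ q ->
    arr h aMul (arr h aMP (w i) + X) = X * (2 ^ q) ^ (n + i) }.

(** On overlays both tuple equations hold by computation, so the context passes through any program
    that leaves these locations alone. *)
Lemma step_ctx_frame h h1 :
  (var h1 rQ, var h1 rN, var h1 rP2, var h1 rK, var h1 rLen, var h1 rBase,
   var h1 rMB, var h1 rW) =
  (var h rQ, var h rN, var h rP2, var h rK, var h rLen, var h rBase,
   var h rMB, var h rW) ->
  (arr h1 aRow, arr h1 aMB, arr h1 aU, arr h1 aV, arr h1 aW, arr h1 aPw,
   arr h1 aPc, arr h1 aSw, arr h1 aPos, arr h1 aMul, arr h1 aMP, arr h1 aP,
   arr h1 aLB, arr h1 aLen) =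
  (arr h aRow, arr h aMB, arr h aU, arr h aV, arr h aW, arr h aPw,
   arr h aPc, arr h aSw, arr h aPos, arr h aMul, arr h aMP, arr h aP,
   arr h aLB, arr h aLen) ->
  step_ctx h -> step_ctx h1.
Proof.
move=> [v1 v2 v3 v4 v5 v6 v7 v8] [a1 a2 a3 a4 a5 a6 a7 a8 a9 a10 a11 a12 a13 a14].
case=> [] [] s1 s2 s3 s4 s5 s6 s7 [] t1 t2 t3 t4 t5 t6 [] r1 r2 r3 r4 r5 r6 r7 c1 c2 c3 c4 c5 c6 c7 c8.
split; last by rewrite a10 a11.
- by split; rewrite ?v1 ?v2 ?a1 ?a2 ?a3 ?a4 ?a5.
- by split; rewrite ?v3 ?v4 ?a6 ?a7 ?a8 ?a9.
- by split; rewrite ?a12 ?a13 ?a14.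
- by rewrite v5.
- by rewrite v6.
- by rewrite v7.
- by rewrite v8.
- by [].
- by [].
- by rewrite a10 a11.
Qed.

Definition colour_sets (X : nat -> nat) (y : name n) : nat := X (index y pl).

Definition leaf_ok (X : nat -> nat) : Prop :=
  realizable e q (part_at s i) (merged_at e s x0 i) (colour_sets X).

Lemma check_black_spec h : step_ctx h -> var h rOk = 1 ->
  (forall a, a < len -> arr h aX a < 2 ^ q) ->
  wp inp E check_black h (fun h1 t =>
    ((var h1 rOk != 0) <->
     (forall a b, a < len -> b < len -> black (H i) (nth x0 pl a) (nth x0 pl b) ->
       forall c, ~~ (bit c (arr h aX a) && bit c (arr h aX b)))) /\
    t <= len * (len * 5 + 2) + 1).
Proof.
move=> hh hok hX.
pose good a b := black (H i) (nth x0 pl a) (nth x0 pl b) ->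
  forall c, ~~ (bit c (arr h aX a) && bit c (arr h aX b)).
pose J done h1 := (var h1 rOk != 0) <->
  (forall a b, a < len -> b < len -> done a b -> good a b).
have lexS a b : a < len -> b < len ->
   (forall a' b', a' < len -> b' < len -> (a' < a) || (a' == a) && (b' < b.+1) -> good a' b') <->
   (forall a' b', a' < len -> b' < len -> (a' < a) || (a' == a) && (b' < b) -> good a' b') /\ good a b.
  move=> al bl; split=> [h1|[h1 h2] a' b' al' bl'].
    split=> [a' b' al' bl' hd|]; apply: h1 => //; last by rewrite eqxx ltnSn orbT.
    by case/orP: hd => [->//|/andP[-> lt]]; rewrite (leqW lt) orbT.
  case/orP=> [lt|/andP[/eqP ->]]; first by apply: h1 => //; rewrite lt.
  rewrite ltnS leq_eqVlt => /orP[/eqP ->//|lt]; apply: h1 => //.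
  by rewrite eqxx lt orbT.
apply: (wp_for (B := len * 5 + 1) (I := fun a => J (fun a' _ => a' < a))).
- by rewrite /J hok.
- move=> a g; rewrite [heval _ _ _ _]/= (ctx_len hh) => al Ja.
  apply: (wp_for (B := 4) (I := fun b => J (fun a' b' => (a' < a) || (a' == a) && (b' < b)))).
  + rewrite /J /=; rewrite /J /= in Ja; rewrite Ja; split=> h1 a' b' al' bl' hd; apply: h1 => //.
      by move: hd; rewrite ltn0 andbF orbF.
    by rewrite hd.
  + move=> b g'; rewrite [heval _ _ _ _]/= (ctx_len hh) => bl Jb; rewrite /J /= in Jb.
    have EP c : c < len -> arr h aP (i * (n + n) + c) = nth x0 pl c.
      by move=> cl; apply: (rec_p (ctx_record hh)).
    wif; rewrite (ctx_base hh) !EP // (setup_row (ctx_setup hh) (ltn_ord _)) (ctx_mb hh).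
    - rewrite (raw_adj q hs hm hE) // => c1; wsteps; (split; last by []).
      rewrite /J /= lexS // Jb; split=> [h1|[]//]; split=> // bk.
      by case: (dist_neq0 c1); rewrite /adj bk.
    rewrite (raw_adj q hs hm hE) // => c1.
    have bk : black (H i) (nth x0 pl a) (nth x0 pl b).
      by move: (dist_eq0 c1); rewrite /adj -/(H i); case: (black _ _ _) => //; case: (red _ _ _).
    have pc := tables_pc (ctx_tables hh); have [xa xb] := (hX a al, hX b bl).
    wif; rewrite !pc; try by [move: xa xb; clear; lia].
    - move=> c2; wsteps; (split; last by []); rewrite /J /= lexS //; split=> // -[_ /(_ bk)].
      by move/popcount_disjointP => c3; rewrite (eqP c3) in c2.
    move/eqP/popcount_disjointP=> c2; wsteps; (split; last by []); rewrite /J /= lexS // Jb.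
    by split=> [h1|[]//]; split.
  + rewrite [heval _ _ _ _]/= (ctx_len hh) => g' t Jb ht; split; last by lia.
    rewrite /J /= in Jb *; rewrite Jb; split=> h1 a' b' al' bl' hd; apply: h1 => //.
      by rewrite bl' andbT orbC -leq_eqVlt -ltnS.
    by move: hd; rewrite bl' andbT orbC -leq_eqVlt -ltnS.
- rewrite [heval _ _ _ _]/= (ctx_len hh) => g t Ja ht; split; last by lia.
  rewrite /J /= in Ja *; rewrite Ja; split=> h1 a b al bl; first exact: (h1 a b).
  by move=> _; apply: h1.
Qed.

Lemma clear_codes_spec h : var h rLen = len ->
  wp inp E clear_codes h (fun h1 t =>
    (forall a, a < len -> arr h1 aAcc a = 0) /\ t <= len * 2 + 1).
Proof.
move=> hl; apply: (wp_for (B := 1) (I := fun k h1 => forall a, a < k -> arr h1 aAcc a = 0)) => //.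
- move=> k g /= _ g1; wsteps; split=> // a; rewrite updE ltnS; case: eqP => // ne ak.
  by apply: g1; lia.
- by rewrite [heval _ _ _ _]/= hl => g t g1 ht; split=> //; lia.
Qed.

Let lab h a := arr h aLB (slot n i a).

Lemma sum_codes_spec h : step_ctx h ->
  (forall a, a < len -> arr h aX a < 2 ^ q) ->
  (forall a, a < len -> arr h aAcc a = 0) ->
  wp inp E sum_codes h (fun h1 t =>
    (forall l, l < len -> arr h1 aAcc l =
       \sum_(a < len | lab h a == l) arr h aX a * weight a) /\ t <= len * 3 + 1).
Proof.
move=> hh hX h0.
apply: (wp_for (B := 2) (I := fun k h1 => forall l, l < len -> arr h1 aAcc l =
   \sum_(a < k | lab h a == l) arr h aX a * weight a)).
- by move=> l ll; rewrite big_ord0 h0.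
- move=> k g; rewrite [heval _ _ _ _]/= (ctx_len hh) => kl /= g1; wsteps.
  have EP : arr h aP (i * (n + n) + k) = nth x0 pl k by apply: (rec_p (ctx_record hh)).
  have lb : arr h aLB (i * (n + n) + k) < len by apply: (rec_lb (ctx_record hh)).
  rewrite (ctx_base hh) EP (ctx_mul hh) ?hX //; split=> // l ll.
  rewrite updE g1 // [RHS]big_mkcond [RHS]big_ord_recr /= -[in RHS]big_mkcond /=.
  case: eqP => [->|ne]; first by rewrite /lab /slot eqxx.
  by rewrite g1 // /lab /slot; case: eqP => [e1|_]; [case: ne|rewrite addn0].
- by rewrite [heval _ _ _ _]/= (ctx_len hh) => g t g1 ht; split=> //; lia.
Qed.

Lemma check_codes_spec h : step_ctx h ->
  wp inp E check_codes h (fun h1 t =>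
    ((var h1 rOk != 0) <-> (var h rOk != 0 /\
       forall a, a < len -> arr h aTab (arr h aAcc (lab h a)) != 0)) /\ t <= len * 3 + 1).
Proof.
move=> hh; apply: (wp_for (B := 2) (I := fun k h1 => (var h1 rOk != 0) <-> (var h rOk != 0 /\
   forall a, a < k -> arr h aTab (arr h aAcc (lab h a)) != 0))).
- by split=> // -[].
- move=> k g; rewrite [heval _ _ _ _]/= (ctx_len hh) => kl /= g1; wif; rewrite (ctx_base hh) => c.
    wsteps; split=> //; rewrite g1; split=> -[h1 h2]; split=> // a ak; last by apply: h2; apply: ltnW.
    by move: ak; rewrite ltnS leq_eqVlt => /orP[/eqP->//|]; apply: h2.
  wsteps; split=> //; split=> // -[_ /(_ k (ltnSn k))].
  by rewrite /lab /slot c.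
- by rewrite [heval _ _ _ _]/= (ctx_len hh) => g t g1 ht; split=> //; lia.
Qed.

(** The program tests the right-hand side of [realizable_glue]: disjointness along black edges and a
    lookup for each old component. The codes of all components are accumulated in one pass, indexed
    by label. *)
Lemma check_leaf_spec h : step_ctx h ->
  (forall a, a < len -> 0 < arr h aX a < 2 ^ q) ->
  {in vertices (H i), forall x f,
    {in red_component (H i) x, forall y, 0 < f y < 2 ^ q} ->
    arr h aTab (code (2 ^ q) id (red_component (H i) x) f) != 0 <->
    realizable e q (part_at s i) (red_component (H i) x) f} ->
  wp inp E check_leaf h (fun h1 t =>
    ((var h1 rOk != 0) <-> leaf_ok (arr h aX)) /\ t <= len * (len * 5 + 10) + 10).
Proof.
move=> hh hX hT; rewrite /check_leaf; wsteps.
have hXq a : a < len -> arr h aX a < 2 ^ q by move/hX=> /andP[].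
have [uV vV uv wV] : [/\ u i \in vertices (H i), v i \in vertices (H i),
  u i != v i & w i \notin vertices (H i)] by apply: step_at; rewrite ?hm.
have rc := ctx_record hh.
have memP a : a < len -> nth x0 pl a \in merged (H i) (u i) (v i) (w i).
  by move=> al; rewrite -[merged _ _ _ _]/(merged_at e s x0 i) -(rec_mem rc) mem_nth.
have subV : merged (H i) (u i) (v i) (w i) \subset vertices (H i) by apply: merged_sub.
wcall check_black_spec => //=; first exact: (step_ctx_frame _ _ hh).
move=> g t [g1 g2]; wcall clear_codes_spec; first exact: ctx_len hh.
move=> g' t' [g3 g4]; wcall sum_codes_spec => //=; first exact: (step_ctx_frame _ _ hh).
move=> k t2 [k1 k2]; wcall check_codes_spec => //=; first exact: (step_ctx_frame _ _ hh).
move=> l t3 [l1 l2]; split; last by move: g2 g4 k2 l2; clear; nia.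
rewrite l1 /= g1 /leaf_ok.
rewrite (realizable_glue hi q0); first last.
- exact: merged_closed hi es uV vV uv wV.
- exact: subV.
have code_eq a : a < len -> arr k 19 (lab h a) =
    code (2 ^ q) id (red_component (H i) (nth x0 pl a)) (colour_sets (arr h aX)).
  move=> al; rewrite k1; last exact: (rec_lb rc).
  rewrite /code (slots_sum x0 _ (rec_uniq rc)); last first.
    move=> y; rewrite (rec_mem rc); apply/subsetP; apply: red_component_min; last exact: memP.
    exact: merged_closed hi es uV vV uv wV.
  apply: eq_big => [b|b _].
    rewrite /lab (rec_conn rc) // inE (sym_connect_sym (red_sym hi)).
    by rewrite (subsetP subV) ?memP.
  by rewrite /colour_sets index_uniq ?(rec_uniq rc).
have cs_lt y : y \in pl -> 0 < colour_sets (arr h aX) y < 2 ^ q.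
  by move=> yp; apply: hX; rewrite index_mem.
have comp_pl a y : a < len -> y \in red_component (H i) (nth x0 pl a) -> y \in pl.
  move=> al; rewrite (rec_mem rc); apply/subsetP; apply: red_component_min; last exact: memP.
  exact: merged_closed hi es uV vV uv wV.
have inP y : y \in merged_at e s x0 i -> exists2 a, a < len & y = nth x0 pl a.
  by rewrite -(rec_mem rc) => yp; exists (index y pl); rewrite ?index_mem // nth_index.
split=> [[h1 h2]|[h1 h2]]; split.
- move=> x y /inP[a al ->] /inP[b bl ->] bk c cq.
  by rewrite /colour_sets !index_uniq ?(rec_uniq rc) //; apply: h1.
- move=> x /inP[a al ->]; apply/(hT _ (subsetP subV _ (memP a al))).
    by move=> y /(comp_pl a y al); apply: cs_lt.
  by rewrite -code_eq // h2.
- move=> a b al bl bk c; case: (ltnP c q) => cq.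
    have := h1 _ _ (memP a al) (memP b bl) bk c cq.
    by rewrite /colour_sets !index_uniq ?(rec_uniq rc).
  by rewrite (bit_out (hXq a al) cq).
- move=> a al; rewrite -/(lab h a) code_eq //.
  apply/(hT _ (subsetP subV _ (memP a al))); last exact: h2 (memP a al).
  by move=> y /(comp_pl a y al); apply: cs_lt.
Qed.

End Leaf.

Lemma low_bits_lt k X : (forall c, k <= c -> bit c X = false) -> X < 2 ^ k.
Proof.
move=> hX; suff -> : X = bitmask k (bit^~ X) by apply: bitmask_lt.
by apply: bit_inj => c; rewrite bit_bitmask; case: (ltnP c k) => // kc; rewrite hX.
Qed.

Lemma bit_add_pow2 k X c : X < 2 ^ k -> bit c (X + 2 ^ k) = bit c X || (c == k).
Proof.
move=> hX; rewrite -[2 ^ k]muln1 bit_cat //; case: ltngtP => ck.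
- by rewrite orbF.
- by rewrite (bit_out hX (ltnW ck)) -[1]/(2 ^ 0) bit_pow2; apply/negbTE; lia.
- by rewrite ck subnn orbT.
Qed.

Lemma drop_top_bit k X : X < 2 ^ k.+1 ->
  exists2 Y, Y < 2 ^ k & X = Y + bit k X * 2 ^ k /\ forall c, c < k -> bit c Y = bit c X.
Proof.
move=> hX; have lt := bitmask_lt k (bit^~ X); exists (bitmask k (bit^~ X)) => //.
split; last by move=> c ck; rewrite bit_bitmask ck.
apply: bit_inj => c; case bk: (bit k X); rewrite ?mul1n ?mul0n ?addn0 ?bit_add_pow2 //
  bit_bitmask; case: (ltngtP c k) => /= [_|ck|->]; rewrite ?orbF ?bk //;
  exact: (bit_out hX ck).
Qed.

(** * Pairs of sets with a given union *)

Section Pairs.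
Variables (inp : nat -> nat) (E q : nat).

Record pairs_ok (k Z : nat) (PU PV : nat -> nat) : Prop := PairsOk {
  pairs_ltu : forall t, t < Z -> PU t < 2 ^ k;
  pairs_ltv : forall t, t < Z -> PV t < 2 ^ k;
  pairs_bit : forall t c, t < Z -> bit c (PU t) || bit c (PV t) = (c < k) }.

Definition complete (k Z : nat) (PU PV : nat -> nat) : Prop :=
  forall U W, U < 2 ^ k -> W < 2 ^ k -> (forall c, bit c U || bit c W = (c < k)) ->
    exists2 t, t < Z & PU t = U /\ PV t = W.

Definition complete_canonical (k Z : nat) (PU PV : nat -> nat) : Prop :=
  forall i j, j <= i -> i <= k ->
    exists2 t, t < Z & PU t = 2 ^ i - 1 /\ PV t = two_blocks j i k.

Lemma all_pairs_spec h k Z : var h rZ = Z -> var h rD = k ->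
  arr h aPw k = 2 ^ k ->
  pairs_ok k Z (arr h aPu) (arr h aPv) -> complete k Z (arr h aPu) (arr h aPv) ->
  wp inp E all_pairs h (fun h1 t =>
    [/\ var h1 rZ = 3 * Z, pairs_ok k.+1 (3 * Z) (arr h1 aPu) (arr h1 aPv),
        complete k.+1 (3 * Z) (arr h1 aPu) (arr h1 aPv) & t <= Z * 8 + 2]).
Proof.
move=> hZ hD hpw [p1 p2 p3] pc; rewrite /all_pairs; wsteps.
apply: (wp_for (B := 7) (I := fun t h1 =>
  [/\ forall t', t' < t ->
        [/\ arr h1 aPu t' = arr h aPu t' + 2 ^ k, arr h1 aPu (t' + Z) = arr h aPu t'
          & arr h1 aPu (t' + Z + Z) = arr h aPu t' + 2 ^ k],
      forall t', t' < t ->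
        [/\ arr h1 aPv t' = arr h aPv t', arr h1 aPv (t' + Z) = arr h aPv t' + 2 ^ k
          & arr h1 aPv (t' + Z + Z) = arr h aPv t' + 2 ^ k]
    & forall t', t <= t' < Z -> arr h1 aPu t' = arr h aPu t' /\ arr h1 aPv t' = arr h aPv t'])).
- by split.
- move=> t g; rewrite [heval _ _ _ _]/= hZ => tZ [g1 g2 g3]; wsteps; rewrite hZ hD hpw.
  have [e1 e2] : arr g aPu t = arr h aPu t /\ arr g aPv t = arr h aPv t by apply: g3; rewrite leqnn.
  rewrite e1 e2; split=> //; split.
  + move=> t'; rewrite ltnS leq_eqVlt => /orP[/eqP->|lt].
      by split; rewrite !updE; do ?[case: eqP => //]; lia.
    by have [a b c] := g1 t' lt; split; rewrite !updE; do ?[case: eqP => //]; lia.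
  + move=> t'; rewrite ltnS leq_eqVlt => /orP[/eqP->|lt].
      by split; rewrite !updE; do ?[case: eqP => //]; lia.
    by have [a b c] := g2 t' lt; split; rewrite !updE; do ?[case: eqP => //]; lia.
  + move=> t' /andP[lt t'Z]; have [|a b] := g3 t'; first by rewrite t'Z ltnW.
    by split; rewrite !updE; do ?[case: eqP => //]; lia.
rewrite [heval _ _ _ _]/= hZ => g t [g1 g2 _] ht; rewrite /= in g1 g2; wsteps; rewrite hZ.
have -> : Z + Z + Z = 3 * Z by lia.
have P2 : 2 ^ k.+1 = 2 ^ k + 2 ^ k by rewrite expnS; lia.
have entry t' : t' < 3 * Z -> exists2 t0, t0 < Z & [\/
   arr g aPu t' = arr h aPu t0 + 2 ^ k /\ arr g aPv t' = arr h aPv t0,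
   arr g aPu t' = arr h aPu t0 /\ arr g aPv t' = arr h aPv t0 + 2 ^ k |
   arr g aPu t' = arr h aPu t0 + 2 ^ k /\ arr g aPv t' = arr h aPv t0 + 2 ^ k].
  move=> lt; case: (ltnP t' Z) => c1.
    by exists t' => //; have [a _ _] := g1 _ c1; have [b _ _] := g2 _ c1; constructor 1.
  case: (ltnP t' (Z + Z)) => c2.
    have tZ : t' - Z < Z by lia.
    exists (t' - Z) => //; have [_ a _] := g1 _ tZ; have [_ b _] := g2 _ tZ.
    by rewrite subnK // in a b; constructor 2.
  have tZ : t' - Z - Z < Z by lia.
  exists (t' - Z - Z) => //; have [_ _ a] := g1 _ tZ; have [_ _ b] := g2 _ tZ.
  by rewrite (_ : t' - Z - Z + Z + Z = t') in a b; [constructor 3|lia].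
split=> //; last by lia.
- split=> [t'|t'|t' c] /entry[t0 t0Z hh].
  + by have := p1 _ t0Z; case: hh => -[-> _]; rewrite P2; lia.
  + by have := p2 _ t0Z; case: hh => -[_ ->]; rewrite P2; lia.
  + have b := p3 _ c t0Z; have [l1 l2] := (p1 _ t0Z, p2 _ t0Z).
    by case: hh => -[-> ->]; rewrite ?bit_add_pow2 // ltnS leq_eqVlt -b;
      case: (bit _ _); case: (bit _ _); case: (_ == _).
- move=> U W hU hW hb; have [U' lU [EU bU]] := drop_top_bit hU.
  have [W' lW [EW bW]] := drop_top_bit hW.
  (* Without colour [k] the pair has union [[0, k)] and is listed; the bits at [k] select one of its
     three extensions. *)
  have [c|t0 t0Z [E1 E2]] := pc U' W' lU lW.
    case: (ltnP c k) => ck; first by rewrite bU // bW // hb ltnW.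
    by rewrite (bit_out lU ck) (bit_out lW ck).
  have [a1 a2 a3] := g1 _ t0Z; have [b1 b2 b3] := g2 _ t0Z.
  move: EU EW (hb k); rewrite ltnSn.
  move: (bit k U) (bit k W) => [] [] //= -> -> _; rewrite ?mul1n ?mul0n ?addn0.
  + by exists (t0 + Z + Z); [lia|rewrite a3 b3 E1 E2].
  + by exists t0; [lia|rewrite a1 b1 E1 E2].
  + by exists (t0 + Z); [lia|rewrite a2 b2 E1 E2].
Qed.

Lemma canonical_pairs_spec h k : var h rD = k ->
  (forall a, a <= k.+1 -> arr h aPw a = 2 ^ a) ->
  wp inp E canonical_pairs h (fun h1 t =>
    [/\ var h1 rZ <= k.+2 * k.+2, pairs_ok k.+1 (var h1 rZ) (arr h1 aPu) (arr h1 aPv),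
        complete_canonical k.+1 (var h1 rZ) (arr h1 aPu) (arr h1 aPv)
      & t <= k.+2 * (k.+2 * 4 + 2) + 2]).
Proof.
move=> hD hpw; rewrite /canonical_pairs; wsteps.
pose K := k.+1; pose J (done : nat -> nat -> bool) h1 :=
  (forall t, t < var h1 rZ -> exists i j, [/\ j <= i, i <= K,
      arr h1 aPu t = 2 ^ i - 1 & arr h1 aPv t = two_blocks j i K]) /\
  (forall i j, j <= i -> i <= K -> done i j -> exists2 t, t < var h1 rZ &
      arr h1 aPu t = 2 ^ i - 1 /\ arr h1 aPv t = two_blocks j i K).
apply: (wp_for (B := k.+2 * 4 + 1) (I := fun i h1 =>
   J (fun i' _ => i' < i) h1 /\ var h1 rZ <= i * k.+2)).
- by [].
- rewrite [heval _ _ _ _]/= hD addn2 => i g ik [[g1 g2] gZ].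
  apply: (wp_for (B := 3) (I := fun j h1 =>
    J (fun i' j' => (i' < i) || (i' == i) && (j' < j)) h1 /\ var h1 rZ <= i * k.+2 + j)) => /=.
  + rewrite addn0; split=> //; split=> // i' j'; rewrite ltn0 andbF orbF; exact: g2.
  + rewrite addn1 => j g' ji [[k1 k2] kZ]; wsteps; rewrite hD addn1 !hpw //; last by lia.
    rewrite /= in k1 k2; split=> //; rewrite /J /=; split; last by lia.
    split.
    * move=> t; rewrite addn1 ltnS leq_eqVlt => /orP[/eqP->|lt].
        by exists i, j; rewrite !upd_same; split=> //; lia.
      have [i' [j' [? ? ? ?]]] := k1 t lt; exists i', j'; rewrite !upd_other //; lia.
    * move=> i' j' ji' iK; rewrite addn1 => dn.
      case: (boolP ((i' == i) && (j' == j))) => [/andP[/eqP-> /eqP->]|ne].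
        by exists (var g' rZ); rewrite ?upd_same.
      have [|t tz [? ?]] := k2 i' j' ji' iK; first by move: dn ne; clear; lia.
      by exists t; [lia|rewrite !upd_other //; lia].
  + rewrite addn1 => g' t [[k1 k2] kZ] ht; rewrite /= in k1 k2; rewrite /J /=; split; last first.
      by move: ht ik; clear; nia.
    split; last by move: kZ ik; clear; nia.
    split=> // i' j' ji' iK lt; apply: k2 => //; lia.
- rewrite [heval _ _ _ _]/= hD addn2 => g t [[g1 g2] gZ] ht; rewrite /= in g1 g2 gZ; split=> //=; last by lia.
  + split=> [t'|t'|t' c] /g1[i [j [ji iK eu ev]]]; rewrite ?eu ?ev.
    * have := expn_gt0 2 i; have : 2 ^ i <= 2 ^ k.+1 by rewrite leq_exp2l.
      by clear; lia.
    * by apply: two_blocks_lt.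
    * by rewrite bit_ones bit_two_blocks //; move: ji iK; rewrite /K; clear; lia.
  + by move=> i j ji iK; apply: g2 => //; rewrite ltnS.
Qed.

End Pairs.

Lemma cost_leaf L t t1 t' : t <= L.+2 * (L.+2 * 5 + 10) + 10 -> t1 <= L * 2 + 6 ->
  t' <= L.-1 * 5 + 2 -> t + (t1 + t') <= 30 * L.+2 ^ 2.
Proof. by case: L => [|L] /=; rewrite -mulnn; lia. Qed.

Lemma cost_range L z t t' : 0 < z -> t <= L.-1 * 2 + 1 -> t' <= (z * (30 * L.+2 ^ 2).+1).+1 ->
  t + t' <= z * (40 * L.+2 ^ 2).
Proof.
move=> z0 h1 h2; have : L.-1 * 2 + 2 + (z * (30 * L.+2 ^ 2)) + z <= z * (40 * L.+2 ^ 2); last by lia.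
have h : L.-1 * 2 + 2 + 1 <= 10 * L.+2 ^ 2 by case: L {h1 h2} => [|L] /=; rewrite -mulnn; lia.
have : z * (L.-1 * 2 + 2 + 1) <= z * (10 * L.+2 ^ 2) by rewrite leq_mul2l h orbT.
move: (L.-1) (L.+2 ^ 2) z0 => a b; clear; nia.
Qed.

(** [L] counts the vertices of the new component other than [w], [R] bounds the search for one pair
    and one last set, and [Z] the number of pairs. The summands are the new weight, the ranges, the
    search and the two rounds of copying. *)
Definition step_cost (q L : nat) : nat :=
  let N := 2 ^ q - 1 in
  let R := N ^ L.-1 * (40 * L.+2 ^ 2) + 12 in
  let Z := if L == 0 then q.+1 * q.+1 else 3 ^ q in
  2 ^ q * 4 + L * (N * 2 + 6)
  + q * (8 * Z + q.+1 * (q.+1 * 4 + 2) + q.+1 * (q * (Z * R + 3) + 2) + 10)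
  + q * (N ^ L * (q * 6 + L * 8 + 18) + L * 2 + 4)
  + 2 ^ q * (N ^ L * (L * 8 + 10) + L * 2 + 5) + 50.

(** * One contraction: the search *)

Section Mark.
Variables (q n : nat) (e : rel 'I_n) (s : seq (name n * name n * name n))
  (x0 : name n) (m E : nat).
Hypotheses (q0 : 0 < q) (es : symmetric e) (ei : irreflexive e)
  (hs : contraction_sequence (trigraph_of_graph e) s)
  (hm : size s = m) (hE : 2 + (m * 3 + n * ((n + n) * (n + n))) <= E).

Let p0 := (x0, x0, x0).
Let inp := nth 0 (encode q e s).
Let H i := trigraph_at e s i.
Let u i := su s p0 i.
Let v i := sv s p0 i.
Let w i := sw s p0 i.

Variables (i : nat) (tl : seq (name n)) (id : name n -> nat).
Let pl := [:: u i, v i & tl].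
Let L := size tl.
Let N := 2 ^ q - 1.
Hypotheses (im : i < m) (upl : uniq pl)
  (mem_pl : pl =i merged_at e s x0 i)
  (id_lt : {in vertices (H i), forall x, id x < n + i})
  (id_inj : {in vertices (H i) &, injective id}).

Let hi : trigraph_inv e (H i) (part_at s i).
Proof. by apply: trigraph_inv_at => //; rewrite hm ltnW. Qed.

Let C' := red_component (H i.+1) (w i).
Let wt a := weight q x0 pl id a.

Let stepP : [/\ u i \in vertices (H i), v i \in vertices (H i),
  u i != v i & w i \notin vertices (H i)].
Proof. by apply: step_at; rewrite ?hm. Qed.

Let HS : H i.+1 = contract (H i) (u i, v i, w i).
Proof. by apply: trigraph_atS; rewrite hm. Qed.

Let wC : w i \in C'.
Proof. by apply: mem_red_component; rewrite HS in_setU1 eqxx. Qed.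

Let q2 : 0 < 2 ^ q. Proof. by rewrite expn_gt0. Qed.

Let N0 : 0 < N. Proof. by rewrite /N subn_gt0 -[1](expn0 2) ltn_exp2l. Qed.

Lemma rest_notin x : x \in C' :\ w i -> x \in vertices (H i) /\ x \notin [set u i; v i].
Proof. by rewrite /C' HS => /C'_rest; rewrite inE => /andP[]. Qed.

Lemma mem_tl : tl =i C' :\ w i.
Proof.
move=> x; have := mem_pl x; rewrite /merged_at /merged -/(H i) -/(u i) -/(v i) -/(w i) -HS.
rewrite in_setU in_set2 !in_cons orbA; case xuv: ((x == u i) || (x == v i)) => /=; last by [].
move=> _; transitivity false.
  apply/negbTE/negP=> xt; move: upl; rewrite /pl /= inE negb_or -!andbA => /and4P[_ h1 h2 _].
  by case/orP: xuv => /eqP E1; move: xt; rewrite E1; apply/negP.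
apply/esym/negbTE/negP=> /rest_notin[_].
by rewrite !inE xuv.
Qed.

Lemma uniq_tl : uniq tl. Proof. by move: upl; rewrite /pl /= => /and3P[]. Qed.

Lemma merged_eq : merged_at e s x0 i = [set u i; v i] :|: C' :\ w i.
Proof. by rewrite /merged_at /merged -/(H i) -/(u i) -/(v i) -/(w i) -HS. Qed.

Definition vertex_sets (S : nat) (X : nat -> nat) (y : name n) : nat :=
  if y == w i then S else X (index y pl).

Definition new_code (S : nat) (X : nat -> nat) : nat :=
  S * (2 ^ q) ^ (n + i) + \sum_(a < L) X a.+2 * wt a.+2.

Definition new_id (y : name n) : nat := if y == w i then n + i else id y.

Definition valid (X : nat -> nat) : Prop := forall a, a < L -> 0 < X a.+2 < 2 ^ q.

Definition colourable_with (S : nat) (X : nat -> nat) : Prop :=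
  realizable e q (part_at s i.+1) C' (vertex_sets S X).

Lemma tl_neq x : x \in tl -> [/\ x != w i, x \in vertices (H i), x != u i & x != v i].
Proof.
rewrite mem_tl => xC; have [xV xn] := rest_notin xC; move: xC xn.
by rewrite !inE negb_or => /andP[-> _] /andP[-> ->].
Qed.

Lemma index_tl x : x \in tl -> index x pl = (index x tl).+2.
Proof.
by move=> /tl_neq[_ _ xu xv]; rewrite /pl /= (eq_sym (u i)) (negbTE xu) (eq_sym (v i)) (negbTE xv).
Qed.

Lemma index_nth_tl a : a < L -> index (nth x0 tl a) pl = a.+2.
Proof. by move=> aL; rewrite index_tl ?mem_nth // index_uniq // uniq_tl. Qed.

Lemma new_codeE S X : new_code S X = code (2 ^ q) new_id C' (vertex_sets S X).
Proof.
rewrite /code (bigD1 (w i)) //= {1}/vertex_sets {1}/new_id !eqxx /new_code; congr (_ + _).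
transitivity (\sum_(y in C' :\ w i) vertex_sets S X y * (2 ^ q) ^ new_id y); last first.
  by apply: eq_bigl => y; rewrite in_setD1 andbC.
rewrite (slots_sum x0 _ uniq_tl); last by move=> y; rewrite mem_tl.
rewrite [RHS]big_mkcond /=; apply: eq_bigr => a _.
have at' : nth x0 tl a \in tl by apply: mem_nth.
rewrite -mem_tl at' /vertex_sets /new_id; have [/negbTE-> _ _ _] := tl_neq at'.
by rewrite index_nth_tl //.
Qed.

Lemma C'_cases y : y \in C' -> y = w i \/ exists2 a, a < L & y = nth x0 tl a.
Proof.
move=> yC; have [->|yw] := eqVneq y (w i); [by left|right].
have yt : y \in tl by rewrite mem_tl in_setD1 yw.
by exists (index y tl); rewrite ?index_mem // nth_index.
Qed.

Lemma vertex_sets_w S X : vertex_sets S X (w i) = S.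
Proof. by rewrite /vertex_sets eqxx. Qed.

Lemma vertex_sets_tl S X a : a < L -> vertex_sets S X (nth x0 tl a) = X a.+2.
Proof.
move=> aL; have at' : nth x0 tl a \in tl by apply: mem_nth.
by rewrite /vertex_sets; have [/negbTE-> _ _ _] := tl_neq at'; rewrite index_nth_tl.
Qed.

Lemma new_id_inj : {in C' &, injective new_id}.
Proof.
have ltw y : y \in C' -> y != w i -> id y < n + i.
  move=> yC yw; apply: id_lt; have : y \in C' :\ w i by rewrite in_setD1 yw.
  by case/rest_notin.
move=> y z yC zC; rewrite /new_id.
case: (eqVneq y (w i)) => [->|yw]; case: (eqVneq z (w i)) => [->//|zw].
- by move=> E1; have := ltw z zC zw; rewrite -E1 ltnn.
- by move=> E1; have := ltw y yC yw; rewrite E1 ltnn.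
- apply: id_inj.
    by have [] // := @rest_notin y _; rewrite in_setD1 yw.
  by have [] // := @rest_notin z _; rewrite in_setD1 zw.
Qed.

Lemma new_id_lt : {in C', forall y, new_id y < (n + i).+1}.
Proof.
move=> y yC; rewrite /new_id; case: eqP => // /eqP yw; apply/ltnW/id_lt.
by have [] // := @rest_notin y _; rewrite in_setD1 yw.
Qed.

Lemma vertex_sets_lt S X : S < 2 ^ q -> valid X -> {in C', forall y, vertex_sets S X y < 2 ^ q}.
Proof.
move=> Sq hX y /C'_cases[->|[a aL ->]]; first by rewrite vertex_sets_w.
by rewrite vertex_sets_tl //; have /andP[] := hX a aL.
Qed.

Lemma new_code_inj S S' X X' : S < 2 ^ q -> S' < 2 ^ q -> valid X -> valid X' ->
  new_code S X = new_code S' X' -> S = S' /\ forall a, a < L -> X a.+2 = X' a.+2.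
Proof.
move=> Sq Sq' hX hX'; rewrite !new_codeE => E1.
have := code_inj new_id_inj q2 (vertex_sets_lt Sq hX) (vertex_sets_lt Sq' hX') E1 => E2.
split; first by have := E2 _ wC; rewrite !vertex_sets_w.
move=> a aL; have := E2 (nth x0 tl a); rewrite !vertex_sets_tl //; apply.
by have := mem_nth x0 aL; rewrite mem_tl in_setD1 => /andP[].
Qed.

(** A nonempty set at the top position pushes the code past every old address, so writing never
    disturbs the old tables that the search is still reading. *)
Lemma new_code_ge S X : 0 < S -> (2 ^ q) ^ (n + i) <= new_code S X.
Proof. by move=> S0; rewrite /new_code; apply: leq_trans (leq_addr _ _); apply: leq_pmull. Qed.

Lemma new_code_lt S X : S < 2 ^ q -> valid X -> new_code S X < (2 ^ q) ^ (n + i.+1).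
Proof.
move=> Sq hX; rewrite new_codeE addnS.
by apply: code_lt new_id_lt q2 (vertex_sets_lt Sq hX); apply: new_id_inj.
Qed.

Lemma new_code_ext S X X' : (forall a, a < L -> X a.+2 = X' a.+2) ->
  new_code S X = new_code S X'.
Proof. by move=> XX; rewrite /new_code; congr (_ + _); apply: eq_bigr => a _; rewrite XX. Qed.

Lemma colourable_swap a S X : a.+1 < q -> colourable_with S X ->
  colourable_with (swap a S) (fun b => swap a (X b)).
Proof.
move=> aq /(realizable_swap aq); apply: realizable_ext => // y _.
by rewrite /vertex_sets; case: eqP.
Qed.

Lemma colourable_ext S X X' : (forall a, a < L -> X a.+2 = X' a.+2) ->
  colourable_with S X -> colourable_with S X'.
Proof.
move=> XX; apply: realizable_ext => // y /C'_cases[->|[a aL ->]].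
  by rewrite !vertex_sets_w.
by rewrite !vertex_sets_tl // XX.
Qed.

Definition with_pair (X : nat -> nat) (U W : nat) (a : nat) : nat :=
  if a is a'.+1 then (if a' is _.+1 then X a else W) else U.

Lemma leaf_ext X X' : (forall a, a < L.+2 -> X a = X' a) ->
  leaf_ok q e s x0 i pl X -> leaf_ok q e s x0 i pl X'.
Proof.
move=> XX; apply: realizable_ext => // y; rewrite -mem_pl => yp.
by rewrite /colour_sets XX //; rewrite -index_mem in yp.
Qed.

Lemma leaf_gt0 X a : leaf_ok q e s x0 i pl X -> a < L.+2 -> 0 < X a.
Proof.
move=> hX aL; have yp : nth x0 pl a \in merged_at e s x0 i by rewrite -mem_pl mem_nth.
have := realizable_gt0 hX yp; rewrite /colour_sets index_uniq //; apply.
apply: (part_neq0 hi); have [uV vV _ _] := stepP.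
by apply: subsetP yp; apply: merged_sub.
Qed.

(** This is [realizable_contract] in the coordinates of the search, with [U] and [W] at positions 0
    and 1. *)
Lemma colourable_split S X : colourable_with S X <->
  exists U W, [/\ U < 2 ^ q, W < 2 ^ q, forall t, t < q -> bit t S = bit t U || bit t W
    & leaf_ok q e s x0 i pl (with_pair X U W)].
Proof.
have [uV vV uv wV] := stepP.
have uC : u i \notin C' :\ w i by apply/negP=> /rest_notin[_]; rewrite !inE eqxx.
have vC : v i \notin C' :\ w i by apply/negP=> /rest_notin[_]; rewrite !inE eqxx orbT.
have wC' : w i \notin C' :\ w i by rewrite !inE eqxx.
have P1 : part_at s i.+1 = part_step (part_at s i) (u i, v i, w i).
  by apply: part_atS; rewrite hm.
have C1 : C' = w i |: C' :\ w i by rewrite setD1K.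
rewrite /colourable_with {1}C1 P1 (realizable_contract _ _ _ es uC vC wC' uv).
rewrite vertex_sets_w.
have same U W : {in [set u i; v i] :|: C' :\ w i,
    (fun x => if x == u i then U else if x == v i then W else vertex_sets S X x)
    =1 colour_sets pl (with_pair X U W)}.
  move=> x; rewrite in_setU => /orP[|xC].
    rewrite !inE /colour_sets /pl /= => /orP[]/eqP->; rewrite eqxx //.
    by rewrite eq_sym (negbTE uv).
  have xt : x \in tl by rewrite mem_tl.
  have [xw _ xu xv] := tl_neq xt; rewrite (negbTE xu) (negbTE xv) /vertex_sets (negbTE xw).
  by rewrite /colour_sets index_tl.
split=> -[U [W [h1 h2 h3 h4]]]; exists U, W; split=> //; rewrite /leaf_ok merged_eq in h4 *.
  by apply: realizable_ext h4 => //; apply: same.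
by apply: realizable_ext h4 => // x xC; rewrite -same.
Qed.

Variable T0 : nat -> nat.
Hypothesis hT0 : {in vertices (H i), forall x f,
    {in red_component (H i) x, forall y, 0 < f y < 2 ^ q} ->
    T0 (code (2 ^ q) id (red_component (H i) x) f) != 0 <->
    realizable e q (part_at s i) (red_component (H i) x) f}.

Definition extends (T T' : nat -> nat) : Prop := forall a, T a != 0 -> T' a != 0.

(** The first field keeps the tables being read intact, the second keeps the region of later
    contractions empty. *)
Record keeps_old (T : nat -> nat) : Prop := KeepsOld {
  keeps_lt : forall a, a < (2 ^ q) ^ (n + i) -> T a = T0 a;
  keeps_zero : forall a, (2 ^ q) ^ (n + i.+1) <= a -> T a = 0 }.

(** Soundness is separated from completeness: it holds throughout the step, whereas completeness
    grows with the entries treated. *)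
Record sound (T : nat -> nat) : Prop := Sound {
  sound_old : keeps_old T;
  sound_new : forall S X, 0 < S < 2 ^ q -> valid X ->
    T (new_code S X) != 0 -> colourable_with S X }.

Notation ctx h := (step_ctx q e s x0 m i pl id h).

Lemma ctx_sub2 h : ctx h -> var h rLen - 2 = L.
Proof. by move=> hh; rewrite (ctx_len hh) /pl /= subn2. Qed.

Lemma ctx_sub3 h : ctx h -> var h rLen - 3 = L.-1.
Proof. by move=> hh; rewrite (ctx_len hh) /pl /= /L; move: (size tl); clear; lia. Qed.

Lemma ctx_tab h : ctx h -> keeps_old (arr h aTab) ->
  {in vertices (H i), forall x f,
    {in red_component (H i) x, forall y, 0 < f y < 2 ^ q} ->
    arr h aTab (code (2 ^ q) id (red_component (H i) x) f) != 0 <->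
    realizable e q (part_at s i) (red_component (H i) x) f}.
Proof.
move=> hh hS x xV f hf; rewrite (keeps_lt hS) ?hT0 //.
have sub y : y \in red_component (H i) x -> y \in vertices (H i).
  by apply: (subsetP (red_component_sub _ _)).
apply: code_lt => //.
- by move=> y z /sub yV /sub zV; apply: id_inj.
- by move=> y /sub; apply: id_lt.
- by move=> y /hf/andP[].
Qed.

Lemma put_new_code T S X : 0 < S < 2 ^ q -> valid X -> colourable_with S X ->
  sound T -> sound (upd T (new_code S X) 1).
Proof.
move=> /andP[S0 Sq] hX hc [[k1 k2] k3]; split; first split.
- move=> a ha; rewrite upd_other ?k1 // => E1.
  by move: ha; rewrite E1 ltnNge new_code_ge.
- move=> a ha; rewrite upd_other ?k2 // => E1.
  by move: ha; rewrite E1 leqNgt new_code_lt.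
- move=> S' X' /andP[S0' Sq'] hX'; rewrite updE; case: (new_code S' X' =P _) => [E1 _|_]; last first.
    by apply: k3; rewrite ?S0'.
  have [-> XX] := new_code_inj Sq' Sq hX' hX E1.
  by apply: colourable_ext hc => a aL; rewrite XX.
Qed.

Lemma extends_upd T a : extends T (upd T a 1).
Proof. by move=> b; rewrite updE; case: (b =P a). Qed.

Lemma rest_code_spec h : ctx h -> var h rS < 2 ^ q -> valid (arr h aX) ->
  wp inp E rest_code h (fun h1 t =>
    var h1 rCd = new_code (var h rS) (arr h aX) /\ t <= L * 2 + 2).
Proof.
move=> hh hS hX; rewrite /rest_code; wsteps.
apply: (wp_for (B := 1) (I := fun k h1 => var h1 rCd =
  var h rS * (2 ^ q) ^ (n + i) + \sum_(a < k) arr h aX a.+2 * wt a.+2)) => /=.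
- by rewrite (ctx_w hh) (ctx_mulw hh) // big_ord0 addn0.
- move=> k g; rewrite (ctx_sub2 hh) => kL g1; wsteps; split=> //.
  have EP : arr h aP (i * (n + n) + k.+2) = nth x0 pl k.+2.
    by apply: (rec_p (ctx_record hh)); rewrite /= !ltnS.
  have /andP[_ Xq] := hX k kL.
  rewrite g1 (ctx_base hh) addn2 EP (ctx_mul hh) //.
  by rewrite big_ord_recr /= addnA.
- by rewrite (ctx_sub2 hh) => g t g1 ht; split=> //; lia.
Qed.

Let len := L.+2.

(** The odometer of the search covers positions 2 to [L]; position [L + 1] holds the last set, which
    the outer loops fix. *)
Definition same_frame (h h1 : store) : Prop :=
  [/\ arr h1 aX 0 = arr h aX 0, arr h1 aX 1 = arr h aX 1
    & forall a, L.-1.+2 <= a -> arr h1 aX a = arr h aX a].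

Lemma mark_leaf_spec h it : ctx h -> sound (arr h aTab) -> 0 < var h rS < 2 ^ q ->
  (forall t, t < q -> bit t (var h rS) = bit t (arr h aX 0) || bit t (arr h aX 1)) ->
  (forall a, a < len -> 0 < arr h aX a < 2 ^ q) ->
  digits_at N L.-1 it (arr h aX) ->
  wp inp E mark_leaf h (fun h1 t =>
    [/\ sound (arr h1 aTab), extends (arr h aTab) (arr h1 aTab),
        (leaf_ok q e s x0 i pl (arr h aX) ->
           arr h1 aTab (new_code (var h rS) (arr h aX)) != 0),
        digits_at N L.-1 it.+1 (arr h1 aX) /\ same_frame h h1
      & t <= 30 * len ^ 2]).
Proof.
move=> hh hS /andP[S0 Sq] hbit hX hdig; rewrite /mark_leaf.
have hv : valid (arr h aX) by move=> a aL; apply: hX; rewrite !ltnS.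
wcall (check_leaf_spec q0 es ei hs hm hE im) => //=; [exact: hh|exact: hX| |].
  exact: ctx_tab hh (sound_old hS).
move=> g t [g1 g2]; wsteps.
have tick_ok h1 t1 : step_ctx q e s x0 m i pl id h1 -> arr h1 aX = arr h aX ->
    sound (arr h1 aTab) -> extends (arr h aTab) (arr h1 aTab) ->
    (leaf_ok q e s x0 i pl (arr h aX) ->
       arr h1 aTab (new_code (var h rS) (arr h aX)) != 0) ->
    t1 <= L * 2 + 6 ->
    wp inp E (tick ($rLen - #3)%prog) h1 (fun h2 t2 =>
     [/\ sound (arr h2 12), extends (arr h 12) (arr h2 12),
         leaf_ok q e s x0 i pl (arr h 18) ->
         arr h2 12 (new_code (var h 38) (arr h 18)) != 0,
         digits_at N L.-1 it.+1 (arr h2 18) /\ same_frame h h2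
       & t + (t1 + t2) <= 30 * len ^ 2]).
  move=> hh1 EX hs1 he1 hl1 ht1.
  wcall (@tick_spec inp E N _ _ L.-1 it) => //=.
  - exact: tables_k (ctx_tables hh1).
  - exact: ctx_sub3 hh1.
  - by rewrite EX.
  rewrite EX => g' t' [d1 d2 d3 d4 d5]; split=> //.
  by apply: cost_leaf.
wif => c.
  have ok : leaf_ok q e s x0 i pl (arr h aX) by apply/g1.
  wcall rest_code_spec => //=; first exact: (step_ctx_frame _ _ hh).
  move=> g' t' [r1 r2]; wsteps.
  apply: tick_ok => //=.
  - exact: (step_ctx_frame _ _ hh).
  - rewrite r1; apply: put_new_code => //; first by rewrite S0.
    apply/colourable_split; exists (arr h aX 0), (arr h aX 1).
    have [/andP[_ h0] /andP[_ h1]] := (hX 0 isT, hX 1 isT).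
    split=> //; apply: leaf_ext ok => -[|[|a]] //.
  - by rewrite r1; apply: extends_upd.
  - by rewrite r1 upd_same.
  - by lia.
wsteps; apply: tick_ok => //=.
- exact: (step_ctx_frame _ _ hh).
- by move/g1; rewrite c.
- by rewrite ltn_addl.
Qed.

Lemma mark_range_spec h : ctx h -> sound (arr h aTab) -> 0 < var h rS < 2 ^ q ->
  var h rNQ = N ^ L.-1 ->
  (forall t, t < q -> bit t (var h rS) = bit t (arr h aX 0) || bit t (arr h aX 1)) ->
  0 < arr h aX 0 < 2 ^ q -> 0 < arr h aX 1 < 2 ^ q -> 0 < arr h aX L.+1 < 2 ^ q ->
  wp inp E mark_range h (fun h1 t =>
    [/\ sound (arr h1 aTab), extends (arr h aTab) (arr h1 aTab),
        (forall Y, valid Y -> Y 0 = arr h aX 0 -> Y 1 = arr h aX 1 ->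
           Y L.+1 = arr h aX L.+1 -> leaf_ok q e s x0 i pl Y ->
           arr h1 aTab (new_code (var h rS) Y) != 0)
      & t <= N ^ L.-1 * (40 * len ^ 2)]).
Proof.
move=> hh hS hSq hNQ hbit x0q x1q xlq; rewrite /mark_range.
wcall (@reset_spec inp E N _ _ L.-1) => //=; first exact: ctx_sub3 hh.
move=> g t [g1 g2 g3 g4 g5]; wsteps.
(* For [L = 0] the last position is 1, that of [W]; otherwise it lies just beyond the digits. *)
have gl : arr g aX L.+1 = arr h aX L.+1.
  by case: (posnP L) => [L0|L0]; [rewrite L0|apply: g4; rewrite prednK].
(* After [it] rounds, the families searched are those whose middle sets have rank below [it]. *)
apply: (wp_for (B := 30 * len ^ 2) (I := fun it h1 =>
  [/\ sound (arr h1 aTab), extends (arr h aTab) (arr h1 aTab),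
      digits_at N L.-1 it (arr h1 aX),
      [/\ arr h1 aX 0 = arr h aX 0, arr h1 aX 1 = arr h aX 1
        & arr h1 aX L.+1 = arr h aX L.+1] &
      (forall Y, valid Y -> Y 0 = arr h aX 0 -> Y 1 = arr h aX 1 ->
           Y L.+1 = arr h aX L.+1 -> leaf_ok q e s x0 i pl Y ->
           rank N L.-1 (fun a => Y a.+2) < it ->
           arr h1 aTab (new_code (var h rS) Y) != 0)])) => /=.
- by split.
- move=> it k; rewrite hNQ => hit [k1 k2 k3 [k4 k5 k6] k7].
  have XS a : a < L.+2 -> a != 0 -> a != 1 -> a != L.+1 ->
      arr k aX a = digit N it a.-2 /\ a.-2 < L.-1.
    case: a => [|[|a]] //= aL _ _ ne; have aL' : a < L.-1 by move: aL ne; clear; lia.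
    by rewrite k3.
  have Nq x : 0 < x <= N -> 0 < x < 2 ^ q by rewrite /N; move: q2; clear; lia.
  have hX a : a < len -> 0 < arr k aX a < 2 ^ q.
    move=> al; have [->|n0] := eqVneq a 0; first by rewrite k4.
    have [->|n1] := eqVneq a 1; first by rewrite k5.
    have [->|nL] := eqVneq a L.+1; first by rewrite k6.
    by have [-> _] := XS a al n0 n1 nL; apply: Nq; rewrite /digit /= ltn_mod.
  wcall (@mark_leaf_spec _ it) => //=.
  + exact: (step_ctx_frame _ _ hh).
  + by rewrite k4 k5.
  move=> l t' [l1 l2 l3 [l4 [l5 l6 l7]] l8]; rewrite /= in l5 l6 l7; split=> //; split=> //.
  + by move=> a /k2/l2.
  + split; [by rewrite l5|by rewrite l6|].
    rewrite -k6; case lt: (L.-1.+1 < L.+1); first exact: l7.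
    by rewrite (_ : L.+1 = 1) //; move: lt; clear; lia.
  + move=> Y hY Y0 Y1 Yl hl; rewrite ltnS leq_eqVlt => /orP[/eqP Er|lt]; last first.
      by apply/l2/k7.
    have YX a : a < L.+2 -> Y a = arr k aX a.
      move=> al; have [->|n0] := eqVneq a 0; first by rewrite k4.
      have [->|n1] := eqVneq a 1; first by rewrite k5.
      have [->|nL] := eqVneq a L.+1; first by rewrite k6.
      have [-> aL'] := XS a al n0 n1 nL.
      rewrite /digit -Er; case: a al n0 n1 nL aL' => [|[|a]] //= al _ _ nL aL'.
      rewrite -(@rank_digit N L.-1 (fun a => Y a.+2)) // => b bL.
      by have := hY b (leq_trans bL (leq_pred _)); rewrite /N; move: q2; clear; lia.
    rewrite (@new_code_ext _ _ (arr k aX)); last by move=> a aL; apply: YX.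
    by apply: l3; apply: leaf_ext hl => a aL; apply: YX.
- rewrite hNQ => k t' [k1 k2 k3 _ k7] ht; split=> //.
    move=> Y hY Y0 Y1 Yl hl; apply: k7 => //; apply: (@rank_lt _ L.-1) => // a aL.
    by have := hY a (leq_trans aL (leq_pred _)); rewrite /N; move: q2; clear; lia.
  have NL : 0 < N ^ L.-1 by rewrite expn_gt0 N0.
  by apply: cost_range.
Qed.

Lemma ctx_sub1 h : ctx h -> var h rLen - 1 = L.+1.
Proof. by move=> hh; rewrite (ctx_len hh) /pl /= subn1. Qed.

Lemma mark_nonempty_spec h : ctx h -> sound (arr h aTab) -> 0 < var h rS < 2 ^ q ->
  var h rNQ = N ^ L.-1 ->
  (forall t, t < q -> bit t (var h rS) = bit t (arr h aX 0) || bit t (arr h aX 1)) ->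
  arr h aX 0 < 2 ^ q -> arr h aX 1 < 2 ^ q -> arr h aX L.+1 < 2 ^ q ->
  wp inp E mark_nonempty h (fun h1 t =>
    [/\ sound (arr h1 aTab), extends (arr h aTab) (arr h1 aTab),
        (forall Y, valid Y -> Y 0 = arr h aX 0 -> Y 1 = arr h aX 1 ->
           Y L.+1 = arr h aX L.+1 -> leaf_ok q e s x0 i pl Y ->
           arr h1 aTab (new_code (var h rS) Y) != 0)
      & t <= N ^ L.-1 * (40 * len ^ 2) + 4]).
Proof.
move=> hh hS hSq hNQ hbit x0q x1q xlq; rewrite /mark_nonempty.
have pos Y a : leaf_ok q e s x0 i pl Y -> a < L.+2 -> Y a = arr h aX a -> arr h aX a != 0.
  by move=> hl aL <-; rewrite -lt0n; apply: leaf_gt0 hl aL.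
wif; rewrite -?lt0n => c0; last first.
  wsteps; split=> //; last by rewrite ltn_addl.
  by move=> Y _ Y0 _ _ hl; have := pos Y 0 hl isT Y0; rewrite c0.
wif; rewrite -?lt0n => c1; last first.
  wsteps; split=> //; last by rewrite ltn_addl.
  by move=> Y _ _ Y1 _ hl; have := pos Y 1 hl isT Y1; rewrite c1.
wif; rewrite (ctx_sub1 hh) -?lt0n => c2; last first.
  wsteps; split=> //; last by rewrite ltn_addl.
  by move=> Y _ _ _ Yl hl; have := pos Y L.+1 hl (ltnSn _) Yl; rewrite c2.
wcall mark_range_spec => //=; rewrite ?c0 ?c1 ?c2 //.
by move=> g t [g1 g2 g3 g4]; split=> //; rewrite addn4 !ltnS; apply: leq_trans g4 _; rewrite leqnSn.
Qed.

Lemma mark_pairs_spec h k : ctx h -> sound (arr h aTab) -> k <= q ->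
  0 < var h rS < 2 ^ q -> (forall t, t < q -> bit t (var h rS) = (t < k)) ->
  var h rNQ = N ^ L.-1 -> var h rVal < 2 ^ q ->
  pairs_ok k (var h rZ) (arr h aPu) (arr h aPv) ->
  wp inp E mark_pairs h (fun h1 t =>
    [/\ sound (arr h1 aTab), extends (arr h aTab) (arr h1 aTab),
        (forall Y t, t < var h rZ -> valid Y -> Y 0 = arr h aPu t -> Y 1 = arr h aPv t ->
           (0 < L -> Y L.+1 = var h rVal) -> leaf_ok q e s x0 i pl Y ->
           arr h1 aTab (new_code (var h rS) Y) != 0)
      & t <= (var h rZ * (N ^ L.-1 * (40 * len ^ 2) + 12)).+1]).
Proof.
move=> hh hS kq hSq hbit hNQ hV [p1 p2 p3]; rewrite /mark_pairs.
have kq2 : 2 ^ k <= 2 ^ q by rewrite leq_exp2l.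
apply: (wp_for (B := N ^ L.-1 * (40 * len ^ 2) + 11) (I := fun t h1 =>
  [/\ sound (arr h1 aTab), extends (arr h aTab) (arr h1 aTab) &
      forall Y t', t' < t -> valid Y -> Y 0 = arr h aPu t' -> Y 1 = arr h aPv t' ->
         (0 < L -> Y L.+1 = var h rVal) -> leaf_ok q e s x0 i pl Y ->
         arr h1 aTab (new_code (var h rS) Y) != 0])).
- by split.
- rewrite [heval _ _ _ _]/= => t g tZ [g1 g2 g3]; rewrite /= in g1 g2 g3; wsteps.
  have [u1 v1] : arr h aPu t < 2 ^ q /\ arr h aPv t < 2 ^ q.
    by split; [apply: leq_trans (p1 t tZ) _|apply: leq_trans (p2 t tZ) _].
  have tail h2 t2 : ctx h2 -> t2 <= 2 -> arr h2 aTab = arr g aTab ->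
      var h2 rS = var h rS -> var h2 rNQ = var h rNQ ->
      arr h2 aX 0 = arr h aPu t -> arr h2 aX 1 = arr h aPv t ->
      arr h2 aX L.+1 = (if L == 0 then arr h aPv t else var h rVal) ->
    wp inp E mark_nonempty h2 (fun h0 t0 =>
      [/\ sound (arr h0 12), extends (arr h 12) (arr h0 12)
        & forall Y t', t' < t.+1 -> valid Y -> Y 0 = arr h 20 t' ->
          Y 1 = arr h 21 t' -> (0 < L -> Y L.+1 = var h 18) ->
          leaf_ok q e s x0 i pl Y -> arr h0 12 (new_code (var h 38) Y) != 0] /\
      1 + (1 + (t2 + t0)) <= N ^ L.-1 * (40 * len ^ 2) + 11).
    move=> hh2 ht2 ET ES EQ X0 X1 XL.
    wcall mark_nonempty_spec => //=.
    - by rewrite ET.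
    - by rewrite ES.
    - by rewrite EQ.
    - by move=> c cq; rewrite ES X0 X1 p3 // hbit.
    - by rewrite X0.
    - by rewrite X1.
    - by rewrite XL; case: ifP.
    rewrite ET ES X0 X1 XL => l t' [l1 l2 l3 l4]; split; last first.
      by move: l4 ht2; move: (_ * _) => z; clear; lia.
    split=> // [a /g2/l2 //|Y t'']; rewrite ltnS leq_eqVlt => /orP[/eqP->|lt] hY Y0 Y1 YL hl.
      apply: l3 => //; case: (posnP L) => [L0|L0]; last by rewrite YL.
      by rewrite L0.
    by apply/l2/(g3 Y t'').
  wif; rewrite (ctx_sub2 hh) => c; wsteps.
    have L0 : 0 < L by rewrite lt0n.
    have -> : (var h rLen - 1) = L.+1 by apply: ctx_sub1 hh.
    apply: tail => //=; first exact: (step_ctx_frame _ _ hh).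
    - by rewrite upd_other ?upd_same //; move: L0; clear; case: L.
    - by rewrite upd_same (negbTE c).
  apply: tail => //=; first exact: (step_ctx_frame _ _ hh).
  by rewrite c upd_same.
- rewrite [heval _ _ _ _]/= => g t [g1 g2 g3] ht; rewrite /= in g1 g2 g3; split=> //.
  by rewrite addnS.
Qed.

Let R := N ^ L.-1 * (40 * len ^ 2) + 12.

(** [P] tells which ends [(a, l)] of the last set the two nested loops have already treated. *)
Definition marked k Z PU PV S (P : nat -> nat -> bool) (T : nat -> nat) : Prop :=
  forall Y t a l, t < Z -> a <= k -> k <= l <= q -> P a l ->
    valid Y -> Y 0 = PU t -> Y 1 = PV t -> (0 < L -> Y L.+1 = two_blocks a k l) ->
    leaf_ok q e s x0 i pl Y -> T (new_code S Y) != 0.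

Lemma mark_last_spec h k Z : ctx h -> sound (arr h aTab) -> k < q -> var h rD = k ->
  var h rS = 2 ^ k.+1 - 1 -> var h rNQ = N ^ L.-1 -> var h rZ = Z ->
  pairs_ok k.+1 Z (arr h aPu) (arr h aPv) ->
  wp inp E mark_last h (fun h1 t =>
    [/\ sound (arr h1 aTab), extends (arr h aTab) (arr h1 aTab),
        marked k.+1 Z (arr h aPu) (arr h aPv) (2 ^ k.+1 - 1) (fun _ _ => true) (arr h1 aTab)
      & t <= (q.+1 * (q * (Z * R + 3) + 2)).+1]).
Proof.
move=> hh hS kq hD hRS hNQ hZ hp; rewrite /mark_last.
pose mk P h1 := [/\ sound (arr h1 aTab), extends (arr h aTab) (arr h1 aTab)
  & marked k.+1 Z (arr h aPu) (arr h aPv) (2 ^ k.+1 - 1) P (arr h1 aTab)].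
have hpw := tables_pw (ctx_tables hh).
have S0 : 0 < 2 ^ k.+1 - 1 < 2 ^ q.
  have : 2 ^ 1 <= 2 ^ k.+1 by rewrite leq_exp2l.
  have : 2 ^ k.+1 <= 2 ^ q by rewrite leq_exp2l.
  by clear; lia.
apply: (wp_for (B := q * (Z * R + 3) + 1) (I := fun a => mk (fun a' _ => a' < a))).
- by split=> //.
- rewrite [heval _ _ _ _]/= hD addn2 => a g ak hg; rewrite /mk /= in hg.
  apply: (wp_for (B := Z * R + 2) (I := fun j =>
    mk (fun a' l => (a' < a) || (a' == a) && (l < k.+1 + j)))).
  + rewrite /mk /=; case: hg => g1 g2 g3; split=> // Y t a' l tZ ak' kl hP; apply: (g3 Y t a' l) => //.
    by move: hP kl; clear; lia.
  + rewrite [heval _ _ _ _]/= (setup_q (ctx_setup hh)) hD => j g' jq [k1 k2 k3].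
    rewrite /= in k1 k2 k3; wsteps.
    wcall (@mark_pairs_spec _ k.+1) => //=.
    * exact: (step_ctx_frame _ _ hh).
    * by rewrite hRS.
    * by move=> c cq; rewrite hRS bit_ones.
    * rewrite hD addn1 !hpw; [|lia|lia|lia].
      by apply: (@two_blocks_lt a k.+1 (k.+1 + j)); lia.
    * by rewrite hZ.
    rewrite hRS hZ hD addn1 !hpw; [|lia|lia|lia].
    move=> g'' t [l1 l2 l3 l4]; split; last by rewrite add1n addn2 ltnS.
    split=> //=; first by move=> b /k2/l2.
    move=> Y t' a' l tZ ak' /andP[kl lq] hP hY Y0 Y1 YL hl.
    case: (boolP ((a' == a) && (l == k.+1 + j))) => [/andP[/eqP Ea /eqP El]|ne].
      by apply: (l3 Y t') => // L0; rewrite YL // Ea El.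
    apply/l2/(k3 Y t' a' l) => //; first by rewrite kl.
    by move: hP ne; clear; lia.
  + rewrite [heval _ _ _ _]/= (setup_q (ctx_setup hh)) hD => g' t [k1 k2 k3] ht.
    rewrite /= in k1 k2 k3; split; last first.
      have : (q - k) * (Z * R + 2).+1 <= q * (Z * R + 3).
        by rewrite -addnS; apply: leq_mul => //; apply: leq_subr.
      by move: ht; move: (_ * _) (_ * _) => z1 z2; clear; lia.
    split=> //= Y t' a' l tZ ak' kl hP; apply: (k3 Y t' a' l) => //; move: hP kl kq; clear; lia.
- rewrite [heval _ _ _ _]/= hD addn2 => g t [g1 g2 g3] ht; rewrite /= in g1 g2 g3; split=> //.
    by move=> Y t' a l tZ ak kl _; apply: (g3 Y t' a l) => //; rewrite ltnS.
  by apply: leq_trans ht _; rewrite ltnS -addnS; apply: leq_mul.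
Qed.

Definition all_marked (K : nat) (T : nat -> nat) : Prop :=
  forall k X a l, k < K -> a <= k.+1 -> k.+1 <= l <= q -> valid X ->
    (0 < L -> X L.+1 = two_blocks a k.+1 l) -> colourable_with (2 ^ k.+1 - 1) X ->
    T (new_code (2 ^ k.+1 - 1) X) != 0.

Lemma leaf_swap a X : a.+1 < q -> leaf_ok q e s x0 i pl X ->
  leaf_ok q e s x0 i pl (fun b => swap a (X b)).
Proof. by move=> aq /(realizable_swap aq). Qed.

(** With another vertex present the list holds all pairs, so any split is found. With [w] alone no
    last set has to be kept canonical, and [canonical_pair] moves the split to a listed one. *)
Lemma marked_complete k Z PU PV T : k < q -> pairs_ok k.+1 Z PU PV ->
  (0 < L -> complete k.+1 Z PU PV) -> (L = 0 -> complete_canonical k.+1 Z PU PV) ->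
  marked k.+1 Z PU PV (2 ^ k.+1 - 1) (fun _ _ => true) T ->
  forall X a l, a <= k.+1 -> k.+1 <= l <= q -> valid X ->
    (0 < L -> X L.+1 = two_blocks a k.+1 l) -> colourable_with (2 ^ k.+1 - 1) X ->
    T (new_code (2 ^ k.+1 - 1) X) != 0.
Proof.
move=> kq hp c1 c2 hm' X a l ak kl hX XL /colourable_split[U [W [hU hW hb hl]]].
have bits c : bit c U || bit c W = (c < k.+1).
  case: (ltnP c q) => cq; first by rewrite -hb // bit_ones.
  by rewrite (bit_out hU cq) (bit_out hW cq) ltnNge (leq_trans kq cq).
have conclude U' W' : (exists2 t, t < Z & PU t = U' /\ PV t = W') ->
    leaf_ok q e s x0 i pl (with_pair X U' W') -> T (new_code (2 ^ k.+1 - 1) X) != 0.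
  case=> t tZ [EU EV] hl'; rewrite (@new_code_ext _ _ (with_pair X U' W')) //.
  apply: (hm' _ t a l) => //= L0; rewrite -XL //.
  by rewrite /with_pair; move: L0; case: L.
case: (posnP L) => L0.
  pose Q U' W' := leaf_ok q e s x0 i pl (with_pair X U' W').
  have Qs a' U' W' : a'.+1 < q -> Q U' W' -> Q (swap a' U') (swap a' W').
    by move=> aq /(leaf_swap aq); apply: leaf_ext => -[|[|b]] //; rewrite L0.
  have [i' [j [ji ik hl']]] := canonical_pair kq Qs hU hW bits hl.
  apply: conclude hl'; exact: c2.
apply: conclude hl; apply: c1 => //.
  by apply: low_bits_lt => c kc; have := bits c; rewrite ltnNge kc /=; case: (bit c U).
by apply: low_bits_lt => c kc; have := bits c; rewrite ltnNge kc /=; case: (bit c W); rewrite ?orbT.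
Qed.

Let Zm := if L == 0 then q.+1 * q.+1 else 3 ^ q.

(** For [L > 0] the list of pairs for [k + 1] grows out of that for [k] and belongs to the
    invariant; for [L = 0] it is made afresh each time. *)
Lemma mark_spec h : ctx h -> sound (arr h aTab) -> var h rNQ = N ^ L.-1 ->
  wp inp E mark h (fun h1 t =>
    [/\ sound (arr h1 aTab), all_marked q (arr h1 aTab)
      & t <= q * (8 * Zm + q.+1 * (q.+1 * 4 + 2) + q.+1 * (q * (Zm * R + 3) + 2) + 10) + 10]).
Proof.
move=> hh hS hNQ; rewrite /mark; wsteps.
have hpw := tables_pw (ctx_tables hh).
apply: (wp_for (B := 8 * Zm + q.+1 * (q.+1 * 4 + 2) + q.+1 * (q * (Zm * R + 3) + 2) + 9)
  (I := fun k h1 => [/\ sound (arr h1 aTab), all_marked k (arr h1 aTab)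
   & 0 < L -> [/\ var h1 rZ = 3 ^ k, pairs_ok k (3 ^ k) (arr h1 aPu) (arr h1 aPv)
     & complete k (3 ^ k) (arr h1 aPu) (arr h1 aPv)]])).
- split=> //= _; split=> //=.
    split=> [t|t|t c]; case: t => // _ //=; rewrite ?upd_same //.
    by rewrite bit0n.
  move=> U W; rewrite expn0 !ltnS !leqn0 => /eqP-> /eqP-> _.
  by exists 0 => //; rewrite !upd_same.
- rewrite [heval _ _ _ _]/= (setup_q (ctx_setup hh)) => k g kq [g1 g2 g3].
  rewrite /= in g1 g2 g3; wsteps.
  have tail h2 t2 Z : ctx h2 -> arr h2 aTab = arr g aTab -> var h2 rD = k ->
      var h2 rS = 2 ^ k.+1 - 1 -> var h2 rNQ = N ^ L.-1 -> var h2 rZ = Z -> Z <= Zm ->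
      pairs_ok k.+1 Z (arr h2 aPu) (arr h2 aPv) ->
      (0 < L -> Z = 3 ^ k.+1 /\ complete k.+1 Z (arr h2 aPu) (arr h2 aPv)) ->
      (L = 0 -> complete_canonical k.+1 Z (arr h2 aPu) (arr h2 aPv)) ->
      t2 <= 8 * Zm + q.+1 * (q.+1 * 4 + 2) + 5 ->
    wp inp E mark_last h2 (fun h0 t0 =>
      [/\ sound (arr h0 12), all_marked k.+1 (arr h0 12)
        & 0 < L -> [/\ var h0 39 = 3 ^ k.+1, pairs_ok k.+1 (3 ^ k.+1) (arr h0 20) (arr h0 21)
        & complete k.+1 (3 ^ k.+1) (arr h0 20) (arr h0 21)]] /\
      1 + (t2 + t0) <= 8 * Zm + q.+1 * (q.+1 * 4 + 2) + q.+1 * (q * (Zm * R + 3) + 2) + 9).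
    move=> hh2 ET ED ES EQ EZ Zle p c1 c2 ht2.
    wcall (@mark_last_spec _ k Z) => //=; first by rewrite ET.
    rewrite ET EZ => l t [l1 l2 l3 l4]; split; last first.
      have : q.+1 * (q * (Z * R + 3) + 2) <= q.+1 * (q * (Zm * R + 3) + 2).
        by rewrite leq_mul2l leq_add2r leq_mul2l leq_add2r leq_mul2r Zle !orbT.
      have aux a b b' c : b <= b' -> t <= b.+1 -> t2 <= a + c + 5 ->
        1 + (t2 + t) <= a + c + b' + 9 by clear; lia.
      by move/aux; apply.
    split=> //; last by move=> L0; have [<- c] := c1 L0.
    have hc := marked_complete kq p (fun L0 => (c1 L0).2) c2 l3.
    move=> k' X a l'; rewrite ltnS leq_eqVlt => /orP[/eqP->|lt]; first exact: hc.
    by move=> ak kl hX XL hc'; apply/l2/(g2 k' X a l').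
  wif; rewrite (ctx_sub2 hh) => c.
    have L0 : 0 < L by rewrite lt0n.
    have [Z3 p3 c3] := g3 L0.
    wcall (@all_pairs_spec _ _ _ k (3 ^ k)) => //=; first by rewrite hpw // ltnW.
    rewrite -expnS => l t [l1 l2 l3 l4].
    apply: (tail _ _ (3 ^ k.+1)) => //=.
    - exact: (step_ctx_frame _ _ hh).
    - by rewrite addn1 hpw.
    - by rewrite /Zm (negbTE c) leq_exp2l.
    - by move=> L1; rewrite L1 in c.
    - have : 3 ^ k <= Zm by rewrite /Zm (negbTE c) leq_exp2l // ltnW.
      by move: l4; move: (q.+1 * _) => z; clear; lia.
  wcall (@canonical_pairs_spec _ _ _ k) => //=; first by move=> a ak; apply: hpw; apply: leq_trans kq.
  move=> l t [l1 l2 l3 l4].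
  apply: (tail _ _ (var l rZ)) => //=.
  - exact: (step_ctx_frame _ _ hh).
  - by rewrite addn1 hpw.
  - by rewrite /Zm c eqxx; apply: leq_trans l1 _; apply: leq_mul.
  - by move=> L1; rewrite c in L1.
  - have : k.+2 * (k.+2 * 4 + 2) <= q.+1 * (q.+1 * 4 + 2).
      by apply: leq_mul => //; rewrite leq_add2r leq_mul2r ltnS kq orbT.
    by move: l4; move: (_ * _) (_ * _) => z1 z2; clear; lia.
- rewrite [heval _ _ _ _]/= (setup_q (ctx_setup hh)) => g t [g1 g2 _] ht; split=> //=.
  by move: ht; rewrite -addnS; move: (q * _) => z; clear; lia.
Qed.

(** * One contraction: copying along transpositions *)

Definition complete_for (P : nat -> (nat -> nat) -> Prop) (T : nat -> nat) : Prop :=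
  forall S X, 0 < S < 2 ^ q -> valid X -> P S X -> colourable_with S X ->
    T (new_code S X) != 0.

Let swapped a (X : nat -> nat) b := swap a (X b).

Lemma valid_swap a X : a.+1 < q -> valid X -> valid (swapped a X).
Proof. by move=> aq hX b bL; have /andP[h1 h2] := hX b bL; rewrite swap_gt0 h1 swap_lt. Qed.

(** A transposition is an involution: if the source is realizable, swapping back shows that the
    target is. *)
Lemma copy_sound T S X a : a.+1 < q -> 0 < S < 2 ^ q -> valid X -> sound T ->
  sound (upd T (new_code S X) (T (new_code (swap a S) (swapped a X)))).
Proof.
move=> aq /andP[S0 Sq] hX [[k1 k2] k3]; split; first split.
- move=> b hb; rewrite upd_other ?k1 // => E1.
  by move: hb; rewrite E1 ltnNge new_code_ge.
- move=> b hb; rewrite upd_other ?k2 // => E1.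
  by move: hb; rewrite E1 leqNgt new_code_lt.
- move=> S' X' /andP[S0' Sq'] hX'; rewrite updE; case: (new_code S' X' =P _) => [E1|_]; last first.
    by apply: k3; rewrite ?S0'.
  have [-> XX] := new_code_inj Sq' Sq hX' hX E1.
  move/k3; rewrite swap_gt0 S0 swap_lt // => /(_ isT (valid_swap aq hX)).
  move/(colourable_swap aq); rewrite swapK; apply: colourable_ext => b bL.
  by rewrite /swapped swapK XX.
Qed.

(** [P] describes the entries treated before and [P'] those treated after: at most the written entry
    is added, and its source satisfies [P]. *)
Lemma copy_complete P (P' : nat -> (nat -> nat) -> Prop) T S X a :
  a.+1 < q -> 0 < S < 2 ^ q -> valid X -> complete_for P T ->
  P (swap a S) (swapped a X) ->
  (forall S' X', valid X' -> P' S' X' -> P S' X' \/ (S' = S /\ forall b, b < L -> X' b.+2 = X b.+2)) ->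
  complete_for P' (upd T (new_code S X) (T (new_code (swap a S) (swapped a X)))).
Proof.
move=> aq /andP[S0 Sq] hX hP hPs hP' S' X' hS' hX' /(hP' _ _ hX') hp hc.
have source : colourable_with S X -> T (new_code (swap a S) (swapped a X)) != 0.
  move=> hc'; apply: hP => //; [by rewrite swap_gt0 S0 swap_lt|exact: valid_swap|].
  exact: colourable_swap.
rewrite updE; case: (new_code S' X' =P _) => [E1|ne].
  have [ES XX] := new_code_inj (proj2 (andP hS')) Sq hX' hX E1.
  by apply: source; rewrite -ES; apply: colourable_ext hc => b bL; rewrite XX.
case: hp => [hp|[ES XX]]; first exact: hP.
by case: ne; rewrite ES; apply: new_code_ext.
Qed.

Lemma copy_spec h a : ctx h -> a.+1 < q -> var h rRow = a * 2 ^ q + 1 ->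
  var h rS < 2 ^ q -> valid (arr h aX) ->
  wp inp E copy h (fun h1 t =>
    arr h1 aTab = upd (arr h aTab) (new_code (var h rS) (arr h aX))
      (arr h aTab (new_code (swap a (var h rS)) (swapped a (arr h aX)))) /\
    t <= L * 3 + 6).
Proof.
move=> hh aq hR hS hX; rewrite /copy; wsteps.
have hsw X : X < 2 ^ q -> arr h aSw (a * 2 ^ q + 1 - 1 + X) = swap a X.
  by rewrite addnK; apply: (tables_sw (ctx_tables hh)).
apply: (wp_for (B := 2) (I := fun k h1 =>
  var h1 rCd = var h rS * (2 ^ q) ^ (n + i) + \sum_(b < k) arr h aX b.+2 * wt b.+2 /\
  var h1 rCe = swap a (var h rS) * (2 ^ q) ^ (n + i) +
    \sum_(b < k) swapped a (arr h aX) b.+2 * wt b.+2)) => /=.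
- by rewrite hR hsw // (ctx_w hh) !(ctx_mulw hh) ?swap_lt // !big_ord0 !addn0.
- move=> k g; rewrite (ctx_sub2 hh) => kL [g1 g2]; wsteps; split=> //.
  have EP : arr h aP (i * (n + n) + k.+2) = nth x0 pl k.+2.
    by apply: (rec_p (ctx_record hh)); rewrite /= !ltnS.
  have /andP[_ Xq] := hX k kL.
  rewrite g1 g2 hR (ctx_base hh) addn2 EP hsw // !(ctx_mul hh) ?swap_lt //.
  by rewrite !big_ord_recr /= !addnA.
- rewrite (ctx_sub2 hh) => g t [g1 g2] ht; wsteps; rewrite g1 g2; split=> //; lia.
Qed.

Lemma find_row_spec h : ctx h -> var h rS < 2 ^ q -> arr h aX L.+1 < 2 ^ q ->
  wp inp E find_row h (fun h1 t =>
    (if var h1 rRow == 0 then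
       forall a, a.+1 < q -> swap a (var h rS) = var h rS ->
         arr h aX L.+1 <= swap a (arr h aX L.+1)
     else exists a, [/\ a.+1 < q, var h1 rRow = a * 2 ^ q + 1,
         swap a (var h rS) = var h rS & swap a (arr h aX L.+1) < arr h aX L.+1]) /\
    t <= q * 6 + 4).
Proof.
move=> hh hS hX; rewrite /find_row; wsteps.
have hsw a X : a.+1 < q -> X < 2 ^ q -> arr h aSw (a * 2 ^ q + X) = swap a X.
  by apply: (tables_sw (ctx_tables hh)).
have hP2 := tables_p2 (ctx_tables hh).
apply: (wp_for (B := 5) (I := fun k h1 => [/\ var h1 rE = k * 2 ^ q
  & if var h1 rRow == 0 then
       forall a, a < k -> swap a (var h rS) = var h rS ->
         arr h aX L.+1 <= swap a (arr h aX L.+1)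
     else exists a, [/\ a.+1 < q, var h1 rRow = a * 2 ^ q + 1,
         swap a (var h rS) = var h rS & swap a (arr h aX L.+1) < arr h aX L.+1]])) => /=.
- by split.
- move=> k g; rewrite (setup_q (ctx_setup hh)) => kq [g1 g2]; wsteps.
  have kq' : k.+1 < q by move: kq; clear; lia.
  have keep : (swap k (var h rS) = var h rS -> arr h aX L.+1 <= swap k (arr h aX L.+1)) ->
    if var g 16 == 0 then forall a, a < k.+1 -> swap a (var h rS) = var h rS ->
         arr h aX L.+1 <= swap a (arr h aX L.+1)
     else exists a, [/\ a.+1 < q, var g 16 = a * 2 ^ q + 1,
         swap a (var h rS) = var h rS & swap a (arr h aX L.+1) < arr h aX L.+1].
    move=> hk; case: ifP g2 => // _ g2 a; rewrite ltnS leq_eqVlt => /orP[/eqP->//|].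
    exact: g2.
  wif; rewrite g1 hsw // => c1; wsteps.
    split=> //; split; first by rewrite g1 hP2 mulSn addnC.
    by apply: keep => /(dist_neq0 c1).
  wif; rewrite (ctx_sub1 hh) g1 hsw // => c2; wsteps.
    split=> //; split; first by rewrite g1 hP2 mulSn addnC.
    rewrite g1 addn1 /=; exists k; rewrite addn1; split=> //; first exact: dist_eq0 c1.
    by rewrite -subn_gt0 lt0n.
  split=> //; split; first by rewrite g1 hP2 mulSn addnC.
  by apply: keep => _; rewrite -subn_eq0 c2.
- rewrite (setup_q (ctx_setup hh)) => g t [g1 g2] ht; split; last by lia.
  case: ifP g2 => // _ g2 a aq; apply: g2; move: aq; clear; lia.
Qed.

Lemma digits_range X it : digits_at N L it X -> forall a, a < L -> 0 < X a.+2 <= N.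
Proof. by move=> hX a aL; rewrite hX // /digit /= ltn_mod. Qed.

Lemma digits_valid X it : digits_at N L it X -> valid X.
Proof.
move=> hX a aL; have /andP[-> le] := digits_range hX aL; apply: leq_ltn_trans le _.
by rewrite /N; move: q2; clear; lia.
Qed.

Lemma valid_range X : valid X -> forall a, a < L -> 0 < X a.+2 <= N.
Proof. by move=> hX a aL; have := hX a aL; rewrite /N; move: q2; clear; lia. Qed.

Let rk (X : nat -> nat) := rank N L (fun a => X a.+2).

Lemma rk_digits X it : it < N ^ L -> digits_at N L it X -> rk X = it.
Proof.
move=> hit hX; rewrite -[RHS](@rank_digits N L it N0 hit); apply: rank_eq => a aL.
by rewrite hX.
Qed.

Lemma rk_eq X Y it : digits_at N L it X -> valid Y -> rk Y = it ->
  forall a, a < L -> Y a.+2 = X a.+2.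
Proof.
move=> hX hY Er a aL; rewrite hX // /digit -Er.
by rewrite -(rank_digit N0 (valid_range hY) aL).
Qed.

(* A set of colours that no adjacent transposition fixing [2 ^ k - 1] lowers. *)
Definition canonical_last k (X : nat -> nat) : Prop :=
  exists a l, [/\ a <= k, k <= l <= q & X L.+1 = two_blocks a k l].

(** At stage [k] the entries with a smaller initial segment are complete, those with a canonical
    last set were settled by the search, and [Q] measures the progress within the current
    segment. *)
Definition initial_done k (Q : nat -> (nat -> nat) -> Prop) S X : Prop :=
  exists k', [/\ k' < q, S = 2 ^ k'.+1 - 1
    & [\/ k' < k, canonical_last k'.+1 X | k' = k /\ Q k X]].

Lemma ones_lt k : k < q -> 0 < 2 ^ k.+1 - 1 < 2 ^ q.
Proof.
move=> kq; have : 2 ^ 1 <= 2 ^ k.+1 by rewrite leq_exp2l.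
have : 2 ^ k.+1 <= 2 ^ q by rewrite leq_exp2l.
by clear; lia.
Qed.

Lemma fill_initial_range_spec h k : ctx h -> 0 < L -> k < q -> sound (arr h aTab) ->
  var h rNP = N ^ L -> var h rS = 2 ^ k.+1 - 1 -> digits_at N L 0 (arr h aX) ->
  complete_for (initial_done k (fun _ _ => False)) (arr h aTab) ->
  wp inp E fill_initial_range h (fun h1 t =>
    [/\ sound (arr h1 aTab),
        complete_for (initial_done k.+1 (fun _ _ => False)) (arr h1 aTab)
      & t <= (N ^ L * (q * 6 + L * 8 + 18)).+1]).
Proof.
move=> hh L0 kq hS hNP hRS hX hc; rewrite /fill_initial_range.
have /andP[S0 Sq] := ones_lt kq.
apply: (wp_for (B := q * 6 + L * 8 + 17) (I := fun it h1 =>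
  [/\ sound (arr h1 aTab), digits_at N L it (arr h1 aX)
    & complete_for (initial_done k (fun _ X => rk X < it)) (arr h1 aTab)])).
- split=> // S X hS' hX' [k' [kq' ES hk]]; apply: hc => //.
  by exists k'; split=> //; case: hk => [?|?|[_ ?]]; [constructor 1|constructor 2|].
- rewrite [heval _ _ _ _]/= hNP => it g hit [g1 g2 g3]; rewrite /= in g1 g2 g3; wsteps.
  have gv := digits_valid g2.
  have Lq : arr g aX L.+1 < 2 ^ q.
    have L1 : L.-1 < L by rewrite prednK.
    by have := gv _ L1; rewrite prednK // => /andP[].
  have stepR S X : valid X -> initial_done k (fun _ X => rk X < it.+1) S X ->
      initial_done k (fun _ X => rk X < it) S X \/
      (S = 2 ^ k.+1 - 1 /\ forall b, b < L -> X b.+2 = arr g aX b.+2).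
    move=> hX' [k' [kq' ES [lt|cl|[Ek]]]].
    - by left; exists k'; split=> //; constructor 1.
    - by left; exists k'; split=> //; constructor 2.
    rewrite ltnS leq_eqVlt => /orP[/eqP Er|lt]; last first.
      by left; exists k'; split=> //; constructor 3.
    by right; rewrite ES Ek; split=> //; apply: rk_eq Er.
  have tail h2 t1 t2 : ctx h2 -> t1 + t2 <= q * 6 + L * 3 + 12 -> sound (arr h2 aTab) ->
      arr h2 aX = arr g aX ->
      complete_for (initial_done k (fun _ X => rk X < it.+1)) (arr h2 aTab) ->
    wp inp E (tick ($rLen - #2)%prog) h2 (fun h0 t0 =>
      [/\ sound (arr h0 12), digits_at N L it.+1 (arr h0 18)
        & complete_for (initial_done k (fun=> (fun X => rk X < it.+1))) (arr h0 12)] /\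
      t1 + (t2 + t0) <= q * 6 + L * 8 + 17).
    move=> hh2 ht2 hs2 EX hc2; wcall (@tick_spec inp E N _ _ L it) => //=.
    - exact: tables_k (ctx_tables hh2).
    - exact: ctx_sub2 hh2.
    - by rewrite EX.
    by move=> l t [l1 l2 l3 l4 l5]; split=> //; move: l5 ht2; clear; lia.
  wcall find_row_spec => //=; [exact: (step_ctx_frame _ _ hh)|by rewrite hRS|].
  rewrite hRS => g' t [k1 k2].
  wsteps; wif => c.
    rewrite (negbTE c) in k1; case: k1 => a [aq ER Ea lt].
    wcall (@copy_spec _ a) => //=; [exact: (step_ctx_frame _ _ hh)|by rewrite hRS|].
    rewrite hRS => l t' [l1 l2].
    apply: tail => //=.
    - exact: (step_ctx_frame _ _ hh).
    - by move: k2 l2; clear; lia.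
    - by rewrite l1; apply: copy_sound; rewrite ?S0.
    - rewrite l1; apply: (copy_complete aq _ gv g3 _ stepR); first by rewrite S0.
      rewrite Ea; exists k; split=> //; constructor 3; split=> //.
      (* The last set is lowered and hence the rank, so the source was treated in an earlier
         round. *)
      rewrite -(rk_digits hit g2); apply: rank_last => //; rewrite ?prednK //.
      + by apply: valid_range; apply: valid_swap.
      + by have := gv L.-1; rewrite prednK // => /(_ (leqnn _))/andP[].
  wsteps; apply: tail => //=.
  - exact: (step_ctx_frame _ _ hh).
  - by move: k2; clear; lia.
  rewrite c eqxx in k1.
  (* No row was found, so the last set is minimal and the search has already settled the entry. *)
  have [a [l [ak kl lq El]]] := minimal_two_blocks kq Lq k1.
  move=> S X hS' hX' /(stepR _ _ hX')[hi'|[ES XX]]; first exact: g3.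
  apply: g3 => //; exists k; split=> //; constructor 2; exists a, l.
  split=> //; first by rewrite kl.
  by rewrite -El; have := XX L.-1; rewrite prednK //; apply.
- rewrite [heval _ _ _ _]/= hNP => g t [g1 g2 g3] ht; rewrite /= in g1 g2 g3; split=> //=.
  + move=> S X hS' hX' [k' [kq' ES hk]]; apply: g3 => //; exists k'; split=> //.
    case: hk => [|cl|[Ek []]]; last by constructor 2.
    rewrite ltnS leq_eqVlt => /orP[/eqP->|lt]; last by constructor 1.
    by constructor 3; split=> //; apply: (rank_lt (valid_range hX')).
  + by rewrite addnS.
Qed.

Lemma fill_initial_spec h : ctx h -> 0 < L -> sound (arr h aTab) ->
  all_marked q (arr h aTab) -> var h rNP = N ^ L ->
  wp inp E fill_initial h (fun h1 t =>
    [/\ sound (arr h1 aTab),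
        complete_for (fun S _ => exists2 k, k < q & S = 2 ^ k.+1 - 1) (arr h1 aTab)
      & t <= (q * (N ^ L * (q * 6 + L * 8 + 18) + L * 2 + 4)).+1]).
Proof.
move=> hh L0 hS hm' hNP; rewrite /fill_initial.
have hpw := tables_pw (ctx_tables hh).
apply: (wp_for (B := N ^ L * (q * 6 + L * 8 + 18) + L * 2 + 3) (I := fun k h1 =>
  sound (arr h1 aTab) /\ complete_for (initial_done k (fun _ _ => False)) (arr h1 aTab))).
- split=> // S X hS' hX' [k' [kq' -> hk]] hc.
  case: hk => [//|[a [l [ak kl El]]]|[_ []]].
  by apply: (hm' k' X a l).
- rewrite [heval _ _ _ _]/= (setup_q (ctx_setup hh)) => k g kq [g1 g2].
  rewrite /= in g1 g2; wsteps.
  wcall (@reset_spec inp E N _ _ L) => //=; first exact: ctx_sub2 hh.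
  move=> l t [l1 l2 l3 l4 l5].
  wcall (@fill_initial_range_spec _ k) => //=.
  + exact: (step_ctx_frame _ _ hh).
  + by rewrite addn1 hpw.
  move=> l' t' [k1 k2 k3]; split; first by split.
  by move: l5 k3; move: (_ * _) (_ * 2) => z1 z2; clear; lia.
- rewrite [heval _ _ _ _]/= (setup_q (ctx_setup hh)) => g t [g1 g2] ht.
  rewrite /= in g1 g2; split=> //=.
    move=> S X hS' hX' [k kq ES]; apply: g2 => //; exists k; split=> //; constructor 1 => //.
  by rewrite addnS.
Qed.

Definition fill_done S0 (Q : (nat -> nat) -> Prop) S X : Prop :=
  [\/ S < S0, exists2 k, k < q & S = 2 ^ k.+1 - 1 | S = S0 /\ Q X].

(** The source has a smaller set at [w], whatever its other sets, so any order within the range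
    would do. *)
Lemma fill_range_spec h S a : ctx h -> a.+1 < q -> swap a S < S -> S < 2 ^ q ->
  sound (arr h aTab) -> var h rNP = N ^ L -> var h rS = S ->
  var h rRow = a * 2 ^ q + 1 -> digits_at N L 0 (arr h aX) ->
  complete_for (fill_done S (fun _ => False)) (arr h aTab) ->
  wp inp E fill_range h (fun h1 t =>
    [/\ sound (arr h1 aTab), complete_for (fill_done S.+1 (fun _ => False)) (arr h1 aTab)
      & t <= (N ^ L * (L * 8 + 10)).+1]).
Proof.
move=> hh aq lt Sq hS hNP hRS hRow hX hc; rewrite /fill_range.
have S0 : 0 < S by apply: leq_ltn_trans lt.
apply: (wp_for (B := L * 8 + 9) (I := fun it h1 =>
  [/\ sound (arr h1 aTab), digits_at N L it (arr h1 aX)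
    & complete_for (fill_done S (fun X => rk X < it)) (arr h1 aTab)])).
- split=> // S' X hS' hX' hk; apply: hc => //.
  by case: hk => [?|?|[_ ?]]; [constructor 1|constructor 2|].
- rewrite [heval _ _ _ _]/= hNP => it g hit [g1 g2 g3]; rewrite /= in g1 g2 g3; wsteps.
  have gv := digits_valid g2.
  wcall (@copy_spec _ a) => //=; [exact: (step_ctx_frame _ _ hh)|by rewrite hRS|].
  rewrite hRS => l t [l1 l2].
  wcall (@tick_spec inp E N _ _ L it) => //=.
  + exact: tables_k (ctx_tables hh).
  + exact: ctx_sub2 hh.
  rewrite l1 => l' t' [k1 k2 k3 k4 k5]; split; last by move: l2 k5; clear; lia.
  split=> //; first by apply: copy_sound => //; rewrite S0.
  apply: (copy_complete aq _ gv g3); [by rewrite S0|by constructor 1|].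
  move=> S' X hX' [lt'|[k kq ES]|[ES]].
  + by left; constructor 1.
  + by left; constructor 2; exists k.
  rewrite ltnS leq_eqVlt => /orP[/eqP Er|lt']; last by left; constructor 3.
  by right; split=> //; apply: rk_eq Er.
- rewrite [heval _ _ _ _]/= hNP => g t [g1 g2 g3] ht; rewrite /= in g1 g2 g3; split=> //=.
  + move=> S' X hS' hX' hk; apply: g3 => //.
    case: hk => [|ini|[_ []]]; last by constructor 2.
    rewrite ltnS leq_eqVlt => /orP[/eqP->|lt']; last by constructor 1.
    by constructor 3; split=> //; apply: (rank_lt (valid_range hX')).
  + by rewrite addnS.
Qed.

Lemma fill_spec h : ctx h -> sound (arr h aTab) ->
  complete_for (fun S _ => exists2 k, k < q & S = 2 ^ k.+1 - 1) (arr h aTab) ->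
  var h rNP = N ^ L ->
  wp inp E fill h (fun h1 t =>
    [/\ sound (arr h1 aTab), complete_for (fun _ _ => True) (arr h1 aTab)
      & t <= (2 ^ q * (N ^ L * (L * 8 + 10) + L * 2 + 5)).+1]).
Proof.
move=> hh hS hc hNP; rewrite /fill.
apply: (wp_for (B := N ^ L * (L * 8 + 10) + L * 2 + 4) (I := fun S h1 =>
  sound (arr h1 aTab) /\ complete_for (fill_done S (fun _ => False)) (arr h1 aTab))).
- split=> // S X hS' hX' [//|ini|[_ []]]; exact: hc.
- rewrite [heval _ _ _ _]/= (tables_p2 (ctx_tables hh)) => S g Sq [g1 g2].
  rewrite /= in g1 g2; wif => c.
    have [[E0 _]|[a aq [ER lt]]] := tables_pos (ctx_tables hh) Sq; first by rewrite E0 in c.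
    wsteps; wcall (@reset_spec inp E N _ _ L) => //=; first exact: ctx_sub2 hh.
    move=> l t [l1 l2 l3 l4 l5].
    wcall (@fill_range_spec _ S a) => //=.
    + exact: (step_ctx_frame _ _ hh).
    + by move: aq; clear; lia.
    + by rewrite ER addn1.
    move=> l' t' [k1 k2 k3]; split=> //.
    by move: l5 k3; move: (_ * (_ + _)) (_ * 2) => z1 z2; clear; lia.
  wsteps; split; last by rewrite addn4.
  split=> // S' X hS' hX' hk; apply: g2 => //; case: hk => [|ini|[_ []]]; last by constructor 2.
  rewrite ltnS leq_eqVlt => /orP[/eqP ES|lt]; last by constructor 1.
  (* No transposition lowers [S], so it is an initial segment and was treated before; it is nonempty
     since [0 < S]. *)
  constructor 2; have [[_ low]|[a aq [ER _]]] := tables_pos (ctx_tables hh) Sq; last by rewrite ER in c.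
  have [|k kq Ek] := minimal_initial Sq; first by move=> b bq; apply: low; move: bq; clear; lia.
  case: k kq Ek => [|k] kq Ek; last by exists k => //; rewrite ES.
  by move: hS'; rewrite ES Ek.
- rewrite [heval _ _ _ _]/= (tables_p2 (ctx_tables hh)) => g t [g1 g2] ht.
  rewrite /= in g1 g2; split=> //=.
    move=> S X hS' hX' _; apply: g2 => //; constructor 1; by case/andP: hS'.
  by rewrite addnS.
Qed.

Lemma ranges_spec h : var h rLen = len -> var h rK = N ->
  wp inp E ranges h (fun h1 t =>
    [/\ var h1 rNP = N ^ L, var h1 rNQ = N ^ L.-1 & t <= L * (N * 2 + 6) + 4]).
Proof.
move=> hl hK; rewrite /ranges; wsteps.
apply: (wp_for (B := N * 2 + 5) (I := fun k h1 =>
  var h1 rNP = N ^ k /\ var h1 rNQ = N ^ k.-1)).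
- by [].
- rewrite [heval _ _ _ _]/= hl => k g kL [g1 g2]; rewrite /= in g1 g2; wsteps.
  apply: (wp_for (B := 1) (I := fun x h1 => var h1 rC = x * N ^ k)) => //=.
    by move=> x g' xK k1; wsteps; split=> //; rewrite k1 g1 mulSn addnC.
  by rewrite hK => g' t k1 ht; wsteps; rewrite k1 expnS; split=> //; lia.
- rewrite [heval _ _ _ _]/= hl /len subn2 => g t [g1 g2] ht; split=> //.
  by rewrite /= in ht *; move: ht; rewrite -addnS; move: (L * _) => z; clear; lia.
Qed.

(** For the component of [w], soundness and completeness at new codes are what is needed. For any
    other, neither the component, nor its codes, nor the entries at old addresses have changed. *)
Lemma tab_inv_step T : sound T -> complete_for (fun _ _ => True) T ->
  {in vertices (H i.+1), forall x f,
    {in red_component (H i.+1) x, forall y, 0 < f y < 2 ^ q} ->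
    T (code (2 ^ q) new_id (red_component (H i.+1) x) f) != 0 <->
    realizable e q (part_at s i.+1) (red_component (H i.+1) x) f}.
Proof.
move=> hS hc x xV f hf; have [uV vV uv wV] := stepP.
have hi' : trigraph_inv e (H i.+1) (part_at s i.+1) by apply: trigraph_inv_at; rewrite ?hm.
have [xC|xC] := boolP (x \in C').
  have Ex : red_component (H i.+1) x = C' := red_component_same hi' xC.
  rewrite Ex in hf *; pose X a := f (nth x0 pl a).
  have fX : {in C', f =1 vertex_sets (f (w i)) X}.
    by move=> y /C'_cases[->|[a aL ->]]; rewrite ?vertex_sets_w // vertex_sets_tl.
  have Ec : code (2 ^ q) new_id C' f = new_code (f (w i)) X.
    by rewrite new_codeE; apply: eq_bigr => y yC; rewrite fX.
  have hX : valid X.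
    by move=> a aL; apply: hf; have := mem_nth x0 aL; rewrite mem_tl in_setD1 => /andP[].
  rewrite Ec; split=> [/(sound_new hS (hf _ wC) hX)|hr].
    by move=> hr; apply: realizable_ext hr => // y yC; rewrite -fX.
  by apply: hc => //; [exact: hf|apply: realizable_ext hr].
have xVi : x \in vertices (H i).
  have := xV; rewrite HS => /verticesP[xw|]; first by rewrite xw wC in xC.
  by rewrite in_setD => /andP[].
have xm : x \notin merged (H i) (u i) (v i) (w i).
  rewrite /merged -HS -/C' in_setU in_setD1 (negbTE xC) andbF orbF.
  have := xV; rewrite HS => /verticesP[xw|]; first by rewrite xw wC in xC.
  by rewrite in_setD => /andP[].
have [_ _ Ex] := red_component_other hi es uV vV uv wV xVi xm.
rewrite -HS in Ex; rewrite -Ex in hf *.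
have neq y : y \in red_component (H i) x -> y != w i.
  move=> yC; apply: contraNneq wV => <-.
  by apply: subsetP yC; apply: red_component_sub.
have sub y : y \in red_component (H i) x -> y \in vertices (H i).
  by apply: (subsetP (red_component_sub _ _)).
have -> : code (2 ^ q) new_id (red_component (H i) x) f = code (2 ^ q) id (red_component (H i) x) f.
  by apply: eq_bigr => y yC; rewrite /new_id (negbTE (neq y yC)).
rewrite (keeps_lt (sound_old hS)); last first.
  apply: code_lt => //.
  - by move=> y z /sub yV /sub zV; apply: id_inj.
  - by move=> y /sub; apply: id_lt.
  - by move=> y /hf/andP[].
rewrite hT0 //; have EP : {in red_component (H i) x, part_at s i =1 part_at s i.+1}.
  move=> y yC; rewrite (part_atS p0) ?hm // /part_step.
  by rewrite -/(w i) (negbTE (neq y yC)).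
by split=> hr; apply: realizable_ext hr => // y /EP.
Qed.

Lemma contract_step_spec h : is_setup q s x0 m h -> is_tables q h ->
  is_record e s x0 h i pl -> var h rStep = i -> arr h aTab = T0 -> tab_inv q e s i id h ->
  wp inp E contract_step h (fun h1 t => tab_inv q e s i.+1 new_id h1 /\ t <= step_cost q L).
Proof.
move=> hs' ht hr hi' hT [i1 i2 i3 i4 i5 i6].
have [uV vV uv wV] := stepP.
have wn : w i < n + n := ltn_ord _.
have im' : i < n + n by move: im; rewrite -hm; have := size_sequence hs; clear; lia.
rewrite /contract_step /load_step; wsteps.
rewrite hi' (setup_u hs') // (setup_v hs') // (setup_w hs') // (setup_row hs') // (setup_mb hs') //.
rewrite (rec_len hr) -/p0 -/(w i).
wcall new_vertex_spec => //=; [exact: tables_p2 ht|exact: i1|].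
move=> g t [[g1 g2 g3] g4 g5]; rewrite /= in g1 g2 g3; wcall ranges_spec => //=; first exact: tables_k ht.
move=> g' t' [k1 k2 k3].
set h1 := overlay _ _ _ g'.
have hh : ctx h1.
  split=> //=.
  - by case: hs' => *; split.
  - by case: ht => *; split.
  - by case: hr => *; split.
  - move=> a X al Xq; rewrite g4.
    have aV : nth x0 pl a \in vertices (H i).
      have : nth x0 pl a \in merged_at e s x0 i by rewrite -mem_pl mem_nth.
      by apply: subsetP; apply: merged_sub.
    rewrite upd_other; last by move/val_inj => E1; move: wV; rewrite -E1 aV.
    by rewrite i2 // g3 //; apply: ltnW; rewrite ltnS; apply: i3.
  - by move=> X Xq; rewrite g4 upd_same g3.
have hS : sound (arr h1 aTab).
  rewrite /= hT; split; first split=> // a ha.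
    rewrite -hT i5 //; apply: leq_trans ha; rewrite leq_exp2l ?leq_add2l //.
    by rewrite -[1](expn0 2) ltn_exp2l.
  move=> S X /andP[S0 _] _; rewrite -hT i5 //; exact: new_code_ge.
(* The remaining programs leave weights and multiples alone, so only soundness and completeness of
   the final table are still missing. *)
have fin h3 : (var h3 rWt, var h3 rMp) = (var h1 rWt, var h1 rMp) ->
    (arr h3 aMul, arr h3 aMP) = (arr h1 aMul, arr h1 aMP) -> sound (arr h3 aTab) ->
    complete_for (fun _ _ => True) (arr h3 aTab) -> tab_inv q e s i.+1 new_id h3.
  move=> [v1 v2] [a1 a2] s3 c3.
  have VS x : x \in vertices (H i.+1) -> x = w i \/ (x != w i /\ x \in vertices (H i)).
    rewrite HS => /verticesP[|]; first by left.
    rewrite in_setD => /andP[_ xV]; right; split=> //.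
    by apply: contraNneq wV => <-.
  split.
  - by split; rewrite ?v1 ?v2 ?a1 /= addnS.
  - move=> x /VS[->|[xw xV]]; rewrite a2 /= g4 /new_id ?eqxx ?upd_same // (negbTE xw).
    by rewrite upd_other ?i2 // => /val_inj E1; rewrite E1 eqxx in xw.
  - by move=> x /VS[->|[xw xV]]; rewrite addnS /new_id ?eqxx // (negbTE xw) ltnS ltnW // i3.
  - move=> x y /VS[->|[xw xV]] /VS[->|[yw yV]] //; rewrite /new_id ?eqxx ?(negbTE xw) ?(negbTE yw).
    + by move=> E1; have := i3 y yV; rewrite -E1 ltnn.
    + by move=> E1; have := i3 x xV; rewrite E1 ltnn.
    + exact: i4.
  - by move=> a ha; apply: (keeps_zero (sound_old s3)).
  - exact: tab_inv_step s3 c3.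
wcall mark_spec => //=.
move=> l t2 [l1 l2 l3].
have tail h3 t3 : ctx h3 -> (var h3 rWt, var h3 rMp) = (var h1 rWt, var h1 rMp) ->
    (arr h3 aMul, arr h3 aMP) = (arr h1 aMul, arr h1 aMP) -> sound (arr h3 aTab) ->
    complete_for (fun S _ => exists2 k, k < q & S = 2 ^ k.+1 - 1) (arr h3 aTab) ->
    var h3 rNP = N ^ L -> t3 <= q * (N ^ L * (q * 6 + L * 8 + 18) + L * 2 + 4) + 5 ->
  wp inp E fill h3 (fun h4 t4 => tab_inv q e s i.+1 new_id h4 /\
    1 + (1 + (1 + (1 + 1))) + (1 + (t + (t' + (t2 + (t3 + t4))))) <= step_cost q L).
  move=> hh3 E1 E2 s3 c3 NP ht3; wcall fill_spec => //=.
  move=> l' t4 [k4 k5 k6]; split; first by apply: fin.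
  move: g5 k3 l3 ht3 k6; rewrite /step_cost.
  have aux z1 z2 z3 z4 z5 : t <= z1 + 10 -> t' <= z2 + 4 -> t2 <= z3 + 10 -> t3 <= z4 + 5 ->
      t4 <= z5.+1 ->
      1 + (1 + (1 + (1 + 1))) + (1 + (t + (t' + (t2 + (t3 + t4))))) <= z1 + z2 + z3 + z4 + z5 + 50.
    by clear; lia.
  exact: aux.
wsteps; wif => c.
  have L0 : 0 < L by move: c; rewrite /L; case: (size tl).
  wcall fill_initial_spec => //=; first exact: (step_ctx_frame _ _ hh).
  move=> l' t3 [k4 k5 k6]; apply: tail => //=; first exact: (step_ctx_frame _ _ hh).
  have aux z : t3 <= z.+1 -> t3 < z + 5 by clear; lia.
  exact: aux.
wsteps; apply: tail => //=; first exact: (step_ctx_frame _ _ hh).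
  have L0 : L = 0 by move: c; rewrite /L; case: (size tl).
  move=> S X hS' hX' [k kq ->] hc; apply: (l2 k X 0 k.+1) => //; first by rewrite leqnn.
  by rewrite L0.
by rewrite ltn_addl.
Qed.

End Mark.

(** * Running time *)

(** This is [(1 + 1/x)^k <= 1 + 3^k/x], freed of division. *)
Lemma succ_exp_le x k : 0 < x -> x * x.+1 ^ k <= x ^ k * (x + 3 ^ k).
Proof.
move=> x0; elim: k => [|k IH]; first by rewrite !expn0 !muln1 mul1n addn1.
have step : (x + 3 ^ k) * x.+1 <= x * (x + 3 ^ k.+1).
  by have := expn_gt0 3 k; rewrite expnS; move: (3 ^ k) => y; nia.
apply: leq_trans (_ : x ^ k * (x + 3 ^ k) * x.+1 <= _).
  by rewrite expnSr mulnA leq_mul2r IH orbT.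
by rewrite -mulnA expnSr -[in X in _ <= X]mulnA leq_mul2l step orbT.
Qed.

Lemma poly_exp k a : exists K, forall q, q.+1 ^ k * a ^ q <= K * a.+1 ^ q.
Proof.
(* From [Q] on, [F] grows by a factor of at most [a + 1] per step, no faster than [a.+1 ^ q]; the
   sum of the values up to [Q] takes care of the rest. *)
pose Q := a * 3 ^ k; pose F q := q.+1 ^ k * a ^ q.
exists (\sum_(q < Q.+1) F q) => q; set K := \sum_(q < _) _.
have small p : p <= Q -> F p <= K * a.+1 ^ p.
  move=> pQ; have lt : p < Q.+1 by [].
  apply: leq_trans (leq_pmulr _ _); last by rewrite expn_gt0.
  by rewrite /K (bigD1 (Ordinal lt)) //= leq_addr.
rewrite -/(F q); case: (leqP q Q) => [/small//|Qq].
rewrite -(subnKC (ltnW Qq)); elim: (q - Q) => [|p IH]; first by rewrite addn0 small.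
rewrite addnS; move: IH; set x := Q + p; move=> IH.
have Qx : Q <= x.+1 by rewrite leqW // leq_addr.
rewrite -(leq_pmul2l (ltn0Sn x)) /F.
apply: leq_trans (_ : x.+1 ^ k * (x.+1 + 3 ^ k) * a ^ x.+1 <= _).
  by rewrite mulnA leq_mul2r succ_exp_le ?orbT.
apply: leq_trans (_ : F x * (a.+1 * x.+1) <= _).
  rewrite /F !expnS -!mulnA leq_mul2l; apply/orP; right.
  rewrite [leqLHS]mulnA [leqLHS]mulnC leq_mul2l; apply/orP; right.
  by move: Qx; rewrite /Q; move: (3 ^ k) => y; nia.
rewrite mulnA [_ * (K * _)]mulnC leq_mul2r /= expnS mulnCA [F x * _]mulnC leq_mul2l.
by rewrite IH.
Qed.

Lemma pow2_le q : 0 < q -> 2 ^ q <= 2 * (2 ^ q - 1).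
Proof. move=> q0; have : 2 ^ 1 <= 2 ^ q by rewrite leq_exp2l.
by lia. Qed.

Lemma mark_cost_le q Z R : 0 < Z -> 0 < R ->
  q * (8 * Z + q.+1 * (q.+1 * 4 + 2) + q.+1 * (q * (Z * R + 3) + 2) + 10) <=
  30 * (q.+1 ^ 3 * (Z * R)).
Proof.
move=> Z0 R0; have Zy : Z <= Z * R by apply: leq_pmulr.
have y0 : 0 < Z * R by rewrite muln_gt0 Z0.
move: (Z * R) Zy y0 => y Zy y0.
rewrite !expnS expn0 muln1; set a := q.+1; have qa : q <= a by [].
have a0 : 0 < a by []. clearbody a.
have aa : a <= a * a by apply: leq_pmulr.
have ay : y <= a * a * y by rewrite leq_pmull // muln_gt0 a0.
have aay : a * a <= a * a * y by apply: leq_pmulr.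
have A1 : 8 * Z <= 8 * (a * a * y) by rewrite leq_mul2l (leq_trans Zy ay).
have A2 : a * (a * 4 + 2) <= 6 * (a * a * y).
  have -> : a * (a * 4 + 2) = 4 * (a * a) + 2 * a by clear; lia.
  by move: aa aay; move: (a * a * y) (a * a) => b c; clear; lia.
have A3 : a * (q * (y + 3) + 2) <= 6 * (a * a * y).
  have : q * (y + 3) + 2 <= 6 * (a * y).
    have : q * (y + 3) <= a * (4 * y) by apply: leq_mul => //; lia.
    have : 1 <= a * y by rewrite muln_gt0 a0.
    by move: (q * _) => z; nia.
  by move=> h; rewrite -mulnA mulnCA leq_mul2l h orbT.
have A4 : 10 <= 10 * (a * a * y) by rewrite leq_pmulr // !muln_gt0 a0.
have : 8 * Z + a * (a * 4 + 2) + a * (q * (y + 3) + 2) + 10 <= 30 * (a * a * y).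
  by move: A1 A2 A3 A4; move: (a * a * y) (a * (_ + 2)) (a * (_ + 2)) => b c f; clear; lia.
move=> h; apply: leq_trans (leq_mul qa h) _.
by rewrite !mulnA [a * 30]mulnC.
Qed.

(** The loops over [k], [a] and [l] give [q^3]. For [L = 0] the quadratically many pairs make it
    [q^5], within a constant times [N]. For [L > 0] the [3^q] pairs make it at most a constant times
    [4^q], hence times [N^2], which turns [N ^ (L - 1)] into [N ^ (L + 1)]. *)
Lemma mark_total_bound : exists K, forall q L, 1 < q ->
  q.+1 ^ 3 * ((if L == 0 then q.+1 * q.+1 else 3 ^ q) *
    ((2 ^ q - 1) ^ L.-1 * (40 * L.+2 ^ 2) + 12)) <= K * ((2 ^ q - 1) ^ L.+1 * L.+2 ^ 2).
Proof.
have [K1 h1] := poly_exp 5 1; have [K2 h2] := poly_exp 3 3.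
exists (52 * (2 * K1 + 4 * K2)) => q L q1.
have P := pow2_le (ltnW q1); set N := 2 ^ q - 1 in P *.
have N0 : 0 < N by move: P; have := expn_gt0 2 q; clear; lia.
have R : N ^ L.-1 * (40 * L.+2 ^ 2) + 12 <= 52 * (N ^ L.-1 * L.+2 ^ 2).
  have : 0 < N ^ L.-1 * L.+2 ^ 2 by rewrite muln_gt0 expn_gt0 N0 expn_gt0.
  by rewrite mulnCA; move: (_ * _) => z; clear; lia.
suff A : q.+1 ^ 3 * (if L == 0 then q.+1 * q.+1 else 3 ^ q) * N ^ L.-1 <=
    (2 * K1 + 4 * K2) * N ^ L.+1.
  apply: leq_trans (_ : q.+1 ^ 3 * ((if L == 0 then q.+1 * q.+1 else 3 ^ q) *
      (52 * (N ^ L.-1 * L.+2 ^ 2))) <= _); first by rewrite !leq_mul2l R !orbT.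
  rewrite -[leqRHS]mulnA [leqRHS]mulnA.
  move: A; move: (q.+1 ^ 3) (if _ then _ else _) (N ^ L.-1) (N ^ L.+1) (L.+2 ^ 2) (2 * K1 + 4 * K2).
  by clear => a b c f g k; nia.
case: L {R} => [|L] /=.
  rewrite expn1 expn0 muln1; have := h1 q; rewrite exp1n muln1 => h.
  have -> : q.+1 ^ 3 * (q.+1 * q.+1) = q.+1 ^ 5 by rewrite mulnn -expnD.
  apply: leq_trans h _; apply: leq_trans (_ : K1 * (2 * N) <= _); first by rewrite leq_mul2l P orbT.
  by clear; nia.
have E4 : 4 ^ q = 2 ^ q * 2 ^ q by rewrite -expnMn.
have h : q.+1 ^ 3 * 3 ^ q <= K2 * (4 * (N * N)).
  apply: leq_trans (h2 q) _; rewrite leq_mul2l E4; apply/orP; right.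
  by apply: leq_trans (leq_mul P P) _; clear; lia.
apply: leq_trans (leq_mul h (leqnn _)) _; rewrite [N ^ L.+2]expnS [N ^ L.+1]expnS.
move: (N ^ L) => b; rewrite (_ : (_ + _) * _ = K2 * (4 * (N * N)) * b + 2 * K1 * (N * (N * b))).
  exact: leq_addr.
by clear; lia.
Qed.

(** The exponent [L + 1] is the size of the new component, which is at most [d]. *)
Lemma step_cost_bound : exists K, forall q L, 1 < q ->
  step_cost q L <= K * ((2 ^ q - 1) ^ L.+1 * L.+2 ^ 2).
Proof.
have [K1 h1] := mark_total_bound; have [K2 h2] := poly_exp 2 1.
exists (8 + 8 + 30 * K1 + 40 * K2 + 40 + 50) => q L q1; rewrite /step_cost.
have P := pow2_le (ltnW q1); set N := 2 ^ q - 1 in P *.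
have N0 : 0 < N by move: P; have := expn_gt0 2 q; clear; lia.
have NL : 0 < N ^ L by rewrite expn_gt0 N0.
have G0 : N <= N ^ L.+1 by rewrite expnS leq_pmulr.
have B1 : 2 ^ q * 4 <= 8 * (N ^ L.+1 * L.+2 ^ 2).
  have : N * 1 <= N ^ L.+1 * L.+2 ^ 2 by apply: leq_mul => //; rewrite expn_gt0.
  by move: P; move: (_ * L.+2 ^ 2) => z; clear; lia.
have B2 : L * (N * 2 + 6) <= 8 * (N ^ L.+1 * L.+2 ^ 2).
  have : L * N <= L.+2 ^ 2 * N ^ L.+1 by apply: leq_mul => //; rewrite -mulnn; lia.
  have : L * (N * 2 + 6) <= 8 * (L * N) by move: N0; clear; nia.
  by rewrite [L.+2 ^ 2 * _]mulnC; move: (_ * L.+2 ^ 2) => z; clear; lia.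
have B3 : q * (8 * (if L == 0 then q.+1 * q.+1 else 3 ^ q) + q.+1 * (q.+1 * 4 + 2)
    + q.+1 * (q * ((if L == 0 then q.+1 * q.+1 else 3 ^ q) *
        (N ^ L.-1 * (40 * L.+2 ^ 2) + 12) + 3) + 2) + 10) <=
    30 * K1 * (N ^ L.+1 * L.+2 ^ 2).
  apply: leq_trans (mark_cost_le _ _ _) _.
  - by case: ifP => _; rewrite ?muln_gt0 ?expn_gt0.
  - by rewrite ltn_addl.
  - by rewrite -mulnA leq_mul2l h1.
have B4 : q * (N ^ L * (q * 6 + L * 8 + 18) + L * 2 + 4) <= 40 * K2 * (N ^ L.+1 * L.+2 ^ 2).
  have C : N ^ L * (q * 6 + L * 8 + 18) + L * 2 + 4 <= 20 * (q.+1 * (N ^ L * L.+2 ^ 2)).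
    rewrite -mulnn; move: (N ^ L) NL => y y0.
    have : q * 6 + L * 8 + 18 + L * 2 + 4 <= 20 * (q.+1 * (L.+2 * L.+2)) by clear; nia.
    by move: (q.+1 * (L.+2 * L.+2)) => z; move: y0; clear; nia.
  apply: leq_trans (leq_mul (leqnSn q) C) _.
  have := h2 q; rewrite exp1n muln1 -mulnn => h.
  have : q.+1 * q.+1 <= K2 * (2 * N) by apply: leq_trans h _; rewrite leq_mul2l P orbT.
  rewrite [N ^ L.+1]expnS -(mulnA N); move: (N ^ L * L.+2 ^ 2) => z A.
  have e1 a : a * (20 * (a * z)) = a * a * (20 * z) by clear; lia.
  have e2 M : 40 * K2 * (M * z) = K2 * (2 * M) * (20 * z) by clear; lia.
  by rewrite e1 e2; apply: leq_mul.
have B5 : 2 ^ q * (N ^ L * (L * 8 + 10) + L * 2 + 5) <= 40 * (N ^ L.+1 * L.+2 ^ 2).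
  have C : N ^ L * (L * 8 + 10) + L * 2 + 5 <= 20 * (N ^ L * L.+2 ^ 2).
    by rewrite -mulnn; move: (N ^ L) NL => y y0; clear - y0; nia.
  apply: leq_trans (leq_mul P C) _; rewrite [N ^ L.+1]expnS -(mulnA N).
  by move: (_ * L.+2 ^ 2) => z; clear; lia.
have B6 : 50 <= 50 * (N ^ L.+1 * L.+2 ^ 2) by rewrite leq_pmulr // muln_gt0 !expn_gt0 N0.
by rewrite 5!(mulnDl _ _ (N ^ L.+1 * L.+2 ^ 2)); exact: (leq_add (leq_add (leq_add (leq_add (leq_add B1 B2) B3) B4) B5) B6).
Qed.

Definition dp_cost (q n d B : nat) : nat :=
  (n * 20 + 20) + 40 * (q * 2 ^ q) + (n * (2 ^ q * 4 + q * 2 + 20) + 10)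
  + (n * (60 * d.+1 ^ 3 + 10) + 20) + n * (B + 2) + 2 ^ q * 4 + 30.

(** * The whole program *)

Section Coloring.
Variables (q n : nat) (e : rel 'I_n) (s : seq (name n * name n * name n))
  (x0 : name n) (m d E : nat).
Hypotheses (q0 : 0 < q) (es : symmetric e) (ei : irreflexive e)
  (hs : contraction_sequence (trigraph_of_graph e) s)
  (hm : size s = m) (hE : 2 + (m * 3 + n * ((n + n) * (n + n))) <= E)
  (hd : all (red_components_le d) (trigraphs (trigraph_of_graph e) s)).

Let p0 := (x0, x0, x0).
Let inp := nth 0 (encode q e s).
Let n0 : n = m.+1. Proof. by rewrite -hm (size_sequence hs). Qed.
Let nm1 : n - 1 = m. Proof. by rewrite n0 subn1. Qed.

Lemma forward_spec h B : is_setup q s x0 m h -> is_tables q h ->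
  (forall i, i < m -> exists pl, is_record e s x0 h i pl /\ size pl <= d.+1) ->
  tab_inv q e s 0 (fun x => x) h ->
  (forall L, L.+2 <= d.+1 -> step_cost q L <= B) ->
  wp inp E forward h (fun h1 t =>
    (exists id, tab_inv q e s m id h1) /\ t <= (m * B.+1).+1).
Proof.
move=> h1 h2 h3 h4 hB; rewrite /forward.
apply: (wp_for (B := B) (I := fun i g => exists id, tab_inv q e s i id g)).
- by exists (@nat_of_ord (n + n)).
- rewrite [heval _ _ _ _]/= (setup_n h1) nm1 => i g im [id hi].
  have [pl [hr hsz]] := h3 i im.
  have [tl Epl] := rec_head hr; subst pl.
  have hT0 := ti_tab hi.
  wcall (@contract_step_spec _ _ _ _ _ _ _ q0 es ei hs hm hE i tl id) => //=.
  + exact: rec_uniq hr.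
  + exact: rec_mem hr.
  + exact: ti_id hi.
  + exact: ti_inj hi.
  + exact: hT0.
  + by case: h1 => *; split.
  + by case: h2 => *; split.
  + by case: hr => *; split.
  + by case: hi => *; split.
  move=> g' t [k1 k2]; split; last by apply: leq_trans k2 _; apply: hB.
  by exists (new_id s x0 i id).
- rewrite [heval _ _ _ _]/= (setup_n h1) nm1 => g t [id hi] ht; split=> //.
  by exists id; case: hi => *; split.
Qed.

Lemma answer_spec h id : is_setup q s x0 m h -> is_tables q h -> 0 < m ->
  tab_inv q e s m id h ->
  wp inp E answer h (fun h1 t => var h1 rAns = colorable q e :> nat /\ t <= 2 ^ q * 3 + 3).
Proof.
move=> h1 h2 m0 hi; rewrite /answer; wsteps.
have nm2 : n - 2 = m.-1 by rewrite n0; lia.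
have m1 : m.-1 < m by rewrite prednK.
rewrite (setup_n h1) nm2 (setup_w h1) // -/p0.
pose z := sw s p0 m.-1; rewrite -/z.
have Vz : vertices (trigraph_at e s m) = [set z].
  by have := vertices_last hs p0; rewrite hm => /(_ m0).
have zV : z \in vertices (trigraph_at e s m) by rewrite Vz inE.
have Cz : red_component (trigraph_at e s m) z = [set z].
  apply/setP => y; apply/idP/idP; last by rewrite inE => /eqP->; apply: mem_red_component.
  by move/(subsetP (red_component_sub _ _)); rewrite Vz.
pose real X := realizable e q (part_at s m) [set z] (fun _ => X).
(* One vertex is left, whose part is the whole graph: its entries are the exact colour sets of
   proper colourings. *)
have entry X : 0 < X < 2 ^ q -> arr h aTab (arr h aMul (arr h aMP z + X)) != 0 <-> real X.
  move=> hX; have [_ _ mul] := ti_mul hi.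
  rewrite (ti_mp hi) // mul; [|by apply: (ti_id hi)|by case/andP: hX].
  have := @ti_tab _ _ _ _ _ _ _ hi z zV (fun=> X); rewrite Cz /code big_set1; apply.
  by [].
apply: (wp_for (B := 2) (I := fun k h1 => (var h1 rAns = 0 \/ var h1 rAns = 1) /\
  (var h1 rAns != 0 <-> exists2 X, 0 < X <= k & real X))).
- by split; [left|split=> // -[[|X]]].
- rewrite [heval _ _ _ _]/= (tables_k h2) => k g kN [g1 g2]; rewrite /= in g1 g2.
  have kq : 0 < k + 1 < 2 ^ q by move: kN; clear; lia.
  wif => c; wsteps; split=> //; split=> //=; [by right| |].
    by split=> // _; exists k.+1; [rewrite ltnS leqnn|rewrite -addn1; apply/entry].
  rewrite g2; split=> -[X /andP[X0 Xk] hX]; exists X => //; first by rewrite X0 leqW.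
  move: Xk; rewrite X0 leq_eqVlt => /orP[/eqP EX|//].
  by move: hX; rewrite EX -addn1 => /(entry _ kq); rewrite c.
- rewrite [heval _ _ _ _]/= (tables_k h2) => g t [g1 g2] ht; rewrite /= in g1 g2 *.
  split; last by move: ht; clear; lia.
  suff : (var g rAns != 0) = colorable q e by case: g1 => ->; case: (colorable _ _).
  apply/idP/idP.
    move/g2 => [X /andP[X0 Xq] hX]; apply/(colorableP es ei hs); exists (fun=> X).
      by move=> _; move: Xq; clear; have := expn_gt0 2 q; lia.
    by rewrite hm Vz.
  move/(colorableP es ei hs) => [f hf]; rewrite hm Vz => hr; apply/g2; exists (f z).
    have hi' : trigraph_inv e (trigraph_at e s m) (part_at s m).
      by apply: trigraph_inv_at => //; rewrite hm.
    have -> /= : 0 < f z by apply: (realizable_gt0 hr); [rewrite inE|exact: (part_neq0 hi' zV)].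
    by have := hf z; clear; lia.
  by apply: realizable_ext hr => // y; rewrite inE => /eqP->.
Qed.

Definition total_cost B : nat :=
  if q < n then (if q == 1 then n * 30 + 40 else dp_cost q n d B) else n * 20 + 30.

Lemma coloring_spec B : (1 < q -> forall L, L.+2 <= d.+1 -> step_cost q L <= B) ->
  wp inp E coloring empty_store (fun h1 t =>
    var h1 rAns = colorable q e :> nat /\ t <= total_cost B).
Proof.
move=> hB; rewrite /coloring /total_cost; wsteps; wcall (@setup_spec q n e s x0 m E) => //=.
move=> g t [g1 g2]; have Eq := setup_q g1; have En := setup_n g1; rewrite /= in Eq En.
wif; rewrite En Eq => c; last first.
  have nq : n <= q by rewrite -subn_eq0 c.
  wsteps; rewrite colorable_widen // ltnNge nq /=; split=> //; by move: g2; clear; lia.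
have qn : q < n by rewrite -subn_gt0 lt0n.
rewrite qn; wif; rewrite Eq => c1; last first.
  have q1 : q = 1 by move: q0 c1; clear; lia.
  rewrite (introT eqP q1); wcall (@edgeless_spec q n e s x0 m E) => //=.
  move=> g' t' [k1 k2]; rewrite k1 q1 colorable1; split=> //.
  by move: g2 k2; clear; lia.
have q2 : 1 < q by move: c1; clear; lia.
rewrite (gtn_eqF q2); have m0 : 0 < m by move: qn q2; rewrite n0; clear; lia.
wcall (@tables_spec q inp E) => //=.
move=> k1 t1 [a1 b1]; wcall (@leaves_spec q n e s inp E) => //=.
move=> k2 t2 [a2 b2]; wcall (@backward_spec q n e s x0 m d E) => //=.
- by case: g1 => *; split.
move=> k3 t3 [a3 b3]; wcall (@forward_spec _ B) => //=.
- by case: g1 => *; split.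
- by case: a1 => *; split.
- by case: a2 => *; split.
- exact: hB.
move=> k4 t4 [[id a4] b4]; wcall (@answer_spec _ id) => //=.
- by case: g1 => *; split.
- by case: a1 => *; split.
move=> k5 t5 [a5 b5]; split=> //; rewrite /dp_cost.
have b4' : t4 <= n * (B + 2) by apply: leq_trans b4 _; rewrite n0; clear; nia.
have aux z1 z2 z3 z4 z5 z6 : t <= z1 -> t1 <= z2 -> t2 <= z3 -> t3 <= z4 -> t4 <= z5 ->
   t5 <= z6 * 3 + 3 -> t + (t1 + (t2 + (t3 + (t4 + t5)))).+2 <= z1 + z2 + z3 + z4 + z5 + z6 * 4 + 30.
  by clear; lia.
exact: aux.
Qed.

End Coloring.

(** * An address above the input *)

Definition doubling : com :=
  While (Reg 2) (Seq (Assign 1 (Add (Reg 1) (Reg 1))) (Assign 2 (Defs.Sub (Reg 2) (Lit 1)))).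

(* Leaves in register 1 an address above the input: the encoded instance has
   fewer than 64 * 2 ^ n cells. *)
Definition prologue : com :=
  Seq (Assign 1 (Lit 64)) (Seq (Assign 2 (Defs.Mem (Lit 1))) doubling).

Lemma doubling_exec k st : reg st 2 = k ->
  exists t st', [/\ exec doubling st t st', reg st' 1 = reg st 1 * 2 ^ k, reg st' 2 = 0,
    (forall r, 2 < r -> reg st' r = reg st r) & Defs.mem st' = Defs.mem st /\ t <= k * 10 + 2].
Proof.
elim: k st => [|k IH] st hk.
  exists 2, st; split=> //; first exact: ExecWhileFalse.
  by rewrite muln1.
pose st1 := State (update (reg st) 1 (reg st 1 + reg st 1)) (Defs.mem st).
pose st2 := State (update (reg st1) 2 (reg st1 2 - 1)) (Defs.mem st).
have h2 : reg st2 2 = k by rewrite /= /update /= hk subn1.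
have [t [st' [h3 h4 h5 h6 [h7 h8]]]] := IH st2 h2.
exists (2 + (4 + 4) + t), st'; split=> //.
- apply: (@ExecWhileTrue _ _ _ st2) => //=; first by rewrite hk.
  by apply: (@ExecSeq _ _ _ st1); [exact: (ExecAssign st 1)|exact: (ExecAssign st1 2)].
- by rewrite h4 /= /update /= expnS mulnA muln2 addnn.
- by move=> r hr; rewrite h6 //= /update; case: eqP => [r2|_]; [lia|case: eqP => // r1; lia].
Qed.

(** A power of two exceeds the cube up to a constant and takes only [n] doublings; as addresses are
    unbounded, the excess is free. *)
Lemma size_input n m : n = m.+1 -> 2 + (m * 3 + n * ((n + n) * (n + n))) <= 64 * 2 ^ n.
Proof.
move=> ->; have cube k : k.+1 ^ 3 <= 8 * 2 ^ k.
  case: k => [|[|[|k]]] //; elim: k => [|k IH] //.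
  rewrite [2 ^ _]expnS mulnCA; apply: leq_trans (_ : 2 * k.+4 ^ 3 <= _).
    by rewrite !expnS expn0; clear; nia.
  by rewrite leq_mul2l.
have := cube m.+1; rewrite !expnS expn0; move: (2 ^ m) => z; clear; nia.
Qed.

Lemma total_cost_bound K0 : exists K, forall q n d, 0 < q -> 0 < n -> 0 < d ->
  total_cost q n d (K0 * ((2 ^ q - 1) ^ d * d.+1 ^ 2)) <= K * ((2 ^ q - 1) ^ d * d ^ 2 * n).
Proof.
(* One summand for each summand of [dp_cost], in the same order; the factor 4 comes from
   [(d + 1)^2 <= 4 d^2]. *)
exists (40 + 80 + 42 + 510 + (4 * K0 + 2) + 8 + 30) => q n d q0 n0 d0.
have P := pow2_le q0; set N := 2 ^ q - 1 in P *.
have N0 : 0 < N by move: P; have := expn_gt0 2 q; clear; lia.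
set y := N ^ d * d ^ 2.
have Ny : N <= y.
  by rewrite -[N]muln1; apply: leq_mul; rewrite ?expn_gt0 ?d0 // -{1}[N]expn1 leq_pexp2l.
have y0 : 0 < y by apply: leq_trans Ny.
have nG : n <= y * n by apply: leq_pmull.
have G0 : 0 < y * n by rewrite muln_gt0 y0.
have [c Ec] : exists c, c = 4 * K0 + 2 by eexists.
rewrite -Ec !(mulnDl _ _ (y * n)) /total_cost; case: ltnP => qn; last first.
  by move: nG G0; move: (y * n) => G; clear; lia.
case: eqP => [_|q1]; first by move: nG G0; move: (y * n) => G; clear; lia.
have q2 : 1 < q by move: q0 q1; clear; lia.
have N2 : 1 < N.
  have : 2 ^ 2 <= 2 ^ q by rewrite leq_exp2l.
  by rewrite /N; clear; lia.
have NG : N * n <= y * n by rewrite leq_mul2r Ny orbT.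
have qP : q < 2 ^ q by apply: ltn_expl.
rewrite /dp_cost.
apply: leq_add; [apply: leq_add; [apply: leq_add; [apply: leq_add; [apply: leq_add;
  [apply: leq_add|]|]|]|]|].
- by move: nG G0; move: (y * n) => G; clear; lia.
- apply: leq_trans (_ : 40 * (n * (2 * N)) <= _).
    by rewrite leq_mul2l leq_mul // ltnW.
  by move: NG; move: (y * n) => G; clear; lia.
- have A : 2 ^ q * 4 + q * 2 + 20 <= 32 * N by move: P qP N0; clear; lia.
  have := leq_mul (leqnn n) A; move: NG G0; move: (y * n) (_ + 20) => G z; clear; nia.
- have A : d.+1 ^ 3 <= 8 * y.
    have dN : d <= N ^ d by apply: ltnW; apply: ltn_expl.
    have : d * d ^ 2 <= y by rewrite leq_mul2r dN orbT.
    by move: d0; clear; rewrite !expnS !expn0; move: y => y; nia.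
  have : n * (60 * d.+1 ^ 3 + 10) <= n * (490 * y).
    by rewrite leq_mul2l; apply/orP; right; move: A y0; move: (_ ^ 3) => z; clear; lia.
  by move: G0; rewrite [y * n]mulnC; move: (n * (_ + _)) => z; clear; nia.
- have A : K0 * (N ^ d * d.+1 ^ 2) + 2 <= c * y.
    have : N ^ d * d.+1 ^ 2 <= 4 * y.
      by rewrite /y mulnCA leq_mul2l; apply/orP; right; move: d0; rewrite -!mulnn; clear; nia.
    by rewrite Ec; move: y0; move: (N ^ d * d.+1 ^ 2) => z; clear; nia.
  by rewrite [c * _]mulnA [c * y * n]mulnC leq_mul2l A orbT.
- have : N <= y * n by apply: leq_trans Ny (leq_pmulr _ n0).
  by move: P; move: (y * n) => G; clear; lia.
- by rewrite leq_pmulr.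
Qed.


Theorem theorem3p5 :
  exists (algo : com) (K : nat),
    forall (q n d : nat) (e : rel 'I_n) (s : seq (name n * name n * name n)),
      0 < q ->
      symmetric e -> irreflexive e ->
      contraction_sequence (trigraph_of_graph e) s ->
      all (red_components_le d) (trigraphs (trigraph_of_graph e) s) ->
      exists (t : nat) (final : state),
        [/\ exec algo (initial_state (encode q e s)) t final,
            reg final 0 = colorable q e :> nat
          & t <= K * ((2 ^ q - 1) ^ d * d ^ 2 * n)].
Proof.
have [K0 hK0] := step_cost_bound; have [K1 hK1] := total_cost_bound K0.
exists (Seq prologue (Seq (compile coloring) (Assign 0 (Reg (rvar rAns))))).
(* The 30 pays for the prologue, linear in [n], and for moving the answer to register 0; the rest is
   compiled time. *)
exists (30 + overhead coloring * K1) => q n d e s q0 es ei hs hd.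
have n0 : n = (size s).+1 by rewrite (size_sequence hs).
have n_gt0 : 0 < n by rewrite n0.
have x0 : name n by apply: Ordinal (_ : 0 < n + n); rewrite addn_gt0 n_gt0.
(* The bound must not vanish, as even the prologue takes time; the component of any vertex shows
   that [d] is positive. *)
have d0 : 0 < d.
  have [x xV] : exists x, x \in vertices (trigraph_at e s 0).
    by apply/set0Pn; rewrite -card_gt0; have := card_at hs (leq0n _); rewrite addn0 => ->.
  apply: leq_trans (component_size hd (leq0n _) xV); rewrite card_gt0.
  by apply/set0Pn; exists x; apply: mem_red_component.
pose E := 64 * 2 ^ n; have hE := size_input n0; rewrite -/E in hE.
pose st0 := initial_state (encode q e s).
pose st1 := State (update (reg st0) 1 64) (Defs.mem st0).
pose st2 := State (update (reg st1) 2 n) (Defs.mem st0).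
have [t1 [st3 [X1 R1 R2 R3 [M1 T1]]]] := @doubling_exec n st2 erefl.
have X2 : exec prologue st0 (2 + (3 + t1)) st3.
  apply: (@ExecSeq _ _ _ st1); first exact: (ExecAssign st0 1 (Lit 64)).
  by apply: (@ExecSeq _ _ _ st2) X1; apply: (ExecAssign st1 2 (Defs.Mem (Lit 1))).
have R : represents (nth 0 (encode q e s)) E empty_store st3.
  split.
  - by rewrite R1.
  (* Register 2, the counter of the prologue, is also variable 0; it has returned to 0. *)
  - case=> [|v]; first exact: R2.
    by rewrite R3 //= /update /= /rvar; do 2!(case: eqP => [|_]; first by lia).
  (* Beyond the encoded input the memory is zero, as are all arrays of the empty store. *)
  - move=> a; rewrite M1 /raw /=; case: ltnP => // aE.
    by apply: nth_default; rewrite (size_encode hs); apply: leq_trans hE aE.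
have [t2 [st4 [X4 [_ R4 _] T4 _]]] := compileP wf_coloring R.
have hB : 1 < q -> forall L, L.+2 <= d.+1 ->
    step_cost q L <= K0 * ((2 ^ q - 1) ^ d * d.+1 ^ 2).
  move=> q1 L Ld; apply: leq_trans (hK0 q L q1) _.
  rewrite leq_mul2l; apply/orP; right; apply: leq_mul; last by rewrite leq_exp2r.
  by rewrite leq_pexp2l //; have : 2 ^ 1 <= 2 ^ q; [rewrite leq_exp2l // ltnW|lia].
have [ans cost] := coloring_spec x0 q0 es ei hs erefl hE hd hB.
exists (2 + (3 + t1) + (t2 + 2)), (State (update (reg st4) 0 (reg st4 (rvar rAns))) (Defs.mem st4)).
split.
- by apply: ExecSeq X2 _; apply: ExecSeq X4 _; apply: ExecAssign.
- by rewrite /= /update eqxx R4 ans.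
- have c1 := leq_trans T4 (leq_mul (leqnn (overhead coloring)) (leq_trans cost (hK1 q n d q0 n_gt0 d0))).
  have G0 : n <= (2 ^ q - 1) ^ d * d ^ 2 * n.
    rewrite leq_pmull // muln_gt0 !expn_gt0 d0 andbT; apply/orP; left.
    by rewrite subn_gt0 -[1](expn0 2) ltn_exp2l.
  rewrite mulnDl -(mulnA (overhead coloring)); move: c1 G0 T1 n_gt0.
  move: ((2 ^ q - 1) ^ d * d ^ 2 * n) => G; move: (overhead coloring * _) => z.
  by clear; lia.
Qed.
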